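(* Let $M\ge 1$ be an integer, $\alpha,\beta,\omega,A_0,h_l,\mathcal R_t>0$, $c=\frac{e}{2\pi}$, and set $q^*=\min(\alpha,\beta,\omega)$, $p^*=\max(\alpha,\beta,\omega)$, $r^*=\mathrm{med}(\alpha,\beta,\omega)$ (the median), with $q^*<r^*$. For each $\bar\gamma>0$, let $\gamma_1,\dots,\gamma_M$ be independent, each with density $$f_{\gamma}(x)=\frac{\sqrt{\omega}}{2x\,\Gamma(\alpha)\Gamma(\beta)}\,G^{3,0}_{1,3}\!\left(\frac{\alpha\beta}{A_0h_l}\sqrt{\frac{x}{\bar\gamma}}\,\middle|\,\begin{matrix}\omega+\tfrac12\\ \alpha,\ \beta,\ \omega\end{matrix}\right),\qquad x>0,$$ and put $\Phi_{\bar\gamma,\mathcal R_t}=\frac{\alpha\beta}{A_0h_l}\sqrt{\frac{2^{2\mathcal R_t/M}-1}{c\,\bar\gamma}}$. Then the outage probability of HARQ with incremental redundancy, $P^{\mathrm{ir}}_{o,M}(\mathcal R_t)=\mathbb P\!\left(\sum_{m=1}^M\log_2(1+c\gamma_m)<2\mathcal R_t\right)$, is bounded above by $$P^{\mathrm{ir,ub}}_{o,M}(\mathcal R_t)=\left(\frac{\sqrt{\omega}}{\Gamma(\alpha)\Gamma(\beta)}\right)^{M}G^{3M,1}_{M+1,3M+1}\!\left(\Phi_{\bar\gamma,\mathcal R_t}^{M}\,\middle|\,\begin{matrix}1,\ \{\omega+\tfrac12\}_1^M\\ \{\alpha\}_1^M,\ \{\beta\}_1^M,\ \{\omega\}_1^M,\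 0\end{matrix}\right),$$ and as $\bar\gamma\to\infty$ this upper bound satisfies $$P^{\mathrm{ir,ub}}_{o,M}(\mathcal R_t)\sim\frac{M^{M-1}}{q^*(M-1)!}\left(\frac{\sqrt{\omega}\,\Gamma(p^*-q^* )\,\Gamma(r^*-q^* )}{\Gamma(\alpha)\Gamma(\beta)\,\Gamma\!\left(\omega-q^*+\frac12\right)}\right)^{M}\left(-\ln\Phi_{\bar\gamma,\mathcal R_t}\right)^{M-1}\Phi_{\bar\gamma,\mathcal R_t}^{\,Mq^*},$$ where $\sim$ means that the ratio of the two sides tends to $1$.
   Context: $\{x\}_1^M$ denotes $x$ repeated $M$ times. Meijer $G$-function convention: $G^{m,n}_{p,q}\!\left(x\,\middle|\,\begin{matrix}a_1,\dots,a_p\\ b_1,\dots,b_q\end{matrix}\right)=\frac{1}{2\pi i}\int_L\frac{\prod_{j=1}^m\Gamma(b_j-s)\prod_{j=1}^n\Gamma(1-a_j+s)}{\prod_{j=m+1}^q\Gamma(1-b_j+s)\prod_{j=n+1}^p\Gamma(a_j-s)}x^s\,ds$, where $L$ is a vertical contour (upward) separating the poles of the $\Gamma(b_j-s)$, $j\le m$ (to its right), from those of the $\Gamma(1-a_j+s)$, $j\le n$ (to its left). The function $f_\gamma$ is an approximate density used as if exact (it is nonnegative but need not integrate exactly to $1$); accordingly, $\mathbb P((\gamma_1,\dots,\gamma_M)\in B)$ denotes $\int_B\prod_{m=1}^M f_\gamma(x_m)\,dx_1\cdots dx_M$ for Borel $B\subseteq(0,\infty)^M$. All parameters other than $\bar\gamma$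 are held fixed in the limit. *)

(* Defs.v *)
From mathcomp Require Import all_boot all_order all_algebra.
From mathcomp Require Import complex.
From mathcomp Require Import all_classical all_reals all_analysis.

Set Implicit Arguments.
Unset Strict Implicit.
Unset Printing Implicit Defensive.

Import Order.TTheory GRing.Theory Num.Theory.
Import numFieldNormedType.Exports.

Local Open Scope classical_set_scope.
Local Open Scope ring_scope.
Local Open Scope complex_scope.

Definition cintegral (R : realType) (D : set R) (f : R -> R[i]) : R[i] :=
  (\int[@lebesgue_measure R]_(t in D) complex.Re (f t)) +i*
  (\int[@lebesgue_measure R]_(t in D) complex.Im (f t)).

Definition cexp (R : realType) (z : R[i]) : R[i] :=
  (expR (complex.Re z))%:C *
  (cos (complex.Im z) +i* sin (complex.Im z)).

(* Meaningful for 0 < x only. *)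
Definition cpow (R : realType) (x : R) (s : R[i]) : R[i] :=
  cexp (s * (ln x)%:C).

(* Euler's integral of the second kind; equal to Gamma z when 0 < Re z. *)
Definition euler_integral (R : realType) (z : R[i]) : R[i] :=
  cintegral `]0, +oo[ (fun t : R => cpow t (z - 1) * (expR (- t))%:C).

Definition gamma_shift (R : realType) (z : R[i]) : nat :=
  if 0 < complex.Re z then 0%N else (Num.truncn (- complex.Re z)).+1.

(* The meromorphic continuation of Euler's integral by means of
   Gamma z = Gamma (z + n) / (z (z + 1) ... (z + n - 1)); the n chosen makes
   Re (z + n) > 0.  At the poles 0, -1, -2, ... the value is 0, so that
   (Gamma z)^-1 is the entire function 1 / Gamma at every z. *)
Definition Gamma (R : realType) (z : R[i]) : R[i] :=
  euler_integral (z + (gamma_shift z)%:R) /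
  \prod_(k < gamma_shift z) (z + k%:R).

(* Gamma is real on the real axis. *)
Definition gammaR (R : realType) (x : R) : R := complex.Re (Gamma x%:C).

(* The integrand of G^{m,n}_{p,q}, where p = size a and q = size b. *)
Definition meijer_integrand (R : realType) (m n : nat) (a b : seq R) (x : R)
    (s : R[i]) : R[i] :=
  (\prod_(bj <- take m b) Gamma (bj%:C - s) *
   \prod_(aj <- take n a) Gamma (1 - aj%:C + s)) /
  (\prod_(bj <- drop m b) Gamma (1 - bj%:C + s) *
   \prod_(aj <- drop n a) Gamma (aj%:C - s)) * cpow x s.

(* The line Re s = sigma has the poles bj, bj + 1, ... of Gamma (bj - s) to its
   right and the poles aj - 1, aj - 2, ... of Gamma (1 - aj + s) to its left. *)
Definition separating (R : realType) (m n : nat) (a b : seq R) (sigma : R) :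
    Prop :=
  (forall bj k, bj \in take m b -> sigma < bj + k%:R) /\
  (forall aj k, aj \in take n a -> aj - 1 - k%:R < sigma).

(* The contour is an arbitrary separating vertical line s = sigma + i y, on
   which ds = i dy, so that ds / (2 pi i) = dy / (2 pi). *)
Definition meijerG (R : realType) (m n : nat) (a b : seq R) (x : R) : R[i] :=
  let sigma := xget 0 [set sigma | separating m n a b sigma] in
  ((2 * pi)^-1)%:C *
  cintegral setT (fun y : R => meijer_integrand m n a b x (sigma +i* y)).

(* For real parameters the integrand takes conjugate values at conjugate
   points, hence G is real. *)
Definition meijerGR (R : realType) (m n : nat) (a b : seq R) (x : R) : R :=
  complex.Re (meijerG m n a b x).

(* \int_0^oo ... \int_0^oo F (x_1, ..., x_n) dx_n ... dx_1; for Borel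
   nonnegative F this is the integral over (0, oo)^n by Tonelli. *)
Fixpoint iter_integral (R : realType) (n : nat) :
    (n.-tuple R -> \bar R) -> \bar R :=
  match n return (n.-tuple R -> \bar R) -> \bar R with
  | 0 => fun F => F [tuple]
  | n'.+1 => fun F =>
      (\int[@lebesgue_measure R]_(x in `]0%R, +oo[)
         iter_integral (fun t : n'.-tuple R => F [tuple of x :: t]))%E
  end.

Definition iid_measure (R : realType) (n : nat) (f : R -> R)
    (B : set (n.-tuple R)) : \bar R :=
  iter_integral (fun t : n.-tuple R =>
    (\1_B t * \prod_(i < n) f (tnth t i))%:E).

Definition log2 (R : realType) (x : R) : R := ln x / ln 2.

Definition min3 (R : realType) (x y z : R) : R := Num.min x (Num.min y z).
Definition max3 (R : realType) (x y z : R) : R := Num.max x (Num.max y z).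
Definition med3 (R : realType) (x y z : R) : R :=
  nth 0 (sort <=%R [:: x; y; z]) 1.

Definition capacity_const (R : realType) : R := expR 1 / (2 * pi).

Definition snr_density (R : realType) (alpha beta omega A0 hl gbar : R)
    (x : R) : R :=
  Num.sqrt omega / (2 * x * gammaR alpha * gammaR beta) *
  meijerGR 3 0 [:: omega + 2^-1] [:: alpha; beta; omega]
    (alpha * beta / (A0 * hl) * Num.sqrt (x / gbar)).

Definition Phi (R : realType) (M : nat) (alpha beta A0 hl Rt gbar : R) : R :=
  alpha * beta / (A0 * hl) *
  Num.sqrt ((2 `^ (2 * Rt / M%:R) - 1) / (capacity_const R * gbar)).

Definition outage_ir (R : realType) (M : nat)
    (alpha beta omega A0 hl Rt gbar : R) : \bar R :=
  iid_measure (snr_density alpha beta omega A0 hl gbar)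
    [set g : M.-tuple R |
      \sum_(m < M) log2 (1 + capacity_const R * tnth g m) < 2 * Rt].

Definition outage_ir_ub (R : realType) (M : nat)
    (alpha beta omega A0 hl Rt gbar : R) : R :=
  (Num.sqrt omega / (gammaR alpha * gammaR beta)) ^+ M *
  meijerGR (3 * M) 1
    (1 :: nseq M (omega + 2^-1))
    (nseq M alpha ++ nseq M beta ++ nseq M omega ++ [:: 0])
    (Phi M alpha beta A0 hl Rt gbar ^+ M).

Definition outage_ir_asym (R : realType) (M : nat)
    (alpha beta omega A0 hl Rt gbar : R) : R :=
  let q := min3 alpha beta omega in
  let p := max3 alpha beta omega in
  let r := med3 alpha beta omega in
  let phi := Phi M alpha beta A0 hl Rt gbar in
  M%:R ^+ M.-1 / (q * (M.-1)`!%:R) *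
  (Num.sqrt omega * gammaR (p - q) * gammaR (r - q) /
   (gammaR alpha * gammaR beta * gammaR (omega - q + 2^-1))) ^+ M *
  (- ln phi) ^+ M.-1 * phi `^ (M%:R * q).

(* Main.v *)
(** In the variable [v = ln x] every function involved is a convolution.  The
    quotient Gamma(w - s) / Gamma(w + 1/2 - s) is a Beta integral, so
    Gamma(a - s) Gamma(b - s) Gamma(w - s) / Gamma(w + 1/2 - s) is the Mellin
    transform of a convolution [hker a b w] of nonnegative kernels.  Since Gamma
    has no zeros and its modulus decays fast enough on vertical lines, Fourier
    inversion identifies [hker] with the G-function in the density, and Perron's
    formula identifies the G-function in the upper bound with the mass that the
    [M]-fold convolution power of [hker] gives to [v_1 + ... + v_M < M ln Phi].

    By convexity of [t |-> ln (1 + expR t)], an outage forces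
    [v_1 + ... + v_M < M ln Phi] for [v_m = ln (k sqrt (gamma_m / gbar))], with
    [k = alpha beta / (A0 hl)]; this gives the bound.

    With [q] the smallest parameter, [expR (- q v) * hker v] converges to a
    constant [C] at [-oo] because the minimum is attained once, and it decays
    exponentially at [+oo].  Hence each convolution with [hker] multiplies the
    tail at [- x] by [C x / m], by scaling and dominated convergence. *)

Require Import Defs.
From mathcomp Require Import all_boot all_order all_algebra.
From mathcomp Require Import complex ring lra.
From mathcomp Require Import all_classical all_reals all_analysis.
From mathcomp Require Import measurable_realfun.
Set Implicit Arguments.
Unset Strict Implicit.
Unset Printing Implicit Defensive.
Import Order.TTheory GRing.Theory Num.Theory.
Import numFieldNormedType.Exports.
Local Open Scope classical_set_scope.
Local Open Scope ring_scope.

(** No contour is ever moved. Multiplying a kernel by [expR (s * v)] adds [s] to each of its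
    parameters and commutes with convolution. So whichever separating abscissa a G-function picks,
    its integral is the inversion integral of a tilted kernel, and the factor x^s undoes the tilt.
    All Gamma factors then have arguments of positive real part, where Euler's integral applies.

    The transform of the Beta kernel is found by division: [bker w] convolved with [gker (w + 2^-1)]
    is Gamma(1/2) times [gker w]. This is where the absence of zeros of Gamma enters.

    Each Gamma factor is only shown to be O(1 / |y|), through Gamma(z + 1) = z Gamma(z). The two
    factors with parameters [a] and [b] make the transform integrable; the remaining quotient is
    merely bounded. Perron's 1 / s is Gamma(s) / Gamma(1 + s), the transform of the tilted Heaviside
    function from which [cumul] starts.

    The kernel is not built symmetrically in its parameters, so its limit at [-oo] takes three
    arguments. The delicate one is a minimal [omega]: the tilted Beta kernel [bker 0] is then
    neither bounded nor integrable. *)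

Section substitution.
Context {R : realType}.
Local Notation mu := (@lebesgue_measure R).

Lemma ge0_integral_opp (f : R -> \bar R) :
  measurable_fun [set: R] f -> (forall x, 0 <= f x)%E ->
  (\int[mu]_x f (- x)%R = \int[mu]_x f x)%E.
Proof.
move=> mf f0.
rewrite [RHS](eq_measure_integral (pushforward mu (-%R : R -> measurableTypeR R))); last first.
  by move=> A mA _; exact/esym/lebesgue_measureN.
by rewrite ge0_integral_pushforward//= preimage_setT.
Qed.

(** The pushforward of Lebesgue measure under [x |-> a * x + b], scaled by [a], agrees with Lebesgue
    measure on the intervals []x, y]], and these determine it. *)
Lemma ge0_integral_affine (f : R -> \bar R) (a b : R) : 0 < a ->
  measurable_fun [set: R] f -> (forall x, 0 <= f x)%E ->
  (\int[mu]_x f (a * x + b)%R = a^-1%:E * \int[mu]_x f x)%E.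
Proof.
move=> a0 mf f0.
pose phi (x : R) : measurableTypeR R := a * x + b.
have mphi : measurable_fun [set: measurableTypeR R] phi.
  by apply: measurable_funD => //; exact: measurable_funM.
pose ma' := @mscale _ _ R (NngNum (ltW a0)) (pushforward mu phi).
pose ma : {measure set (measurableTypeR R) -> \bar R} := ma' mphi.
have mE A : measurable A -> mu A = ma A.
  apply: lebesgue_measure_unique => _ [[x y] _ <-].
  have -> : ma `]x, y]%classic = (a%:E * mu (phi @^-1` `]x, y]%classic))%E by [].
  have -> : phi @^-1` `]x, y]%classic = `](x - b) / a, (y - b) / a]%classic.
    apply/seteqP; split => z /=; rewrite !in_itv/= /phi;
      by rewrite ltr_pdivrMr// ler_pdivlMr// ltrBlDr lerBrDr [z * a]mulrC.
  rewrite !lebesgue_measure_itv/= !lte_fin ltr_pM2r ?invr_gt0// ltrD2r.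
  case: ifPn => _; last by rewrite mule0.
  rewrite -!EFinD -EFinM; congr EFin; field; exact: lt0r_neq0.
rewrite [in RHS](eq_measure_integral ma); last by move=> A mA _; rewrite -mE.
rewrite [in RHS]/ma /ma' ge0_integral_mscale//= ge0_integral_pushforward//= preimage_setT.
by rewrite muleA -EFinM mulVf ?mul1e// lt0r_neq0.
Qed.

Let mfunpos (f : R -> R) : measurable_fun setT f -> measurable_fun setT ((EFin \o f)^\+)%E.
Proof. by move=> mf; apply: measurable_funepos; exact/measurable_EFinP. Qed.

Let mfunneg (f : R -> R) : measurable_fun setT f -> measurable_fun setT ((EFin \o f)^\-)%E.
Proof. by move=> mf; apply: measurable_funeneg; exact/measurable_EFinP. Qed.

Lemma Rintegral_opp (f : R -> R) : measurable_fun setT f ->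
  \int[mu]_x f (- x) = \int[mu]_x f x.
Proof.
move=> mf; rewrite /Rintegral integralE [in RHS]integralE.
rewrite -(ge0_integral_opp (mfunpos mf))// -(ge0_integral_opp (mfunneg mf))//.
by congr (fine (_ - _)%E); apply: eq_integral => x _; rewrite ?funeposE ?funenegE.
Qed.

(** Positive and negative parts are transformed separately. If one of them has infinite integral,
    both sides are 0 by the convention of [fine]. *)
Lemma Rintegral_affine (f : R -> R) (a b : R) : 0 < a -> measurable_fun setT f ->
  \int[mu]_x f (a * x + b) = a^-1 * \int[mu]_x f x.
Proof.
move=> a0 mf; rewrite /Rintegral integralE [in RHS]integralE.
have pE : (\int[mu]_x ((fun x => (f (a * x + b))%:E)^\+)%E x =
    a^-1%:E * \int[mu]_x ((EFin \o f)^\+)%E x)%E.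
  rewrite -(ge0_integral_affine b a0 (mfunpos mf))//.
  by apply: eq_integral => x _; rewrite !funeposE.
have nE : (\int[mu]_x ((fun x => (f (a * x + b))%:E)^\-)%E x =
    a^-1%:E * \int[mu]_x ((EFin \o f)^\-)%E x)%E.
  rewrite -(ge0_integral_affine b a0 (mfunneg mf))//.
  by apply: eq_integral => x _; rewrite !funenegE.
rewrite pE nE.
set P := integral mu setT ((EFin \o f)^\+)%E; set N := integral mu setT ((EFin \o f)^\-)%E.
have P0 : (0 <= P)%E by apply: integral_ge0.
have N0 : (0 <= N)%E by apply: integral_ge0.
case: P N P0 N0 => [p| |] [n| |] //= _ _;
  rewrite ?gt0_muley ?lte_fin ?invr_gt0//= ?mulr0//.
by rewrite mulrBr.
Qed.

Lemma Rintegral_shift (f : R -> R) (b : R) : measurable_fun setT f ->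
  \int[mu]_x f (x + b) = \int[mu]_x f x.
Proof.
move=> mf; have := Rintegral_affine b ltr01 mf; rewrite invr1 mul1r => <-.
by apply: eq_Rintegral => x _; rewrite mul1r.
Qed.

Lemma Rintegral_reflect (f : R -> R) (b : R) : measurable_fun setT f ->
  \int[mu]_x f (b - x) = \int[mu]_x f x.
Proof.
move=> mf; rewrite -[RHS](Rintegral_shift b mf)//.
rewrite -[RHS](@Rintegral_opp (fun x => f (x + b))).
  by apply: eq_Rintegral => x _; rewrite addrC.
by apply: measurableT_comp mf _; exact: measurable_funD.
Qed.

End substitution.

(** * Integrability and dominated convergence for real-valued functions *)

Section integrability.
Context {R : realType}.
Local Notation mu := (@lebesgue_measure R).
Local Notation L1 F := (mu.-integrable setT (EFin \o F)).

Lemma L1_measurable (F : R -> R) : L1 F -> measurable_fun setT F.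
Proof. by move/integrableP => [/measurable_EFinP]. Qed.

Lemma L1_ge0P (F : R -> R) : measurable_fun setT F -> (forall x, 0 <= F x) ->
  (\int[mu]_x (F x)%:E < +oo)%E -> L1 F.
Proof.
move=> mF F0 h; apply/integrableP; split; first exact/measurable_EFinP.
by under eq_integral do rewrite /= ger0_norm//.
Qed.

Lemma L1_EFin (F : R -> R) : L1 F ->
  (\int[mu]_x (F x)%:E)%E = (\int[mu]_x F x)%:E.
Proof. by move=> h; rewrite fineK//; exact: integrable_fin_num. Qed.

Lemma L1_le (F G : R -> R) : measurable_fun setT F ->
  (forall x, `|F x| <= G x) -> L1 G -> L1 F.
Proof.
move=> mF FG; apply: le_integrable => //; first exact/measurable_EFinP.
by move=> x _; rewrite /= lee_fin (le_trans (FG x))// ler_norm.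
Qed.

Lemma L1D (F G : R -> R) : L1 F -> L1 G -> L1 (fun x => F x + G x).
Proof. by move=> hF hG; exact: (integrableD measurableT hF hG). Qed.

Lemma L1B (F G : R -> R) : L1 F -> L1 G -> L1 (fun x => F x - G x).
Proof. by move=> hF hG; exact: (integrableB measurableT hF hG). Qed.

Lemma L1Z (k : R) (F : R -> R) : L1 F -> L1 (fun x => k * F x).
Proof. by move=> hF; exact: (integrableZl measurableT k hF). Qed.

Lemma L1_norm (F : R -> R) : L1 F -> L1 (fun x => `|F x|).
Proof. by move=> hF; exact: (integrable_norm hF). Qed.

Lemma L1M (k : R) (F G : R -> R) : L1 F -> measurable_fun setT G ->
  (forall x, `|G x| <= k) -> L1 (fun x => F x * G x).
Proof.
move=> hF mG Gk; apply: (L1_le _ _ (L1Z k (L1_norm hF))).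
  by apply: measurable_funM => //; exact: L1_measurable.
by move=> x; rewrite normrM mulrC ler_wpM2r.
Qed.

Lemma L1_affine (F : R -> R) (a b : R) : 0 < a -> L1 F -> L1 (fun x => F (a * x + b)).
Proof.
move=> a0 hF; have mF := L1_measurable hF.
have m1 : measurable_fun [set: R] (fun x : R => a * x + b).
  by apply: measurable_funD => //; exact: measurable_funM.
apply/integrableP; split; first by apply/measurable_EFinP; exact: measurableT_comp.
have m2 : measurable_fun [set: R] (fun x => `|(F x)%:E|%E).
  by apply: measurableT_comp => //; exact/measurable_EFinP.
rewrite (ge0_integral_affine b a0 m2)//.
move/integrableP : hF => [_]; rewrite /= => h.
by rewrite lte_mul_pinfty// lee_fin invr_ge0 ltW.
Qed.

Lemma L1_opp (F : R -> R) : L1 F -> L1 (fun x => F (- x)).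
Proof.
move=> hF; have mF := L1_measurable hF.
apply/integrableP; split; first by apply/measurable_EFinP; exact: measurableT_comp.
have m2 : measurable_fun [set: R] (fun x => `|(F x)%:E|%E).
  by apply: measurableT_comp => //; exact/measurable_EFinP.
by rewrite (ge0_integral_opp m2)//; case/integrableP : hF.
Qed.

Lemma L1_reflect (F : R -> R) (b : R) : L1 F -> L1 (fun x => F (b - x)).
Proof.
move=> /(L1_affine b ltr01) /L1_opp; rewrite (_ : (fun x => _) = (fun x => F (b - x)))//.
by apply/funext => x; rewrite mul1r addrC.
Qed.

Lemma Rintegral_dominated (F_ : nat -> R -> R) (F G : R -> R) :
  (forall n, measurable_fun setT (F_ n)) -> measurable_fun setT F -> L1 G ->
  {ae mu, forall x, F_ ^~ x @ \oo --> F x} -> (forall n x, `|F_ n x| <= G x) ->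
  (\int[mu]_x F_ n x) @[n --> \oo] --> \int[mu]_x F x.
Proof.
move=> mF_ mF hG cF FG.
have [] := @dominated_convergence _ _ R mu setT measurableT
  (fun n x => (F_ n x)%:E) (EFin \o F) (EFin \o G).
- by move=> n; apply/measurable_EFinP; exact: mF_.
- exact/measurable_EFinP.
- move: cF; apply: (@filterS _ _ (ae_filter_ringOfSetsType mu)) => x h _; apply: cvg_EFin => //;
  exact: nearW.
- exact: hG.
- by apply: aeW => x n _; rewrite /= lee_fin.
by move=> iF _ /= ; rewrite -(fineK (integrable_fin_num measurableT iF)) => /fine_cvgP[].
Qed.

End integrability.

(** * The fundamental theorem of calculus on unbounded intervals *)

Section fundamental_theorem.
Context {R : realType}.
Local Notation mu := (@lebesgue_measure R).
Local Notation L1 F := (mu.-integrable setT (EFin \o F)).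

Lemma is_derive_continuous (F : R -> R) (x d : R) : is_derive x 1 F d -> {for x, continuous F}.
Proof. by case => dF _; exact/differentiable_continuous/derivable1_diffP. Qed.

Lemma FTC_itv (F f : R -> R) (a b : R) : a <= b ->
  (forall x, a <= x <= b -> is_derive x 1 F (f x)) ->
  (forall x, a <= x <= b -> {for x, continuous f}) ->
  (\int[mu]_(x in `[a, b]) (f x)%:E)%E = (F b - F a)%:E.
Proof.
rewrite le_eqVlt => /predU1P[<- _ _|ab dF cf].
  by rewrite set_itv1 integral_set1 subrr.
rewrite (@continuous_FTC2 _ f F a b)//.
- apply/(continuous_within_itvP _ ab); split.
  + move=> x; rewrite in_itv/= => /andP[ax xb]; apply: cf; by rewrite !ltW.
  + apply: cvg_at_right_filter; apply: cf; by rewrite lexx ltW.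
  + apply: cvg_at_left_filter; apply: cf; by rewrite lexx ltW.
- split.
  + move=> x; rewrite in_itv/= => /andP[ax xb].
    by have [] := dF x; rewrite ?(ltW ax) ?(ltW xb).
  + apply: cvg_at_right_filter.
    by apply: (@is_derive_continuous F a (f a)); apply: dF; rewrite lexx ltW.
  + apply: cvg_at_left_filter.
    by apply: (@is_derive_continuous F b (f b)); apply: dF; rewrite lexx ltW.
- move=> x; rewrite in_itv/= => /andP[ax xb].
  rewrite derive1E; have [|_ ->//] := dF x.
  by rewrite !ltW.
Qed.

Lemma measurable_gt0 (D : set R) : measurable_fun D (fun x : R => (0 < x)%R%:R : R).
Proof.
have m0 : measurable_fun [set: bool] (fun b : bool => b%:R : R) by [].
apply: (measurableT_comp m0); exact: measurable_fun_ltr.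
Qed.

(** The half line is exhausted by []0, n]]. Dominated convergence, with [f] itself as the bound,
    reduces the improper integral to the limit of [F] along the integers. *)
Lemma FTC_gt0 (F f : R -> R) (l : R) :
  (forall x : R, is_derive x 1 F (f x)) -> continuous f ->
  L1 (fun x => f x * (0 < x)%R%:R) -> F n%:R @[n --> \oo] --> l ->
  \int[mu]_x (f x * (0 < x)%R%:R) = l - F 0.
Proof.
move=> dF cf hf Fl.
have mf : measurable_fun setT f by exact: continuous_measurable_fun.
have E n : \int[mu]_x (f x * (\1_(`]0, n%:R]%classic) x)) = F n%:R - F 0.
  rewrite -[RHS](_ : fine (F n%:R - F 0)%:E = _)//.
  rewrite -(@FTC_itv F f)//; first last.
  - by move=> x _; exact: cf.
  rewrite -integral_itv_obnd_cbnd; last first.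
    by apply/measurable_EFinP; exact: measurable_funTS.
  congr fine; rewrite [RHS]integral_mkcond; apply: eq_integral => x _.
  by rewrite /= patchE indicE; case: ifPn; rewrite ?mulr1 ?mulr0.
have : \int[mu]_x (f x * (\1_(`]0, n%:R]%classic) x)) @[n --> \oo] -->
    \int[mu]_x (f x * (0 < x)%R%:R).
  apply: (@Rintegral_dominated _ _ _ (fun x => `|f x * (0 < x)%R%:R|)).
  - by move=> n; apply: measurable_funM => //; exact: measurable_indic.
  - by apply: measurable_funM => //; exact: measurable_gt0.
  - exact: L1_norm.
  - apply: aeW => x; apply: cvgM; first exact: cvg_cst.
    apply: cvg_near_cst; near=> n; rewrite indicE mem_setE in_itv/=.
    by rewrite [x <= _](_ : _ = true) ?andbT//; near: n; exact: nbhs_infty_ger.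
  - move=> n x; rewrite !normrM ler_wpM2l// indicE mem_setE in_itv/=.
    by case: (0 < x) => //=; case: (x <= n%:R); rewrite ?normr1 ?normr0.
under eq_fun do rewrite E.
move=> h; apply: (cvg_unique _ h) => //.
by apply: cvgB => //; exact: cvg_cst.
Unshelve. all: by end_near. Qed.

Lemma FTC_T (F f : R -> R) (l l' : R) :
  (forall x : R, is_derive x 1 F (f x)) -> continuous f -> L1 f ->
  F n%:R @[n --> \oo] --> l -> F (- n%:R) @[n --> \oo] --> l' ->
  \int[mu]_x f x = l - l'.
Proof.
move=> dF cf hf Fl Fl'.
have mf : measurable_fun setT f by exact: continuous_measurable_fun.
have E n : \int[mu]_x (f x * (\1_(`[- n%:R, n%:R]%classic) x)) = F n%:R - F (- n%:R).
  rewrite -[RHS](_ : fine (F n%:R - F (- n%:R))%:E = _)//.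
  rewrite -(@FTC_itv F f)//; first last.
  - by move=> x _; exact: cf.
  - by rewrite (@le_trans _ _ 0)// oppr_le0.
  congr fine; rewrite [RHS]integral_mkcond; apply: eq_integral => x _.
  by rewrite /= patchE indicE; case: ifPn; rewrite ?mulr1 ?mulr0.
have : \int[mu]_x (f x * (\1_(`[- n%:R, n%:R]%classic) x)) @[n --> \oo] -->
    \int[mu]_x (f x).
  apply: (@Rintegral_dominated _ _ _ (fun x => `|f x|)) => //.
  - by move=> n; apply: measurable_funM => //; exact: measurable_indic.
  - exact: L1_norm.
  - apply: aeW => x; rewrite -[X in _ --> X]mulr1; apply: cvgM; first exact: cvg_cst.
    apply: cvg_near_cst; near=> n; rewrite indicE mem_setE in_itv/=.
    rewrite -ler_norml (_ : `|x| <= _ = true)//; near: n; exact: nbhs_infty_ger.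
  - move=> n x; rewrite !normrM ler_piMr// indicE mem_setE in_itv/=.
    by case: (_ && _); rewrite ?normr1 ?normr0.
under eq_fun do rewrite E.
move=> h; apply: (cvg_unique _ h) => //.
by apply: cvgB => //; exact: cvg_cst.
Unshelve. all: by end_near. Qed.

End fundamental_theorem.

(** * The substitution [x = expR v] *)

Section expR_substitution.
Context {R : realType}.
Local Notation mu := (@lebesgue_measure R).
Local Notation L1 F := (mu.-integrable setT (EFin \o F)).

(* [expR (- ln x)] is [x^-1] on the half line, but visibly measurable. *)
Let h (phi : R -> R) (x : R) := \1_(`]0, +oo[%classic) x * (phi (ln x) * expR (- ln x)).

Let mh (phi : R -> R) : measurable_fun setT phi -> measurable_fun setT (h phi).
Proof.
move=> mphi; apply: measurable_funM; first exact: measurable_indic.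
apply: measurable_funM; first by apply: (measurableT_comp mphi); exact: measurable_ln.
by apply: measurableT_comp => //; apply: measurableT_comp => //; exact: measurable_ln.
Qed.

Let h0 (phi : R -> R) x : (forall x, 0 <= phi x) -> 0 <= h phi x.
Proof. by move=> p0; rewrite mulr_ge0// mulr_ge0// expR_ge0. Qed.

Let H phi : \bar R := (\int[mu]_x (h phi x)%:E)%E.

Let HZ (c : R) (phi : R -> R) : 0 <= c -> measurable_fun setT phi ->
  (forall x, 0 <= phi x) -> (\int[mu]_x (c * h phi x)%:E = c%:E * H phi)%E.
Proof.
move=> c0 mphi p0; rewrite /H -ge0_integralZl//.
- by apply/measurable_EFinP; exact: mh.
- by move=> x _; rewrite lee_fin h0.
Qed.

(** The measure dx / x is invariant under scaling, and scaling by [expR (- v)] translates [ln x] by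
    [- v]. *)
Let H_shift (phi : R -> R) (v : R) : measurable_fun setT phi -> (forall x, 0 <= phi x) ->
  H (fun u : R => phi (u + v)) = H phi.
Proof.
move=> mphi p0.
have mpv : measurable_fun setT (fun u : R => phi (u + v)).
  by apply: (measurableT_comp mphi); exact: measurable_funD.
have m1 : measurable_fun setT (fun x => (h (fun u : R => phi (u + v)) x)%:E).
  by apply/measurable_EFinP; exact: mh.
have e0 := expR_gt0 (- v).
have := ge0_integral_affine 0 e0 m1 (fun x => ltac:(by rewrite lee_fin h0)).
rewrite -expRN opprK => E.
have E2 : (\int[mu]_x (h (fun u : R => (phi (u + v))) (expR (- v) * x + 0))%:E =
   (expR v)%:E * H phi)%E.
  rewrite -(HZ (expR_ge0 _) mphi p0); apply: eq_integral => x _; rewrite addr0; congr EFin.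
  rewrite /h !indicE !mem_setE !in_itv/= !andbT pmulr_rgt0//.
  case: ltP => x0; last by rewrite !mul0r mulr0.
  rewrite !mul1r lnM ?posrE// expRK [X in phi X](_ : _ = ln x); last by ring.
  by rewrite opprD opprK expRD; ring.
move: E; rewrite E2 => /(congr1 (fun z => (expR (- v))%:E * z)%E).
by rewrite !muleA -EFinM mulrC -expRD subrr expR0 !mul1e.
Qed.

(** Uniqueness of a translation-invariant integral up to a factor, in functional form. The function
    phi (ln x + v) g (- v) / x of (v, x) is integrated in both orders. One order gives [H phi] times
    the integral of [g], the other the integral of [phi] times [H g], and both normalising factors
    are 1. *)
Lemma ge0_integral_ln (phi : R -> R) :
  measurable_fun setT phi -> (forall x, 0 <= phi x) ->
  (\int[mu]_(x in `]0%R, +oo[) (phi (ln x) / x)%:E = \int[mu]_x (phi x)%:E)%E.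
Proof.
move=> mphi p0.
transitivity (H phi).
  rewrite integral_mkcond; apply: eq_integral => x _.
  rewrite patchE /h indicE; case: ifPn => /=; last by rewrite mul0r.
  by rewrite mem_setE in_itv/= andbT => x0; rewrite mul1r expRN lnK.
(* [g] has mass 1 for dv, and [H g] is the integral of 1 / x over [[1, e]], again 1. *)
pose g : R -> R := \1_(`[0, 1]%classic).
have mg : measurable_fun setT g by exact: measurable_indic.
have g0 x : 0 <= g x by [].
have intg : (\int[mu]_v (g (- v))%:E = 1)%E.
  rewrite (ge0_integral_opp (f := EFin \o g))//; last exact/measurable_EFinP.
  rewrite integral_indic// ?setIT.
  by apply: (etrans (lebesgue_measure_itv _)); rewrite /= lte_fin ltr01 oppr0 adde0.
have Hg : H g = 1%E.
  rewrite /H (_ : (fun x => _) = (fun x => ((fun x => x^-1%:E)%R \_ `[1, expR 1]%classic) x)).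
    rewrite -integral_mkcond (@FTC_itv _ (@ln R) (fun x => x^-1) 1 (expR 1) _ _ _).
    - by rewrite expRK ln1 subr0.
    - by rewrite -[leLHS]expR0 ler_expR.
    - by move=> x /andP[x1 _]; apply: is_derive1_ln; exact: lt_le_trans x1.
    - move=> x /andP[x1 _]; apply: inv_continuous.
      by rewrite gt_eqF// (lt_le_trans _ x1).
  apply/funext => x; rewrite /h patchE indicE !mem_setE !in_itv/= andbT.
  rewrite /g indicE mem_setE in_itv/=.
  case: ltP => x0; last first.
    by rewrite mul0r ifF//; apply/negP => /andP[/le_trans/(_ x0)]; rewrite ler10.
  have -> : (0 <= ln x) = (1 <= x) by rewrite -ln1 ler_ln ?posrE.
  have -> : (ln x <= 1) = (x <= expR 1) by rewrite -{1}(expRK 1) ler_ln ?posrE ?expR_gt0.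
  by case: ifPn => _; rewrite ?mul0r ?mulr0// !mul1r expRN lnK.
pose k (z : R * R) := ((\1_(`]0, +oo[%classic) z.2 * expR (- ln z.2)) *
  phi (ln z.2 + z.1)) * g (- z.1).
have mk : measurable_fun setT k.
  apply: measurable_funM; last first.
    by apply: (measurableT_comp mg); exact: measurableT_comp.
  apply: measurable_funM; last first.
    apply: (measurableT_comp mphi); apply: measurable_funD.
      exact: (measurableT_comp (@measurable_ln R)).
    exact: measurable_fst.
  have m1 : measurable_fun setT (fun x : R => \1_(`]0, +oo[%classic) x * expR (- ln x)).
    apply: measurable_funM; first exact: measurable_indic.
    by do 2 (apply: measurableT_comp => //); exact: measurable_ln.
  exact: (measurableT_comp m1).
have k0 z : 0 <= k z by rewrite !mulr_ge0// expR_ge0.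
have := @fubini_tonelli _ _ _ _ R mu mu (EFin \o k).
rewrite /= => FT.
have L : (\int[mu]_x \int[mu]_y (k (x, y))%:E = H phi)%E.
  have inner v : (\int[mu]_y (k (v, y))%:E = (g (- v))%:E * H phi)%E.
    have mpv : measurable_fun setT (fun u : R => phi (u + v)).
      by apply: (measurableT_comp mphi); exact: measurable_funD.
    rewrite -(H_shift v mphi p0) -(HZ (g0 (- v)) mpv (fun x => p0 (x + v))).
    apply: eq_integral => x _; congr EFin; rewrite /k /h /=.
    by ring.
  under eq_integral do rewrite inner.
  have H0 : (0 <= H phi)%E by apply: integral_ge0 => x _; rewrite lee_fin h0.
  have mgn : measurable_fun [set: R] (fun v => (g (- v))%:E).
    by apply/measurable_EFinP; exact: (measurableT_comp mg).
  rewrite (ge0_integralZr mu measurableT mgn (fun v _ => g0 (- v)) H0).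
  by rewrite intg mul1e.
rewrite -L FT; [ | exact/measurable_EFinP | by move=> z; rewrite lee_fin].
(* For fixed [x], translating [v] by [ln x] moves the dependence on [x] from [phi] to [g]. A second
   exchange of integrals then isolates [H] of a translate of [g]. *)
transitivity (\int[mu]_x \int[mu]_v
    ((\1_(`]0, +oo[%classic) x * expR (- ln x)) * (phi v * g (ln x - v)))%:E)%E.
  apply: eq_integral => x _.
  have mG : measurable_fun setT (fun v : R => ((\1_(`]0, +oo[%classic) x * expR (- ln x)) *
      (phi v * g (ln x - v)))%:E).
    apply/measurable_EFinP; apply: measurable_funM; first exact: measurable_cst.
    apply: (measurable_funM mphi); apply: (measurableT_comp mg).
    by apply: measurable_funB; [exact: measurable_cst|exact: measurable_id].
  have := ge0_integral_affine (ln x) ltr01 mG.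
  rewrite invr1 mul1e => <-; last by move=> y; rewrite lee_fin !mulr_ge0// expR_ge0.
  apply: eq_integral => v _; congr EFin; rewrite /k /= mul1r.
  by rewrite [v + ln x]addrC opprD addNKr; ring.
pose k' (z : R * R) := (\1_(`]0, +oo[%classic) z.1 * expR (- ln z.1)) *
  (phi z.2 * g (ln z.1 - z.2)).
have mk' : measurable_fun setT k'.
  apply: measurable_funM.
    have m1 : measurable_fun setT (fun x : R => \1_(`]0, +oo[%classic) x * expR (- ln x)).
      apply: measurable_funM; first exact: measurable_indic.
      apply: (measurableT_comp (@measurable_expR R)).
      exact: (measurable_funN (@measurable_ln R)).
    exact: (measurableT_comp m1).
  apply: measurable_funM; first exact: (measurableT_comp mphi).
  apply: (measurableT_comp mg); apply: measurable_funB.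
    exact: (measurableT_comp (@measurable_ln R)).
  exact: measurable_snd.
have k'0 z : 0 <= k' z by rewrite !mulr_ge0// expR_ge0.
have := @fubini_tonelli _ _ _ _ R mu mu (EFin \o k').
rewrite /= => FT'; rewrite FT'; [ | exact/measurable_EFinP | by move=> z; rewrite lee_fin].
apply: eq_integral => v _.
have mgv : measurable_fun setT (fun u : R => g (u - v)).
  by apply: (measurableT_comp mg); exact: measurable_funD.
rewrite -[RHS]mule1 -Hg -(H_shift (- v) mg g0) -(HZ (p0 v) mgv (fun x => g0 (x - v))).
apply: eq_integral => x _; congr EFin; rewrite /k' /h /=.
by ring.
Qed.

Lemma Rintegral_ln (phi : R -> R) : measurable_fun setT phi ->
  \int[mu]_(x in `]0%R, +oo[) (phi (ln x) / x) = \int[mu]_x phi x.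
Proof.
move=> mphi; rewrite /Rintegral integralE [in RHS]integralE.
pose p v := Num.max (phi v) 0; pose m v := Num.max (- phi v) 0.
have mp : measurable_fun setT p by apply: measurable_maxr => //; exact: measurable_cst.
have mm : measurable_fun setT m.
  by apply: measurable_maxr; [exact: measurable_funN|exact: measurable_cst].
have p0 x : 0 <= p x by rewrite le_max lexx orbT.
have m0 x : 0 <= m x by rewrite le_max lexx orbT.
congr (fine (_ - _)%E).
  transitivity (\int[mu]_x (p x)%:E)%E; last first.
    by apply: eq_integral => x _; rewrite funeposE /p EFin_max.
  rewrite -ge0_integral_ln//; apply: eq_integral => x; rewrite inE/= in_itv/= andbT => x0.
  by rewrite funeposE -EFin_max /p maxr_pMl ?mul0r// invr_ge0 ltW.
transitivity (\int[mu]_x (m x)%:E)%E; last first.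
  by apply: eq_integral => x _; rewrite funenegE /m EFin_max.
rewrite -ge0_integral_ln//; apply: eq_integral => x; rewrite inE/= in_itv/= andbT => x0.
by rewrite funenegE -EFinN -EFin_max /m maxr_pMl ?mul0r ?mulNr// invr_ge0 ltW.
Qed.

End expR_substitution.

(** Measurability by recursion on the body. A function known only through a hypothesis
    [measurable_fun setT F] of the context is settled by that hypothesis; the [natmul] case is the
    indicator [(0 < x)%R%:R]. *)
Ltac meas_step :=
  lazymatch goal with
  | m : measurable_fun setT ?F |- measurable_fun _ ?F => exact: m
  | m : measurable_fun setT ?F |- measurable_fun _ (fun x => ?F (@?f x)) =>
      apply: (measurableT_comp m)
  | |- measurable_fun _ (fun x => x) => exact: measurable_id
  | |- measurable_fun _ (fun x => GRing.add (@?f x) (GRing.opp (@?g x))) =>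
      apply: measurable_funB
  | |- measurable_fun _ (fun x => GRing.add (@?f x) (@?g x)) =>
      apply: measurable_funD
  | |- measurable_fun _ (fun x => GRing.mul (@?f x) (@?g x)) =>
      apply: measurable_funM
  | |- measurable_fun _ (fun x => GRing.opp (@?f x)) =>
      apply: measurable_funN
  | |- measurable_fun _ (fun x => GRing.exp (@?f x) ?n) =>
      apply: measurable_funX
  | |- measurable_fun _ (fun x => fst x) => exact: measurable_fst
  | |- measurable_fun _ (fun x => snd x) => exact: measurable_snd
  | |- measurable_fun _ (fun x => expR (@?f x)) => apply: (measurableT_comp (@measurable_expR _))
  | |- measurable_fun _ (fun x => ln (@?f x)) => apply: (measurableT_comp (@measurable_ln _))
  | |- measurable_fun _ (fun x => cos (@?f x)) =>
      apply: (measurableT_comp (continuous_measurable_fun (@continuous_cos _)))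
  | |- measurable_fun _ (fun x => sin (@?f x)) =>
      apply: (measurableT_comp (continuous_measurable_fun (@continuous_sin _)))
  | |- measurable_fun _ (fun x => Num.norm (@?f x)) =>
      apply: (measurableT_comp (@normr_measurable _ setT))
  | |- measurable_fun _ (fun x => GRing.natmul _ (nat_of_bool _)) =>
      apply: (measurableT_comp (@measurable_gt0 _ setT))
  | |- measurable_fun _ (fun=> _) => exact: measurable_cst
  end.
Ltac meas := repeat meas_step.

(** * Exponential integrals *)

Section exponential_integrals.
Context {R : realType}.
Local Notation mu := (@lebesgue_measure R).
Local Notation L1 F := (mu.-integrable setT (EFin \o F)).

Lemma cvg_expRn (s : R) : 0 < s -> expR (- s * n%:R) @[n --> \oo] --> (0 : R).
Proof.
move=> s0; have e1 : `|expR (- s)| < 1.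
  by rewrite ger0_norm ?expR_ge0// expR_lt1 oppr_lt0.
rewrite (_ : (fun n => _) = (fun n => expR (- s) ^+ n)); first exact: cvg_expr.
by apply/funext => n; rewrite expRM_natr.
Qed.

Lemma exp_L1 (s : R) : 0 < s -> L1 (fun x => expR (- s * x) * (0 < x)%R%:R).
Proof.
move=> s0; have := integrable_exponential_pdf s0 => h.
have := L1Z s^-1 h; apply: L1_le.
  by meas.
move=> x; rewrite /= normrM ger0_norm ?expR_ge0//.
case: ltP => x0; last by rewrite normr0 mulr0 mulr_ge0// ?invr_ge0 ?exponential_pdf_ge0// ltW.
rewrite normr1 mulr1 exponential_pdfE; last exact: ltW.
by rewrite mulrA mulVf ?mul1r// gt_eqF.
Qed.

Lemma exp_integral (s : R) : 0 < s -> \int[mu]_x (expR (- s * x) * (0 < x)%R%:R) = s^-1.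
Proof.
move=> s0.
have dF (x : R) : is_derive x 1 (fun x => - s^-1 * expR (- s * x)) (expR (- s * x)).
  apply: is_derive_eq.
  by rewrite /GRing.scale/=; field; rewrite gt_eqF.
rewrite (FTC_gt0 (l := 0) dF).
- by rewrite mulr0 expR0 mulr1 sub0r opprK.
- move=> x; apply: continuous_comp; last exact: continuous_expR.
  by apply: cvgM; [exact: cvg_cst|exact: cvg_id].
- exact: exp_L1.
- by rewrite -[X in _ --> X](mulr0 (- s^-1)); apply: cvgM; [exact: cvg_cst|exact: cvg_expRn].
Qed.

Lemma exp_abs_L1 (s : R) : 0 < s -> L1 (fun x => expR (- s * `|x|)).
Proof.
move=> s0; have h := exp_L1 s0.
have h' := L1_opp h.
(* The two half-line functions both vanish at 0; the indicator of the null set {0} restores the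
   pointwise bound there. *)
have h0 : L1 (fun x : R => \1_[set (0 : R)] x).
  apply: L1_ge0P => //; first exact: measurable_indic.
  rewrite integral_indic// setIT [X in (X < _)%E](_ : _ = 0%E)//.
  exact: lebesgue_measure_set1.
apply: (L1_le _ _ (L1D (L1D h h') h0)).
  by meas.
move=> x; rewrite ger0_norm ?expR_ge0// indicE.
case: (ltgtP x 0) => [x0|x0|->].
- by rewrite oppr_gt0 x0 mulr0 mulr1 add0r ltr0_norm// lerDl.
- by rewrite mulr1 gtr0_norm// -addrA lerDl addr_ge0// mulr_ge0// expR_ge0.
- by rewrite normr0 oppr0 ltxx mulr0 expR0 mem_set// !mulr0 !add0r.
Qed.

(** Real and imaginary parts of the integral of exp (- (s - i y) x) over the half line, which is 1 /
    (s - i y). Likewise [Fc] and [Fs] are the parts of the antiderivative - exp (- (s - i y) x) / (s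
    - i y). *)
Lemma exp_cos_sin (s y : R) : 0 < s ->
  \int[mu]_x (expR (- s * x) * cos (y * x) * (0 < x)%R%:R) = s / (s ^+ 2 + y ^+ 2) /\
  \int[mu]_x (expR (- s * x) * sin (y * x) * (0 < x)%R%:R) = y / (s ^+ 2 + y ^+ 2).
Proof.
move=> s0; have D0 : s ^+ 2 + y ^+ 2 != 0 by rewrite gt_eqF// ltr_wpDr ?sqr_ge0// exprn_gt0.
have ce : continuous (fun x => expR (- s * x)).
  move=> x; apply: continuous_comp; last exact: continuous_expR.
  by apply: cvgM; [exact: cvg_cst|exact: cvg_id].
have cc : continuous (fun x => cos (y * x)).
  move=> x; apply: continuous_comp; last exact: continuous_cos.
  by apply: cvgM; [exact: cvg_cst|exact: cvg_id].
have cs : continuous (fun x => sin (y * x)).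
  move=> x; apply: continuous_comp; last exact: continuous_sin.
  by apply: cvgM; [exact: cvg_cst|exact: cvg_id].
pose D := s ^+ 2 + y ^+ 2.
pose Fc (x : R) := expR (- s * x) * ((- s / D) * cos (y * x) + (y / D) * sin (y * x)).
pose Fs (x : R) := expR (- s * x) * ((- s / D) * sin (y * x) - (y / D) * cos (y * x)).
have dc (x : R) : is_derive x 1 Fc (expR (- s * x) * cos (y * x)).
  apply: is_derive_eq.
  by rewrite /GRing.scale/= /D; field.
have ds (x : R) : is_derive x 1 Fs (expR (- s * x) * sin (y * x)).
  apply: is_derive_eq.
  by rewrite /GRing.scale/= /D; field.
have lim (a b : R) : forall f g : R -> R, (forall x, `|f x| <= 1) -> (forall x, `|g x| <= 1) ->
    expR (- s * n%:R) * (a * f n%:R + b * g n%:R) @[n --> \oo] --> (0 : R).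
  move=> f g f1 g1; apply/norm_cvg0P.
  apply: (@squeeze_cvgr _ _ _ _ (fun=> 0) (fun n => expR (- s * n%:R) * (`|a| + `|b|))).
  - apply: nearW => n; rewrite normr_ge0 normrM ger0_norm ?expR_ge0// ler_wpM2l ?expR_ge0//.
    by rewrite (le_trans (ler_normD _ _))// lerD// normrM ler_piMr.
  - exact: cvg_cst.
  - by rewrite -[X in _ --> X](mul0r (`|a| + `|b|)); apply: cvgM; [exact: cvg_expRn|exact: cvg_cst].
have h := exp_L1 s0.
split.
- rewrite (FTC_gt0 (l := 0) dc).
  + by rewrite /Fc !mulr0 expR0 cos0 sin0 /D; field.
  + by move=> x; apply: cvgM; [exact: ce|exact: cc].
  + rewrite (_ : (fun _ => _) = (fun x => (expR (- s * x) * (0 < x)%R%:R) * cos (y * x))).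
      by apply: L1M h _ (fun x => cos_max _); meas.
    by apply/funext => x; rewrite mulrAC.
  + by apply: (lim _ _ (fun x => cos (y * x)) (fun x => sin (y * x))) => x;
    [exact: cos_max|exact: sin_max].
- rewrite (FTC_gt0 (l := 0) ds).
  + by rewrite /Fs !mulr0 expR0 cos0 sin0 /D; field.
  + by move=> x; apply: cvgM; [exact: ce|exact: cs].
  + rewrite (_ : (fun _ => _) = (fun x => (expR (- s * x) * (0 < x)%R%:R) * sin (y * x))).
      by apply: L1M h _ (fun x => sin_max _); meas.
    by apply/funext => x; rewrite mulrAC.
  + rewrite /Fs; under eq_fun do rewrite -mulNr.
    by apply: (lim _ _ (fun x => sin (y * x)) (fun x => cos (y * x))) => x;
      [exact: sin_max|exact: cos_max].
Qed.

End exponential_integrals.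

(** * Convolutions and Fourier inversion *)

Section convolution.
Context {R : realType}.
Local Notation mu := (@lebesgue_measure R).
Local Notation L1 F := (mu.-integrable setT (EFin \o F)).
Implicit Types F G phi : R -> R.

Definition convol F G (x : R) : R := \int[mu]_w (F w * G (x - w)).

Lemma convol_integrable F G (A : R) (x : R) : L1 F -> measurable_fun setT G ->
  (forall x, `|G x| <= A) -> L1 (fun w => F w * G (x - w)).
Proof. by move=> hF mG GA; apply: (L1M hF _ (fun w => GA (x - w))); meas. Qed.

Lemma convol_ge0 F G x : (forall x, 0 <= F x) -> (forall x, 0 <= G x) -> 0 <= convol F G x.
Proof. by move=> F0 G0; apply: Rintegral_ge0 => w _; rewrite mulr_ge0. Qed.

Lemma convol_le F G (A : R) x : L1 F -> (forall x, 0 <= F x) -> measurable_fun setT G ->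
  (forall x, `|G x| <= A) -> `|convol F G x| <= A * \int[mu]_w F w.
Proof.
move=> hF F0 mG GA; have h := convol_integrable x hF mG GA.
rewrite -RintegralZl//; apply: (le_trans (le_normr_Rintegral measurableT h)).
apply: le_Rintegral => //; [exact: L1_norm|exact: L1Z|].
by move=> w _; rewrite normrM mulrC (ger0_norm (F0 w)) ler_wpM2r.
Qed.

Lemma convolC F G x : measurable_fun setT F -> measurable_fun setT G -> convol F G x = convol G F x.
Proof.
move=> mF mG; rewrite /convol -(@Rintegral_reflect _ (fun w => F w * G (x - w)) x); last by meas.
by apply: eq_Rintegral => w _; rewrite opprB addrCA subrr addr0 mulrC.
Qed.

Lemma eq_convol F F' G G' : F =1 F' -> G =1 G' -> convol F G =1 convol F' G'.
Proof. by move=> /funext -> /funext ->. Qed.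

(** Since [expR (s * x)] is the product of [expR (s * w)] and [expR (s * (x - w))], a tilt
    distributes over the two factors. *)
Lemma convol_scale F G (s x : R) : L1 (fun w => F w * G (x - w)) ->
  expR (s * x) * convol F G x = convol (fun w => expR (s * w) * F w) (fun w =>
    expR (s * w) * G w) x.
Proof.
move=> h; rewrite /convol -RintegralZl//; apply: eq_Rintegral => w _.
by rewrite [RHS]mulrACA -expRD -mulrDr [w + _]addrC subrK.
Qed.

Lemma convol_measurable F G : measurable_fun setT F -> measurable_fun setT G ->
  (forall x, 0 <= F x) -> (forall x, 0 <= G x) -> measurable_fun setT (convol F G).
Proof.
move=> mF mG F0 G0.
pose k (z : R * R) := F z.2 * G (z.1 - z.2).
have mk : measurable_fun setT (EFin \o k) by apply/measurable_EFinP; rewrite /k; meas.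
have := @measurable_fun_fubini_tonelli_F _ _ _ _ R mu _ mk.
have k0 z : (0 <= (EFin \o k) z)%E by rewrite lee_fin mulr_ge0.
by move=> /(_ k0) h; apply: (measurableT_comp (@fine_measurable R setT measurableT) h).
Qed.

(** A bounded test function [phi] covers total mass ([phi = 1]) and transforms (cosine and sine)
    with one use of Fubini. The bound [A] on [G] makes the inner integral converge at every [x], so
    that the real-valued [convol] is the inner integral everywhere. *)
Lemma convol_fubini F G phi (A : R) : L1 F -> L1 G -> (forall x, 0 <= F x) ->
  (forall x, 0 <= G x <= A) -> measurable_fun setT phi -> (forall x, `|phi x| <= 1) ->
  L1 (convol F G) /\
  \int[mu]_x (convol F G x * phi x) = \int[mu]_w (F w * \int[mu]_x (G x * phi (x + w))).
Proof.
move=> hF hG F0 GA mphi phi1.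
have mF := L1_measurable hF; have mG := L1_measurable hG.
have G0 x : 0 <= G x by case/andP: (GA x).
have nG x : `|G x| <= A by rewrite ger0_norm//; case/andP: (GA x).
have main (psi : R -> R) : measurable_fun setT psi -> (forall x, `|psi x| <= 1) ->
    [/\ L1 (fun x => convol F G x * psi x) &
  \int[mu]_x (convol F G x * psi x) = \int[mu]_w (F w * \int[mu]_x (G x * psi (x + w)))].
  move=> mpsi psi1.
  pose k (z : R * R) := F z.2 * G (z.1 - z.2) * psi z.1.
  have mk : measurable_fun setT (EFin \o k) by apply/measurable_EFinP; rewrite /k; meas.
  have ik : (mu \x mu)%E.-integrable setT (EFin \o k).
    apply/integrable21ltyP => //.
    apply: (@le_lt_trans _ _ (\int[mu]_x (F x * \int[mu]_y G y)%:E)%E); last first.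
      rewrite L1_EFin ?ltry// (_ : (fun x => _) = (fun x => (\int[mu]_y G y) * F x)).
        exact: L1Z.
      by apply/funext => x; rewrite mulrC.
    apply: ge0_le_integral => //.
    - by move=> x _; apply: integral_ge0.
    - have mk2 : measurable_fun setT (abse \o (EFin \o k)) by exact: measurableT_comp.
      have k20 z : (0 <= (abse \o (EFin \o k)) z)%E by rewrite /= lee_fin.
      have := @measurable_fun_fubini_tonelli_G _ _ _ _ R mu _ mk2 k20.
      exact.
    - by apply/measurable_EFinP; meas.
    - move=> x _.
      have hx : L1 (fun y => F x * G (y - x)).
        apply: L1Z; have := L1_affine (- x) ltr01 hG.
        by congr (_.-integrable _ _); apply/funext => y; rewrite /= mul1r.
      apply: (@le_trans _ _ (\int[mu]_y (F x * G (y - x))%:E)%E).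
        apply: ge0_le_integral => //.
        + by apply: measurableT_comp => //; apply/measurable_EFinP; rewrite /k /=; meas.
        + by apply/measurable_EFinP; meas.
        + by move=> y _; rewrite /= lee_fin /k normrM /= -[leRHS](ger0_norm (mulr_ge0 (F0 x) (G0 (y - x)))) ler_piMr.
      rewrite L1_EFin// RintegralZl//; last first.
        have := L1_affine (- x) ltr01 hG.
        by congr (_.-integrable _ _); apply/funext => y; rewrite /= mul1r.
      by rewrite (Rintegral_shift (- x)).
  have iF := integrable_fubini_F ik.
  have FT := Fubini ik.
  have E1 x : (\int[mu]_y (EFin \o k) (x, y) = (convol F G x * psi x)%:E)%E.
    have hx := convol_integrable x hF mG nG.
    rewrite L1_EFin.
      rewrite -RintegralZr//.
    rewrite (_ : (fun _ => _) = (fun y => psi x * (F y * G (x - y)))); first exact: L1Z.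
    by apply/funext => y; rewrite /k /= mulrC.
  have E2 x : (\int[mu]_y (EFin \o k) (y, x) = (F x * \int[mu]_y (G y * psi (y + x)))%:E)%E.
    have hx : L1 (fun y => G y * psi (y + x)).
      by apply: (L1M hG _ (fun y => psi1 (y + x))); meas.
    rewrite L1_EFin.
      rewrite -(RintegralZl (F x) measurableT hx).
      have mh : measurable_fun setT (fun y => F x * (G y * psi (y + x))) by meas.
      rewrite -(Rintegral_shift (- x) mh); congr EFin.
      by apply: eq_Rintegral => y _; rewrite /k /= subrK mulrA.
    have := L1_affine (- x) ltr01 (L1Z (F x) hx).
    by congr (_.-integrable _ _); apply/funext => y; rewrite /= mul1r subrK mulrA.
  split.
    move: iF; rewrite /fubini_F; congr (_.-integrable _ _); apply/funext => x.
    exact: E1.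
  move: FT; under eq_integral do rewrite E1.
  by under [in X in _ = X -> _]eq_integral do rewrite E2; rewrite /Rintegral => ->.
have [i1 _] := main (fun=> 1) (measurable_cst _) (fun=> ltac:(by rewrite normr1)).
split; last by have [] := main phi mphi phi1.
by move: i1; congr (_.-integrable _ _); apply/funext => x; rewrite /= mulr1.
Qed.

Lemma convol_L1 F G (A : R) : L1 F -> L1 G -> (forall x, 0 <= F x) ->
  (forall x, 0 <= G x <= A) -> L1 (convol F G).
Proof.
move=> hF hG F0 GA.
by have [] := convol_fubini hF hG F0 GA (measurable_cst (1 : R)) (fun=> ltac:(by rewrite normr1)).
Qed.

Lemma Rintegral_convol F G (A : R) : L1 F -> L1 G -> (forall x, 0 <= F x) ->
  (forall x, 0 <= G x <= A) -> \int[mu]_x convol F G x = (\int[mu]_x F x) * \int[mu]_x G x.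
Proof.
move=> hF hG F0 GA.
have [_] := convol_fubini hF hG F0 GA (measurable_cst (1 : R)) (fun=> ltac:(by rewrite normr1)).
rewrite -RintegralZr//; under eq_Rintegral do rewrite mulr1.
by move=> ->; apply: eq_Rintegral => w _; under eq_Rintegral do rewrite mulr1.
Qed.

(** The sequence [u] is arbitrary so as to serve both continuity, where [u] converges, and tail
    limits, where [u] tends to [-oo]. *)
Lemma convol_cvg F G (A : R) (u : nat -> R) (g : R -> R) : L1 F -> measurable_fun setT G ->
  (forall x, `|G x| <= A) -> measurable_fun setT g ->
  (forall w, G (u n - w) @[n --> \oo] --> g w) ->
  convol F G (u n) @[n --> \oo] --> \int[mu]_w (F w * g w).
Proof.
move=> hF mG GA mg Gg; have mF := L1_measurable hF.
apply: (@Rintegral_dominated _ _ _ (fun w => A * `|F w|)).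
- by move=> n; meas.
- by meas.
- exact/L1Z/L1_norm.
- by apply: aeW => w; apply: cvgM; [exact: cvg_cst|exact: Gg].
- by move=> n w; rewrite normrM mulrC ler_wpM2r.
Qed.

Lemma convol_continuous F G (A : R) : L1 F -> continuous G ->
  (forall x, `|G x| <= A) -> continuous (convol F G).
Proof.
move=> hF cG GA x; apply/(@cvg_nbhsP _ R^o) => u ux.
have mG := continuous_measurable_fun cG.
apply: (convol_cvg hF mG GA); first by meas.
move=> w; have cw : u n - w @[n --> \oo] --> x - w by apply: cvgB => //; exact: cvg_cst.
exact: (cvg_comp _ G cw (cG _)).
Qed.

End convolution.

Section fourier_inversion.
Context {R : realType}.
Local Notation mu := (@lebesgue_measure R).
Local Notation L1 F := (mu.-integrable setT (EFin \o F)).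
Implicit Types F : R -> R.

Definition fcos F (y : R) : R := \int[mu]_v (F v * cos (y * v)).
Definition fsin F (y : R) : R := \int[mu]_v (F v * sin (y * v)).

Lemma L1_cos F (y : R) : L1 F -> L1 (fun v => F v * cos (y * v)).
Proof. by move=> hF; apply: (L1M hF _ (fun v => cos_max _)); meas. Qed.

Lemma L1_sin F (y : R) : L1 F -> L1 (fun v => F v * sin (y * v)).
Proof. by move=> hF; apply: (L1M hF _ (fun v => sin_max _)); meas. Qed.

(** The left side is the real part of the transform of [F] at [y] times exp (- i y x). *)
Lemma fcos_fsin_translate F (x y : R) : L1 F ->
  fcos F y * cos (y * x) + fsin F y * sin (y * x) = \int[mu]_v (F v * cos (y * (x - v))).
Proof.
move=> hF; have hc := L1_cos y hF; have hs := L1_sin y hF.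
rewrite /fcos /fsin -RintegralZr// -RintegralZr//.
rewrite -RintegralD//; [|by rewrite (_ : (fun _ => _) = (fun v =>
  cos (y * x) * (F v * cos (y * v))));
    [exact: L1Z|apply/funext => v; rewrite mulrC] |
  by rewrite (_ : (fun _ => _) = (fun v => sin (y * x) * (F v * sin (y * v))));
    [exact: L1Z|apply/funext => v; rewrite mulrC]].
by apply: eq_Rintegral => v _; rewrite mulrBr cosB; ring.
Qed.

Lemma Rintegral_fold F : L1 F ->
  \int[mu]_x F x = \int[mu]_x (F x * (0 < x)%R%:R) + \int[mu]_x (F (- x) * (0 < x)%R%:R).
Proof.
move=> hF; have mF := L1_measurable hF.
have m0 := @measurable_gt0 R setT.
have b0 (x : R) : `|(0 < x)%R%:R| <= 1 :> R by case: (0 < x) => /=; rewrite ?normr1 ?normr0.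
have h1 : L1 (fun x => F x * (0 < x)%R%:R) by exact: (L1M hF).
have h2 : L1 (fun x => F x * (0 < - x)%R%:R).
  have m1 : measurable_fun setT (fun x : R => (0 < - x)%R%:R : R).
    by apply: (measurableT_comp m0); meas.
  exact: (L1M hF m1 (fun x => b0 (- x))).
(* Folding loses the point 0. Subtracting the function that carries only [F 0], of integral 0, makes
   the identity hold pointwise. *)
have E0 : \int[mu]_x (F \_ [set 0]) x = 0 by rewrite -Rintegral_mkcond Rintegral_set1.
have h3 : L1 (F \_ [set 0]).
  apply: (L1_le _ _ (L1_norm hF)); first by apply/(measurable_restrictT _ _).1 => //;
    exact: measurable_funTS.
  by move=> x; rewrite patchE; case: ifPn => _; rewrite ?normr0.
rewrite -[X in _ + X](@Rintegral_opp _ (fun x => F (- x) * (0 < x)%R%:R)); last by meas.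
rewrite -[LHS]subr0 -[X in _ - X = _]E0 -RintegralB//.
under [X in _ + X]eq_Rintegral do rewrite opprK.
rewrite -RintegralD//; apply: eq_Rintegral => x _; rewrite patchE oppr_gt0.
case: ltgtP => [x0|x0|<-].
- by rewrite memNset ?subr0 ?mulr1 ?mulr0 ?addr0//=; apply/eqP; rewrite gt_eqF.
- by rewrite memNset ?subr0 ?mulr1 ?mulr0 ?add0r//=; apply/eqP; rewrite lt_eqF.
- by rewrite mem_set// subrr mulr0 addr0.
Qed.

Lemma exp_abs_cos (s t : R) : 0 < s ->
  \int[mu]_y (expR (- s * `|y|) * cos (y * t)) = 2 * s / (s ^+ 2 + t ^+ 2).
Proof.
move=> s0; have hE := exp_abs_L1 s0.
rewrite Rintegral_fold; last first.
  by apply: (L1M hE _ (fun y => cos_max _)); meas.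
have [Ec _] := exp_cos_sin t s0.
have E (x : R) : expR (- s * `|x|) * cos (x * t) * (0 < x)%R%:R =
   expR (- s * x) * cos (t * x) * (0 < x)%R%:R.
  by case: ltP => x0; rewrite ?mulr0// gtr0_norm// [x * t]mulrC.
under eq_Rintegral do rewrite E.
under [X in _ + X]eq_Rintegral do rewrite normrN [- _ * t]mulNr cosN E.
by rewrite Ec; ring.
Qed.

Lemma cvg_shiftn (f : R -> R) (l : R) : f x @[x --> +oo] --> l -> f n%:R @[n --> \oo] --> l.
Proof. by move=> /cvg_pinftyP /(_ _ (@cvgr_idn R)). Qed.

Lemma poisson_kernel :
  L1 (fun x => (1 + x ^+ 2)^-1) /\ \int[mu]_x (1 + x ^+ 2)^-1 = pi.
Proof.
have p0 (x : R) : 0 < 1 + x ^+ 2 by rewrite ltr_pwDl// sqr_ge0.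
have ci : continuous (fun x : R => (1 + x ^+ 2)^-1).
  move=> x; apply: (@continuousV _ _ (fun x : R => 1 + x ^+ 2)); first by rewrite gt_eqF.
  by apply: cvgD; [exact: cvg_cst|exact: exprn_continuous].
have mi := continuous_measurable_fun ci.
have iy : (\int[mu]_(x in `[0%R, +oo[) ((1 + x ^+ 2)^-1)%:E = (pi / 2)%:E)%E.
  rewrite (@ge0_continuous_FTC2y _ _ atan 0 (pi / 2)).
  - by rewrite atan0 sube0.
  - by move=> x _; rewrite invr_ge0 ltW.
  - exact: continuous_subspaceT.
  - exact: cvgy_atan.
  - by move=> x _; exact: derivable_atan.
  - by apply: cvg_at_right_filter; exact: continuous_atan.
  - by move=> x _; rewrite derive1_atan.
have h : L1 (fun x => (1 + x ^+ 2)^-1).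
  have h1 : L1 (fun x : R => (1 + x ^+ 2)^-1 * \1_(`[0%R, +oo[%classic) x).
    apply: L1_ge0P; first by apply: measurable_funM => //; exact: measurable_indic.
      by move=> x; rewrite mulr_ge0// invr_ge0 ltW.
    rewrite (_ : integral _ _ _ = (pi / 2)%:E) ?ltry// -iy [RHS]integral_mkcond.
    apply: eq_integral => x _; rewrite patchE indicE.
    by case: ifPn; rewrite ?mulr1 ?mulr0.
  have h2 := L1_opp h1.
  apply: (L1_le mi _ (L1D h1 h2)) => x.
  have := p0 x; rewrite -invr_gt0 => /ltW i0.
  rewrite (ger0_norm i0) !indicE !mem_setE !in_itv/= !andbT sqrrN oppr_ge0.
  case: (leP 0 x) => x0; first by rewrite mulr1 lerDl mulr_ge0.
  by rewrite mulr0 add0r (ltW x0) mulr1.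
split => //.
rewrite (FTC_T (F := atan) (l := pi / 2) (l' := - (pi / 2))) //.
- by field.
- exact/cvg_shiftn/cvgy_atan.
- under eq_fun do rewrite atanN.
  by apply: cvgN; exact/cvg_shiftn/cvgy_atan.
Qed.

(** Abel regularisation: the factor exp (- e_n |y|) licenses Fubini, and the integral in [y] becomes
    a Poisson kernel of width e_n. As e_n tends to 0 both sides converge by domination: the left
    because the transforms are integrable, the right because [F] is bounded and continuous. *)
Theorem fourier_inversion F (A x : R) : L1 F -> continuous F -> (forall v, `|F v| <= A) ->
  L1 (fcos F) -> L1 (fsin F) ->
  \int[mu]_y (fcos F y * cos (y * x) + fsin F y * sin (y * x)) = 2 * pi * F x.
Proof.
move=> hF cF FA hc hs.
have mF := L1_measurable hF.
have mc := L1_measurable hc; have ms := L1_measurable hs.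
pose psi y := fcos F y * cos (y * x) + fsin F y * sin (y * x).
have hpsi : L1 psi.
  apply: L1D; [apply: (L1M hc _ (fun y => cos_max _))|apply: (L1M hs _ (fun y => sin_max _))];
    by meas.
have mpsi := L1_measurable hpsi.
pose e n : R := n.+1%:R^-1.
have e0 n : 0 < e n by rewrite invr_gt0.
have cvge : e n @[n --> \oo] --> 0 by exact: cvg_harmonic.
have lhs : \int[mu]_y (expR (- e n * `|y|) * psi y) @[n --> \oo] --> \int[mu]_y psi y.
  apply: (@Rintegral_dominated _ _ _ (fun y => `|psi y|)) => //.
  - by move=> n; meas.
  - exact: L1_norm.
  - apply: aeW => y; rewrite -[X in _ --> X]mul1r; apply: cvgM; last exact: cvg_cst.
    have cy : - e n * `|y| @[n --> \oo] --> 0.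
      rewrite -[X in _ --> X](mul0r `|y|); apply: cvgM; last exact: cvg_cst.
      by rewrite -oppr0; exact: cvgN.
    by rewrite -expR0; apply: (cvg_comp _ expR cy); exact: continuous_expR.
  - move=> n y; rewrite normrM ler_piMl// ger0_norm ?expR_ge0// -expR0 ler_expR.
    by rewrite mulNr oppr_le0 mulr_ge0// ltW.
have [hP IP] := poisson_kernel.
have mP := L1_measurable hP.
have main n : \int[mu]_y (expR (- e n * `|y|) * psi y) =
    \int[mu]_u (F (x - e n * u) * (2 * (1 + u ^+ 2)^-1)).
  pose s := e n; have s0 : 0 < s := e0 n.
  have hE := exp_abs_L1 s0.
  pose k (z : R * R) := (expR (- s * `|z.1|) * F z.2) * cos (z.1 * (x - z.2)).
  have mk : measurable_fun setT (EFin \o k) by apply/measurable_EFinP; rewrite /k; meas.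
  have ik : (mu \x mu)%E.-integrable setT (EFin \o k).
    apply/integrable12ltyP => //.
    apply: (@le_lt_trans _ _ (\int[mu]_y ((\int[mu]_v `|F v|) * expR (- s * `|y|))%:E)%E);
      last first.
      by rewrite L1_EFin ?ltry//; exact: L1Z.
    apply: ge0_le_integral => //.
    - by move=> y _; exact: integral_ge0.
    - have mk2 : measurable_fun setT (abse \o (EFin \o k)) by exact: measurableT_comp.
      have k20 z : (0 <= (abse \o (EFin \o k)) z)%E by rewrite /= lee_fin.
      have := @measurable_fun_fubini_tonelli_F _ _ _ _ R mu _ mk2 k20.
      exact.
    - by apply/measurable_EFinP; meas.
    - move=> y _.
      have hy : L1 (fun v => expR (- s * `|y|) * `|F v|) by exact/L1Z/L1_norm.
      rewrite mulrC -RintegralZl//; last exact: L1_norm.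
      rewrite -L1_EFin//; apply: ge0_le_integral => //.
      + by apply: measurableT_comp => //; apply/measurable_EFinP; rewrite /k /=; meas.
      + by apply/measurable_EFinP; meas.
      + move=> v _; rewrite /= lee_fin /k normrM /= normrM (ger0_norm (expR_ge0 _)).
        by rewrite ler_piMr// ?mulr_ge0 ?expR_ge0// cos_max.
  have E1 y : (\int[mu]_v (EFin \o k) (y, v) = (expR (- s * `|y|) * psi y)%:E)%E.
    have hy : L1 (fun v => F v * cos (y * (x - v))).
      by apply: (L1M hF _ (fun y => cos_max _)); meas.
    rewrite /psi fcos_fsin_translate// -RintegralZl// -L1_EFin; last exact: L1Z.
    by apply: eq_integral => v _; rewrite /k /= mulrA.
  have E2 v : (\int[mu]_y (EFin \o k) (y, v) = (F v * (2 * s / (s ^+ 2 + (x - v) ^+ 2)))%:E)%E.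
    have hy : L1 (fun y => expR (- s * `|y|) * cos (y * (x - v))).
      by apply: (L1M hE _ (fun y => cos_max _)); meas.
    rewrite -exp_abs_cos// -RintegralZl// -L1_EFin; last exact: L1Z.
    by apply: eq_integral => y _; rewrite /k /= mulrA [F v * _]mulrC.
  have := Fubini ik.
  under eq_integral do rewrite E1.
  under [in X in _ = X -> _]eq_integral do rewrite E2.
  move=> /(congr1 fine); rewrite -!/(Rintegral _ _ _) => ->.
  (* The kernel is rewritten so that the substitution [v = x - s * u] brings it to width 1. *)
  pose f1 v := F v * (2 * s * (s ^- 2 * (1 + (s^-1 * (x - v)) ^+ 2)^-1)).
  have mf1 : measurable_fun setT f1.
    have m : measurable_fun setT (fun v : R => (1 + (s^-1 * (x - v)) ^+ 2)^-1).
      by apply: (measurableT_comp mP); meas.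
    by rewrite /f1; meas.
  transitivity (\int[mu]_v f1 v).
    apply: eq_Rintegral => v _; rewrite /f1; congr (_ * (_ * _)).
    rewrite -invfM; congr (_^-1); rewrite exprMn; field; exact: lt0r_neq0.
  rewrite -(Rintegral_reflect x mf1).
  have mf2 : measurable_fun setT (fun u : R => f1 (x - u)) by meas.
  have := Rintegral_affine 0 s0 mf2; rewrite -/s => /(congr1 (fun z => s * z)).
  rewrite mulrA divff ?gt_eqF// mul1r => <-.
  have Eu (u : R) : s^-1 * (x - (x - (s * u + 0))) = u by field; rewrite gt_eqF.
  have u0 (u : R) : 1 + u ^+ 2 != 0 by rewrite gt_eqF// ltr_pwDl// sqr_ge0.
  rewrite -RintegralZl//; last first.
    have hi : L1 (fun u => (2 * s^-1) * ((1 + u ^+ 2)^-1 * F (x - s * u))).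
      by apply/L1Z/(L1M hP _ (fun u => FA _)); meas.
    move: hi; congr (_.-integrable _ _); apply/funext => u; rewrite /f1 /=.
    rewrite Eu addr0; congr EFin; field.
    by rewrite (gt_eqF s0) u0.
  apply: eq_Rintegral => u _; rewrite /f1 Eu addr0; field.
  by rewrite (gt_eqF s0) u0.
have rhs : \int[mu]_u (F (x - e n * u) * (2 * (1 + u ^+ 2)^-1)) @[n --> \oo] -->
    \int[mu]_u (F x * (2 * (1 + u ^+ 2)^-1)).
  apply: (@Rintegral_dominated _ _ _ (fun u => A * (2 * (1 + u ^+ 2)^-1))).
  - by move=> n; meas.
  - by meas.
  - exact/L1Z/L1Z.
  - apply: aeW => u; apply: cvgM; last exact: cvg_cst.
    have cx : x - e n * u @[n --> \oo] --> x.
      rewrite -[X in _ --> X]subr0; apply: cvgB; first exact: cvg_cst.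
      by rewrite -[X in _ --> X](mul0r u); apply: cvgM => //; exact: cvg_cst.
    exact: (cvg_comp _ F cx (cF x)).
  - move=> n u; have p0 : 0 <= 2 * (1 + u ^+ 2)^-1 :> R.
      by rewrite mulr_ge0// invr_ge0 addr_ge0// sqr_ge0.
    by rewrite normrM (ger0_norm p0) ler_wpM2r.
have -> : 2 * pi * F x = \int[mu]_u (F x * (2 * (1 + u ^+ 2)^-1)).
  by rewrite RintegralZl ?RintegralZl ?IP//; [ring|exact: L1Z].
apply: (cvg_unique _ lhs) => //.
by rewrite /=; under eq_fun do rewrite main; exact: rhs.
Qed.

End fourier_inversion.

(** * The Gamma function on vertical lines *)

Section gamma_kernel.
Context {R : realType}.
Local Notation mu := (@lebesgue_measure R).
Local Notation L1 F := (mu.-integrable setT (EFin \o F)).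
Implicit Types (a b w v y : R).

(* The integrand of Euler's integral in the logarithmic variable. *)
Definition gker (a v : R) : R := expR (a * v) * expR (- expR v).

Lemma gker_gt0 a v : 0 < gker a v.
Proof. by rewrite mulr_gt0 ?expR_gt0. Qed.

Lemma gker_ge0 a v : 0 <= gker a v.
Proof. exact/ltW/gker_gt0. Qed.

Lemma gker_shift a s v : expR (s * v) * gker a v = gker (a + s) v.
Proof. by rewrite /gker mulrA -expRD -mulrDl [s + a]addrC. Qed.

Lemma continuous_gker a : continuous (gker a).
Proof.
have c1 (k : R) : continuous (fun x : R => expR (k * x)).
  move=> x; apply: continuous_comp; last exact: continuous_expR.
  by apply: cvgM; [exact: cvg_cst|exact: cvg_id].
move=> x; apply: cvgM; first exact: c1.
apply: (@continuous_comp _ _ _ (fun x => - expR x) expR); last exact: continuous_expR.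
by apply: cvgN; exact: continuous_expR.
Qed.

Lemma measurable_gker a : measurable_fun setT (gker a).
Proof. apply: continuous_measurable_fun; exact: continuous_gker. Qed.

Lemma gker0_le1 v : gker 0 v <= 1.
Proof. by rewrite /gker mul0r expR0 mul1r -expR0 ler_expR oppr_le0 expR_ge0. Qed.

(** For [v >= 0] the exponential series gives exp (e^v) >= e^(N v) / N!, and [N >= a + 1] leaves N!
    e^(- v). For [v < 0] the factor [expR (a * v)] decays by itself. The rate [Num.min a 1] fits
    both sides. *)
Lemma gker_decay a : 0 < a ->
  exists2 C : R, 0 < C & forall v, gker a v <= C * expR (- Num.min a 1 * `|v|).
Proof.
move=> a0; pose N := (Num.truncn (a + 1)).+1.
have aN : a + 1 <= N%:R by rewrite ltW// truncnS_gt.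
have d0 : 0 < Num.min a 1 by rewrite lt_min a0 ltr01.
exists N`!%:R; first by rewrite ltr0n fact_gt0.
move=> v; case: (leP 0 v) => v0.
  have h := expR_ge1Dxn (Num.truncn (a + 1)) (expR_ge0 v); rewrite -/N in h.
  have xN : expR v ^+ N = expR (N%:R * v) by rewrite expRM_natl.
  have F0 : 0 < N`!%:R :> R by rewrite ltr0n fact_gt0.
  have h2 : expR (N%:R * v) / N`!%:R <= expR (expR v).
    by rewrite -xN (le_trans _ h)// lerDr.
  have h3 : expR (- expR v) <= N`!%:R * expR (- (N%:R * v)).
    rewrite !expRN -[N`!%:R]invrK -invfM lef_pV2 ?posrE ?expR_gt0//.
      by rewrite mulrC.
    by rewrite mulr_gt0 ?expR_gt0// invr_gt0.
  rewrite /gker (le_trans (ler_wpM2l (expR_ge0 _) h3))//.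
  rewrite mulrCA ler_pM2l// -expRD ler_expR ger0_norm//.
  rewrite -mulNr -mulrDl ler_wpM2r// lerBlDr -lerBlDl opprK.
  by rewrite (le_trans _ aN)// lerD2l ge_min lexx orbT.
rewrite ltr0_norm// mulrNN /gker (@le_trans _ _ (expR (a * v)))//.
  by rewrite ler_piMr ?expR_ge0// -expR0 ler_expR oppr_le0 expR_ge0.
rewrite (@le_trans _ _ (expR (Num.min a 1 * v)))//.
  by rewrite ler_expR (ler_wnM2r (ltW v0))// ge_min lexx.
by rewrite ler_peMl ?expR_ge0// ler1n fact_gt0.
Qed.

Lemma gker_L1 a : 0 < a -> L1 (gker a).
Proof.
move=> a0; have [C C0 h] := gker_decay a0.
have d0 : 0 < Num.min a 1 by rewrite lt_min a0 ltr01.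
apply: (L1_le (measurable_gker a) _ (L1Z C (exp_abs_L1 d0))) => v.
by rewrite ger0_norm ?gker_ge0.
Qed.

Lemma gker_bounded a : 0 <= a -> exists2 C, 0 < C & forall v, 0 <= gker a v <= C.
Proof.
rewrite le_eqVlt => /predU1P[<-|a0].
  by exists 1 => // v; rewrite gker_ge0 gker0_le1.
have [C C0 h] := gker_decay a0; exists C => // v; rewrite gker_ge0 (le_trans (h v))//.
rewrite (ler_piMr (ltW C0))// -[leRHS]expR0 ler_expR mulNr oppr_le0 mulr_ge0//.
by rewrite le_min ler01 ltW.
Qed.

(** Exponent 0 is the borderline between decay and growth at [-oo]. The limit 1 found there is the
    source of the leading constant of the tail, once the smallest parameter has been tilted to 0. *)
Lemma gker_cvgNy (u : nat -> R) : u n @[n --> \oo] --> -oo ->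
  gker 0 (u n) @[n --> \oo] --> (1 : R) /\ forall a, 0 < a -> gker a (u n) @[n --> \oo] --> (0 : R).
Proof.
move=> uy.
have e0 s : 0 < s -> expR (s * u n) @[n --> \oo] --> (0 : R).
  move=> s0; have su : - (s * u n) @[n --> \oo] --> +oo.
    apply/cvgryPge => A; move/cvgrNyPle : uy => /(_ (- A / s)); apply: filterS => n.
    by rewrite ler_pdivlMr// lerNr mulrC.
  have -> : (fun n => expR (s * u n)) = (fun x => expR (- x)) \o (fun n => - (s * u n)).
    by apply/funext => n /=; rewrite opprK.
  exact: (cvg_comp _ _ su (@cvgr_expR R)).
have e1 : expR (- expR (u n)) @[n --> \oo] --> (1 : R).
  rewrite -expR0 -oppr0.
  have h : - expR (u n) @[n --> \oo] --> - (0 : R).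
    by apply: cvgN; have := e0 1 ltr01; under eq_fun do rewrite mul1r.
  exact: (cvg_comp _ expR h (@continuous_expR _ _)).
split=> [|a a0].
  by rewrite /gker; under eq_fun do rewrite mul0r expR0 mul1r.
by rewrite -[X in _ --> X](mul0r (1 : R)); apply: cvgM => //; exact: e0.
Qed.

Definition rgamma (a : R) : R := \int[mu]_v gker a v.

End gamma_kernel.

(** * Euler's integral as a Fourier transform, and its nonvanishing *)

Section gamma_function.
Context {R : realType}.
Local Notation mu := (@lebesgue_measure R).
Local Notation L1 F := (mu.-integrable setT (EFin \o F)).
Implicit Types (a b w v y : R).
Local Open Scope complex_scope.

Lemma Rintegral_indic_itv (c x : R) : \int[mu]_v (c * \1_(`[x, x + 1]%classic) v) = c /\
  L1 (fun v => c * \1_(`[x, x + 1]%classic) v).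
Proof.
have h : L1 (\1_(`[x, x + 1]%classic) : R -> R) by exact: integrable_indic_itv.
split; last exact: L1Z.
rewrite RintegralZl// /Rintegral integral_indic// setIT.
rewrite [X in fine X](_ : _ = 1%E) ?mulr1//; apply: (etrans (lebesgue_measure_itv _)).
by rewrite /= lte_fin ltrDl ltr01 -EFinD addrAC subrr add0r.
Qed.

Lemma rgamma_gt0 a : 0 < a -> 0 < rgamma a.
Proof.
(* [c] bounds the kernel below on [[-1, 0]]: the minimum of each factor is taken separately. *)
move=> a0; pose c := expR (- a) * expR (- expR 0).
have c0 : 0 < c by rewrite mulr_gt0 ?expR_gt0.
have [E h] := Rintegral_indic_itv c (- 1).
rewrite (lt_le_trans c0)// -E; apply: (le_Rintegral measurableT h (gker_L1 a0)).
move=> v _; rewrite indicE mem_setE in_itv/= addNr.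
case: (boolP (-1 <= v <= 0)) => [/andP[v1 v0]|_]; last by rewrite mulr0 gker_ge0.
rewrite mulr1 ler_pM ?expR_ge0// ler_expR.
  by rewrite -[leLHS]mulrN1 ler_pM2l.
by rewrite lerN2 ler_expR.
Qed.

(* The characteristic function of the finite measure [F v dv]. *)
Definition ft (F : R -> R) y : R[i] := fcos F y +i* fsin F y.

Lemma ft0 (F : R -> R) : ft F 0 = (\int[mu]_v F v)%:C.
Proof.
congr (_ +i* _).
  by apply: eq_Rintegral => v _; rewrite mul0r cos0 mulr1.
rewrite /fsin (_ : (fun v => _) = (fun=> 0)); first by rewrite Rintegral_cst// mul0r.
by apply/funext => v; rewrite mul0r sin0 mulr0.
Qed.

Lemma ft_convol (F G : R -> R) (A y : R) : L1 F -> L1 G -> (forall x, 0 <= F x) ->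
  (forall x, 0 <= G x <= A) -> ft (convol F G) y = ft F y * ft G y.
Proof.
move=> hF hG F0 GA; have mF := L1_measurable hF; have mG := L1_measurable hG.
have hFc := L1_cos y hF; have hFs := L1_sin y hF.
have hGc := L1_cos y hG; have hGs := L1_sin y hG.
have mc : measurable_fun setT (fun v : R => cos (y * v)) by meas.
have ms : measurable_fun setT (fun v : R => sin (y * v)) by meas.
have [_ Ec] := convol_fubini hF hG F0 GA mc (fun v => cos_max (y * v)).
have [_ Es] := convol_fubini hF hG F0 GA ms (fun v => sin_max (y * v)).
have Zr (f : R -> R) (k : R) : L1 f -> L1 (fun v => f v * k).
  by move=> /(L1Z k); congr (_.-integrable _ _); apply/funext => v /=; rewrite mulrC.
congr (_ +i* _).
  rewrite /fcos Ec.
  have E w : F w * \int[mu]_x (G x * cos (y * (x + w))) =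
      F w * cos (y * w) * fcos G y - F w * sin (y * w) * fsin G y.
    rewrite -!mulrA -mulrBr; congr (_ * _); rewrite /fcos /fsin.
    rewrite -!RintegralZl// -RintegralB//; try exact: L1Z.
    by apply: eq_Rintegral => x _; rewrite mulrDr cosD; ring.
  by under eq_Rintegral do rewrite E; rewrite RintegralB ?RintegralZr//; exact: Zr.
rewrite /fsin Es.
have E w : F w * \int[mu]_x (G x * sin (y * (x + w))) =
    F w * cos (y * w) * fsin G y + F w * sin (y * w) * fcos G y.
  rewrite -!mulrA -mulrDr; congr (_ * _); rewrite /fcos /fsin.
  rewrite -!RintegralZl// -RintegralD//; try exact: L1Z.
  by apply: eq_Rintegral => x _; rewrite mulrDr sinD; ring.
by under eq_Rintegral do rewrite E; rewrite RintegralD ?RintegralZr//; exact: Zr.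
Qed.

(** For positive real part [gamma_shift] is 0, so [Gamma] is Euler's integral itself, and
    [t = expR v] turns it into a Fourier integral along the vertical line. *)
Lemma GammaE (z : R[i]) : 0 < complex.Re z -> Gamma z = ft (gker (complex.Re z)) (complex.Im z).
Proof.
case: z => a y /= a0; rewrite /Gamma /gamma_shift /= a0 big_ord0 divr1 addr0.
rewrite /euler_integral /cintegral; congr (_ +i* _).
  rewrite /fcos -Rintegral_ln; last by have := @measurable_gker R a => m; meas.
  apply: eq_Rintegral => t; rewrite inE/= in_itv/= andbT => t0.
  rewrite /cpow /cexp /= /gker lnK ?posrE//.
  rewrite !mulr0 !mul0r !subr0 ?addr0 ?add0r mulrBl mul1r expRB lnK ?posrE//.
  by ring.
rewrite /fsin -Rintegral_ln; last by have := @measurable_gker R a => m; meas.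
apply: eq_Rintegral => t; rewrite inE/= in_itv/= andbT => t0.
rewrite /cpow /cexp /= /gker lnK ?posrE//.
rewrite !mulr0 !mul0r !subr0 ?addr0 ?add0r mulrBl mul1r expRB lnK ?posrE//.
by ring.
Qed.

Lemma gammaRE a : 0 < a -> gammaR a = rgamma a.
Proof. by move=> a0; rewrite /gammaR GammaE// (ft0 (gker a)). Qed.

Lemma gker_cvgy (a : R) : 0 < a ->
  gker a n%:R @[n --> \oo] --> (0 : R) /\ gker a (- n%:R) @[n --> \oo] --> (0 : R).
Proof.
move=> a0; have [C C0 h] := gker_decay a0.
have d0 : 0 < Num.min a 1 by rewrite lt_min a0 ltr01.
have Ce : C * expR (- Num.min a 1 * n%:R) @[n --> \oo] --> (0 : R).
  by rewrite -[X in _ --> X](mulr0 C); apply: cvgM; [exact: cvg_cst|exact: cvg_expRn].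
split; apply: (squeeze_cvgr _ (cvg_cst 0) Ce); apply: nearW => n;
  by rewrite gker_ge0 (le_trans (h _))// ?normrN ger0_norm.
Qed.

(** The functional equation Gamma(z + 1) = z Gamma(z), by parts. The derivative of gker a v e^(i y
    v) is (a + i y) gker a v e^(i y v) - gker (a + 1) v e^(i y v), and its integral is 0 because the
    kernel vanishes at both ends. *)
Lemma rgammaS_ft a y : 0 < a ->
  ft (gker (a + 1)) y = (a +i* y) * ft (gker a) y.
Proof.
move=> a0; have a10 : 0 < a + 1 by rewrite addr_gt0.
have h0 := gker_L1 a0; have h1 := gker_L1 a10.
have [cy cNy] := gker_cvgy a0.
have k1 v : gker (a + 1) v = expR v * gker a v.
  by rewrite -gker_shift mul1r.
have cc : continuous (fun v : R => cos (y * v)).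
  move=> x; apply: continuous_comp; last exact: continuous_cos.
  by apply: cvgM; [exact: cvg_cst|exact: cvg_id].
have cs : continuous (fun v : R => sin (y * v)).
  move=> x; apply: continuous_comp; last exact: continuous_sin.
  by apply: cvgM; [exact: cvg_cst|exact: cvg_id].
have cg := @continuous_gker R a; have cg1 := @continuous_gker R (a + 1).
have lim (u : nat -> R) (f : R -> R) : (forall v, `|f v| <= 1) ->
    gker a (u n) @[n --> \oo] --> (0 : R) -> gker a (u n) * f (u n) @[n --> \oo] --> (0 : R).
  move=> f1 gu; apply/norm_cvg0P; apply: (squeeze_cvgr _ (cvg_cst 0) gu).
  by apply: nearW => n; rewrite normr_ge0 normrM (ger0_norm (gker_ge0 _ _)) ler_piMr ?gker_ge0.
have dc (x : R) : is_derive x 1 (fun v => gker a v * cos (y * v))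
    (a * (gker a x * cos (y * x)) - gker (a + 1) x * cos (y * x) - y * (gker a x * sin (y * x))).
  by apply: is_derive_eq; rewrite /GRing.scale/= k1 /gker; ring.
have ds (x : R) : is_derive x 1 (fun v => gker a v * sin (y * v))
    (a * (gker a x * sin (y * x)) - gker (a + 1) x * sin (y * x) + y * (gker a x * cos (y * x))).
  by apply: is_derive_eq; rewrite /GRing.scale/= k1 /gker; ring.
have h0c := L1_cos y h0; have h1c := L1_cos y h1.
have h0s := L1_sin y h0; have h1s := L1_sin y h1.
have Ic : a * fcos (gker a) y - fcos (gker (a + 1)) y - y * fsin (gker a) y = 0.
  have := FTC_T (l := 0) (l' := 0) dc; rewrite subrr => <-.
  - rewrite RintegralB ?RintegralB ?RintegralZl//; [exact: L1Z| |exact: L1Z].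
    by apply: L1B => //; exact: L1Z.
  - move=> x; apply: cvgB; last first.
      by apply: cvgM; [exact: cvg_cst|apply: cvgM; [exact: cg|exact: cs]].
    apply: cvgB; last by apply: cvgM; [exact: cg1|exact: cc].
    by apply: cvgM; [exact: cvg_cst|apply: cvgM; [exact: cg|exact: cc]].
  - by apply: L1B; [apply: L1B => //|]; exact: L1Z.
  - exact: (lim _ (fun v => cos (y * v)) (fun v => cos_max _) cy).
  - exact: (lim _ (fun v => cos (y * v)) (fun v => cos_max _) cNy).
have Is : a * fsin (gker a) y - fsin (gker (a + 1)) y + y * fcos (gker a) y = 0.
  have := FTC_T (l := 0) (l' := 0) ds; rewrite subrr => <-.
  - rewrite RintegralD ?RintegralB ?RintegralZl//; [exact: L1Z| |exact: L1Z].
    by apply: L1B => //; exact: L1Z.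
  - move=> x; apply: cvgD; last first.
      by apply: cvgM; [exact: cvg_cst|apply: cvgM; [exact: cg|exact: cc]].
    apply: cvgB; last by apply: cvgM; [exact: cg1|exact: cs].
    by apply: cvgM; [exact: cvg_cst|apply: cvgM; [exact: cg|exact: cs]].
  - by apply: L1D; [apply: L1B => //|]; exact: L1Z.
  - exact: (lim _ (fun v => sin (y * v)) (fun v => sin_max _) cy).
  - exact: (lim _ (fun v => sin (y * v)) (fun v => sin_max _) cNy).
rewrite /ft; move: Ic Is.
move: (fcos (gker a) y) (fsin (gker a) y) (fcos (gker (a + 1)) y) (fsin (gker (a + 1)) y).
move=> c s c1 s1 Ic Is.
congr (_ +i* _); first by rewrite -[LHS]addr0 -Ic; ring.
by rewrite -[LHS]addr0 -Is; ring.
Qed.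

Lemma rgammaS a : 0 < a -> rgamma (a + 1) = a * rgamma a.
Proof.
move=> a0; have := rgammaS_ft 0 a0; rewrite !ft0 -!/(rgamma _) => -[-> _].
by rewrite mul0r subr0.
Qed.

Lemma abs_sin_le (x : R) : `|sin x| <= `|x|.
Proof.
wlog x0 : x / 0 <= x.
  move=> h; case: (leP 0 x) => [/h//|/ltW x0].
  by rewrite -normrN -sinN -[leRHS]normrN h// oppr_ge0.
have [->|xn0] := eqVneq x 0; first by rewrite sin0.
have x1 : 0 < x by rewrite lt_neqAle eq_sym xn0.
have [|c _] := @MVT _ sin cos 0 x x1 _ _.
  by apply: continuous_subspaceT; exact: continuous_sin.
by rewrite sin0 !subr0 => ->; rewrite normrM ler_piMl ?cos_max.
Qed.

Lemma cos_ge_quadratic (x : R) : 1 - x ^+ 2 / 2 <= cos x.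
Proof.
have -> : cos x = 1 - 2 * sin (x / 2) ^+ 2.
  have -> : cos x = cos (x / 2 + x / 2) by congr cos; field.
  by rewrite cosD -!expr2 cos2sin2; ring.
rewrite lerD2l lerN2 -[sin _ ^+ 2]real_normK ?num_real//.
have := lerXn2r 2 (normr_ge0 (sin (x / 2))) (normr_ge0 (x / 2)) (abs_sin_le (x / 2)).
rewrite (real_normK (num_real (x / 2))) => h; lra.
Qed.

(** The bracket is (e^x - e^(- x))^2 for x = w / 2, and e^x - e^(- x) >= x suffices; this crude
    bound is what costs the 4. Exponentials are wanted because they turn [gker b] into
    [gker (b + 1)] and [gker (b - 1)]. *)
Lemma sqr_le_cosh (w : R) : w ^+ 2 <= 4 * (expR w + expR (- w) - 2).
Proof.
wlog w0 : w / 0 <= w.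
  move=> h; case: (leP 0 w) => [/h//|/ltW w0].
  by have := h (- w); rewrite oppr_ge0 sqrrN opprK [expR (- w) + _]addrC => /(_ w0).
pose x := w / 2; have x0 : 0 <= x by rewrite divr_ge0.
have e1 : expR x - expR (- x) >= x.
  have e0 := expR_ge1Dx x; have p1 : 0 < 1 + x by rewrite ltr_pwDl.
  have : expR (- x) <= (1 + x)^-1 by rewrite expRN lef_pV2 ?posrE ?expR_gt0.
  move=> h; have : x <= 1 + x - (1 + x)^-1; last by lra.
  rewrite -subr_ge0 (_ : _ - x = x / (1 + x)); first by rewrite divr_ge0// ltW.
  by field; rewrite gt_eqF.
have -> : expR w + expR (- w) - 2 = (expR x - expR (- x)) ^+ 2.
  have ew : expR w = expR x * expR x by rewrite -expRD; congr expR; rewrite /x; field.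
  have eNw : expR (- w) = expR (- x) * expR (- x) by rewrite -expRD; congr expR; rewrite /x; field.
  have e1' := expRxMexpNx_1 x.
  rewrite ew eNw; apply/eqP; rewrite -subr_eq0; apply/eqP.
  by transitivity (2 * (expR x * expR (- x) - 1)); [ring|rewrite e1'; ring].
have -> : w ^+ 2 = 4 * x ^+ 2 by rewrite /x; field.
by rewrite ler_pM2l// lerXn2r ?nnegrE// (le_trans x0).
Qed.

(* For large [n], the measure [gker (a + n) v dv] concentrates near [ln (a + n)]
   on the scale given by the frequency [y]. *)
Lemma ft_gker_neq0 a y : 0 < a -> ft (gker a) y != 0.
Proof.
move=> a0; apply/eqP => fa0.
(* This choice gives [2 * y ^+ 2 < b - 1], which makes the final lower bound
   [rgamma b * (1 - 2 * y ^+ 2 / (b - 1))] positive. *)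
pose n := (Num.truncn (2 * y ^+ 2 + 1)).+1.
have nb : 2 * y ^+ 2 + 1 < n%:R by rewrite truncnS_gt.
pose b := a + n%:R; pose t := ln b.
have y2 := sqr_ge0 y.
have b1 : 2 * y ^+ 2 < b - 1 by rewrite /b; lra.
have b10 : 0 < b - 1 by lra.
have b0 : 0 < b by lra.
(* The functional equation propagates a zero from [a] to every [a + k], so a contradiction at [b] is
   enough. *)
have fb : ft (gker b) y = 0.
  rewrite /b; elim: (n) => [|k IH]; first by rewrite addr0.
  by rewrite -natr1 addrA rgammaS_ft ?IH ?mulr0// ltr_wpDr.
have hb := gker_L1 b0; have hb1 := gker_L1 b10.
have hbp : L1 (gker (b + 1)) by apply: gker_L1; rewrite addr_gt0.
have := fcos_fsin_translate t y hb.
have -> : fcos (gker b) y = 0 by have := congr1 (@complex.Re R) fb.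
have -> : fsin (gker b) y = 0 by have := congr1 (@complex.Im R) fb.
rewrite !mul0r addr0 => /eqP; apply/negP; rewrite lt_eqF//.
have gb0 := rgamma_gt0 b0.
have eb : expR t = b by rewrite lnK ?posrE.
(* [lo] minorises [gker b v * cos (y * (t - v))]: the cosine is at least 1 - y^2 (t - v)^2 / 2, and
   the square is at most 4 (b e^(- v) + e^v / b - 2) because [expR t = b]. *)
pose lo v := gker b v * (1 + 4 * y ^+ 2) - (2 * y ^+ 2 / b) * gker (b + 1) v
  - (2 * y ^+ 2 * b) * gker (b - 1) v.
have hlo : L1 lo.
  apply: L1B; last exact: L1Z.
  apply: L1B; last exact: L1Z.
  by have := L1Z (1 + 4 * y ^+ 2) hb; congr (_.-integrable _ _); apply/funext => v /=;
    rewrite mulrC.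
apply: (@lt_le_trans _ _ (\int[mu]_v lo v)); last first.
  apply: le_Rintegral => //.
    by apply: (L1M hb _ (fun v => cos_max _)); have := @measurable_gker R b => m; meas.
  move=> v _; rewrite /lo.
  have -> : gker (b + 1) v = gker b v * expR v by rewrite -gker_shift mul1r mulrC.
  have -> : gker (b - 1) v = gker b v * expR (- v) by rewrite -gker_shift mulN1r mulrC.
  have cq := cos_ge_quadratic (y * (t - v)).
  have sq := sqr_le_cosh (t - v).
  have ew : expR (t - v) = b * expR (- v) by rewrite expRD eb.
  have eNw : expR (- (t - v)) = expR v / b by rewrite opprB expRD expRN eb.
  rewrite ew eNw in sq.
  have sq' := ler_wpM2l y2 sq.
  rewrite (_ : _ - _ = gker b v *
      (1 - (y ^+ 2 * (4 * (b * expR (- v) + expR v / b - 2))) / 2)); last first.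
    by field; rewrite gt_eqF.
  rewrite ler_wpM2l ?gker_ge0// (le_trans _ cq)//.
  rewrite lerD2l lerN2 ler_pM2r// ?invr_gt0//.
  by rewrite exprMn.
have I1 : rgamma (b + 1) = b * rgamma b by rewrite rgammaS.
have I2 : rgamma (b - 1) = rgamma b / (b - 1).
  have := rgammaS b10; rewrite subrK => ->.
  by rewrite mulrC mulKf// gt_eqF.
have hb' : L1 (fun v => gker b v * (1 + 4 * y ^+ 2)).
  by have := L1Z (1 + 4 * y ^+ 2) hb; congr (_.-integrable _ _); apply/funext => v /=;
    rewrite mulrC.
rewrite /lo RintegralB ?RintegralB ?RintegralZl ?RintegralZr//; [|exact: L1Z| |exact: L1Z];
  last first.
  by apply: L1B => //; exact: L1Z.
rewrite -!/(rgamma _) I1 I2.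
rewrite (_ : _ - _ = rgamma b * ((b - 1 - 2 * y ^+ 2) / (b - 1))); last first.
  by field; rewrite !gt_eqF.
by rewrite mulr_gt0// divr_gt0// subr_gt0.
Qed.

End gamma_function.

(** * The Beta kernel *)

Section beta_kernel.
Context {R : realType}.
Local Notation mu := (@lebesgue_measure R).
Local Notation L1 F := (mu.-integrable setT (EFin \o F)).
Implicit Types (a b w v y : R).
Local Open Scope complex_scope.

(* The integrand of the Beta integral B(w, 1/2) in the logarithmic variable,
   that is [expR (w * v) / Num.sqrt (1 - expR v)] for [v < 0] and [0] otherwise. *)
Definition bker (w v : R) : R :=
  expR (w * v) * expR (- (ln (1 - expR v) / 2)) * (0 < - v)%R%:R.

Lemma bker_ge0 w v : 0 <= bker w v.
Proof. by rewrite !mulr_ge0 ?expR_ge0. Qed.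

Lemma bker_shift w s v : expR (s * v) * bker w v = bker (w + s) v.
Proof. by rewrite /bker !mulrA -expRD -mulrDl [s + w]addrC. Qed.

Lemma measurable_bker w : measurable_fun setT (bker w).
Proof. by rewrite /bker; meas. Qed.

(** With [t = expR v] the convolution is t^w times the integral of (x - t)^(-1/2) e^(- x) over x >
    t, and the translation x -> x + t leaves t^w e^(- t) Gamma(1/2). In the proof [phi] is the
    integrand in ln x, [psi] the one in x, and [phi2] the one in the logarithm of the translated
    variable. *)
Lemma convol_bker w v : convol (bker w) (gker (w + 2^-1)) v = rgamma 2^-1 * gker w v.
Proof.
have mb := @measurable_bker; have mg := @measurable_gker R.
pose t := expR v; have t0 : 0 < t := expR_gt0 v.
pose phi u := expR (w * v) * (expR (u / 2) * expR (- (ln (1 - expR (v - u)) / 2)) *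
  expR (- expR u)) * (0 < u - v)%R%:R.
have mphi : measurable_fun setT phi by rewrite /phi; meas.
pose psi x := expR (w * v) * (expR (- (ln (x - t) / 2)) * expR (- x)) * (0 < x - t)%R%:R.
have mpsi : measurable_fun setT psi by rewrite /psi; meas.
pose phi2 u := (expR (w * v) * expR (- t)) * gker 2^-1 u.
have mphi2 : measurable_fun setT phi2 by rewrite /phi2 /gker; meas.
have -> : rgamma 2^-1 * gker w v = \int[mu]_u phi2 u.
  by rewrite RintegralZl//; [rewrite mulrC|apply: gker_L1; rewrite invr_gt0].
transitivity (\int[mu]_u phi u).
  rewrite /convol -(@Rintegral_reflect _ (fun x => bker w x * gker (w + 2^-1) (v - x)) v);
    last first.
    by rewrite /bker /gker; meas.
  apply: eq_Rintegral => u _; rewrite /phi /bker /gker subKr opprB.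
  have -> : expR (w * v) = expR (w * (v - u)) * expR (w * u).
    by rewrite -expRD -mulrDr subrK.
  have -> : expR ((w + 2^-1) * u) = expR (w * u) * expR (u / 2).
    by rewrite -expRD mulrDl [2^-1 * u]mulrC.
  by ring.
rewrite -(Rintegral_ln mphi).
transitivity (\int[mu]_x psi x).
  rewrite Rintegral_mkcond; apply: eq_Rintegral => x _; rewrite patchE mem_setE in_itv/= andbT.
  case: ifPn => [x0|]; last first.
    rewrite -leNgt => x0; rewrite /psi ltNge subr_le0 (le_trans x0 (ltW t0)) mulr0.
    by [].
  rewrite /phi /psi -/t !lnK ?posrE//.
  have -> : (0 < ln x - v) = (0 < x - t).
    by rewrite !subr_gt0 /t -[X in _ = (_ < X)]lnK ?posrE// ltr_expR.
  case: ltP => xt; last by rewrite !mulr0 mul0r.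
  have -> : expR (v - ln x) = t / x by rewrite expRD expRN lnK.
  have -> : ln (x - t) = ln (1 - t / x) + ln x.
    rewrite -lnM ?posrE//; first by congr ln; field; rewrite gt_eqF.
    by rewrite subr_gt0 ltr_pdivrMr// mul1r -subr_gt0.
  have -> : expR (ln x / 2) = x * expR (- (ln x / 2)).
    by rewrite -{2}(lnK x0) -expRD; congr expR; field.
  rewrite mulrDl opprD expRD; field; rewrite gt_eqF//.
rewrite -(Rintegral_shift t mpsi) -(Rintegral_ln mphi2).
rewrite [RHS]Rintegral_mkcond; apply: eq_Rintegral => x _; rewrite patchE mem_setE in_itv/= andbT.
rewrite /psi addrK; case: ifPn => [x0|_]; last by rewrite mulr0.
rewrite mulr1 /phi2 /gker lnK ?posrE// opprD expRD.
have -> : expR (2^-1 * ln x) = x * expR (- (ln x / 2)).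
  by rewrite -{2}(lnK x0) -expRD; congr expR; field.
by field; rewrite gt_eqF.
Qed.

(** [fine] sends infinities to 0, so a nonzero value certifies finiteness. *)
Lemma fine_EFin_neq0 (x : \bar R) (r : R) : r != 0 -> fine x = r -> x = r%:E.
Proof. by case: x => [x _ /= ->| /= r0 E| /= r0 E]//; rewrite -E eqxx in r0. Qed.

(** The singularity at 0 needs no estimate. By Tonelli, the integral of [bker w] times
    [rgamma (w + 2^-1)] is the integral of the convolution, known to be a multiple of [gker w],
    hence finite. *)
Lemma bker_L1 w : 0 < w -> L1 (bker w).
Proof.
move=> w0; have w20 : 0 < w + 2^-1 by rewrite addr_gt0 ?invr_gt0.
have h20 : 0 < 2^-1 :> R by rewrite invr_gt0.
have mb := measurable_bker w; have mg := @measurable_gker R (w + 2^-1).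
pose k (z : R * R) := bker w z.1 * gker (w + 2^-1) (z.2 - z.1).
have mk : measurable_fun setT (EFin \o k) by apply/measurable_EFinP; rewrite /k; meas.
have k0 z : (0 <= (EFin \o k) z)%E by rewrite /= lee_fin mulr_ge0 ?bker_ge0 ?gker_ge0.
have := @fubini_tonelli _ _ _ _ R mu mu _ mk k0.
have E1 x : (\int[mu]_y (EFin \o k) (x, y) = (bker w x * rgamma (w + 2^-1))%:E)%E.
  have hx : L1 (fun y => gker (w + 2^-1) (y - x)).
    have := L1_affine (- x) ltr01 (gker_L1 w20).
    by congr (_.-integrable _ _); apply/funext => y; rewrite /= mul1r.
  rewrite /rgamma -(Rintegral_shift (- x) mg) -RintegralZl// -L1_EFin//.
  exact: L1Z.
have E2 x : (\int[mu]_y (EFin \o k) (y, x) = (rgamma 2^-1 * gker w x)%:E)%E.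
  apply: fine_EFin_neq0; last by rewrite -convol_bker.
  by rewrite gt_eqF// mulr_gt0 ?rgamma_gt0 ?gker_gt0.
move=> FT; have E : (\int[mu]_x (bker w x * rgamma (w + 2^-1))%:E =
    (\int[mu]_x (rgamma 2^-1 * gker w x))%:E)%E.
  rewrite -L1_EFin; last exact/L1Z/gker_L1.
  transitivity (\int[mu]_x \int[mu]_y (EFin \o k) (x, y))%E.
    by apply: eq_integral => x _; rewrite -E1.
  by rewrite FT; apply: eq_integral => x _; exact: E2.
clear FT E1 E2 k mk k0; have g0 := rgamma_gt0 w20.
have h : L1 (fun x => bker w x * rgamma (w + 2^-1)).
  apply: L1_ge0P; [by meas| |by rewrite E ltry].
  by move=> x; exact: (mulr_ge0 (bker_ge0 w x) (ltW g0)).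
have := L1Z (rgamma (w + 2^-1))^-1 h; congr (_.-integrable _ _); apply/funext => x /=.
by rewrite [bker w x * _]mulrC mulKf// gt_eqF.
Qed.

Lemma Rintegral_bker w : 0 < w ->
  \int[mu]_v bker w v = rgamma 2^-1 * rgamma w / rgamma (w + 2^-1).
Proof.
move=> w0; have w20 : 0 < w + 2^-1 by rewrite addr_gt0 ?invr_gt0.
have [C C0 hC] := gker_bounded (ltW w20).
have := Rintegral_convol (bker_L1 w0) (gker_L1 w20) (bker_ge0 w) hC.
under eq_Rintegral do rewrite convol_bker.
rewrite RintegralZl//; last exact: gker_L1.
by rewrite -!/(rgamma _) => ->; rewrite mulfK// gt_eqF// rgamma_gt0.
Qed.

Lemma ftZ (k : R) (F : R -> R) y : L1 F -> ft (fun v => k * F v) y = k%:C * ft F y.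
Proof.
move=> hF; have hc := L1_cos y hF; have hs := L1_sin y hF.
rewrite /ft; congr (_ +i* _); rewrite /= mul0r ?subr0 ?addr0.
  by rewrite /fcos -RintegralZl//; apply: eq_Rintegral => v _; rewrite mulrA.
by rewrite /fsin -RintegralZl//; apply: eq_Rintegral => v _; rewrite mulrA.
Qed.

Lemma ft_bker w y : 0 < w ->
  ft (bker w) y = (rgamma 2^-1)%:C * ft (gker w) y / ft (gker (w + 2^-1)) y.
Proof.
move=> w0; have w20 : 0 < w + 2^-1 by rewrite addr_gt0 ?invr_gt0.
have [C C0 hC] := gker_bounded (ltW w20).
have := ft_convol y (bker_L1 w0) (gker_L1 w20) (bker_ge0 w) hC.
rewrite (_ : convol _ _ = (fun v => rgamma 2^-1 * gker w v)); last by apply/funext/convol_bker.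
rewrite ftZ; last exact: gker_L1.
by move=> ->; rewrite mulfK// ft_gker_neq0.
Qed.

(** Splits the non-integrable [bker 0] into a step function and an integrable remainder. With t =
    e^v and s = (1 - t)^(-1/2) the upper bound s - 1 <= t s amounts to s (1 - t) <= 1, that is 1 / s
    <= 1. *)
Lemma bker0_bound v : 0 <= bker 0 v - (0 < - v)%R%:R <= bker 1 v.
Proof.
rewrite /bker mul0r expR0 mul1r mul1r; case: ltP => v0; last by rewrite !mulr0 subrr lexx.
rewrite !mulr1; set t := expR v.
have t0 : 0 < t := expR_gt0 v.
have t1 : t < 1 by rewrite expR_lt1 -oppr_gt0.
have e1 : 0 < 1 - t by rewrite subr_gt0.
set s := expR (- (ln (1 - t) / 2)).
have s0 : 0 < s := expR_gt0 _.
have ss : s * s * (1 - t) = 1.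
  rewrite -expRD (_ : _ + _ = - ln (1 - t)); last by field.
  by rewrite expRN lnK ?posrE// mulVf// gt_eqF.
have s1 : 1 <= s.
  by rewrite -expR0 ler_expR oppr_ge0 pmulr_lle0 ?invr_gt0// ln_le0// gerBl ltW.
rewrite subr_ge0 s1/= lerBlDr -lerBlDl -[X in X - _]mul1r -mulrBl.
rewrite -(ler_pM2l s0) mulrA mulr1 [s * (1 - t) * s]mulrAC ss//.
Qed.

End beta_kernel.

(** * Mellin inversion and convolution powers *)

Section mellin_inversion.
Context {R : realType}.
Local Notation mu := (@lebesgue_measure R).
Local Notation L1 F := (mu.-integrable setT (EFin \o F)).
Implicit Types (a b w v y : R) (F : R -> R).
Local Open Scope complex_scope.

Lemma continuous_fcos F : L1 F -> continuous (fcos F).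
Proof.
move=> hF y; have mF := L1_measurable hF; apply/(@cvg_nbhsP _ R^o) => u uy.
apply: (@Rintegral_dominated _ _ _ (fun v => `|F v|)); [by move=> n;
  meas|by meas|exact: L1_norm| |].
  apply: aeW => v; apply: cvgM; first exact: cvg_cst.
  have cu : u n * v @[n --> \oo] --> y * v by apply: cvgM => //; exact: cvg_cst.
  exact: (cvg_comp _ cos cu (@continuous_cos _ _)).
by move=> n v; rewrite normrM ler_piMr// cos_max.
Qed.

Lemma continuous_fsin F : L1 F -> continuous (fsin F).
Proof.
move=> hF y; have mF := L1_measurable hF; apply/(@cvg_nbhsP _ R^o) => u uy.
apply: (@Rintegral_dominated _ _ _ (fun v => `|F v|)); [by move=> n;
  meas|by meas|exact: L1_norm| |].
  apply: aeW => v; apply: cvgM; first exact: cvg_cst.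
  have cu : u n * v @[n --> \oo] --> y * v by apply: cvgM => //; exact: cvg_cst.
  exact: (cvg_comp _ sin cu (@continuous_sin _ _)).
by move=> n v; rewrite normrM ler_piMr// sin_max.
Qed.

(** The squared modulus with values in [R], a polynomial in the two parts, so that multiplicativity
    is a ring identity. *)
Definition nsq (z : R[i]) : R := complex.Re z ^+ 2 + complex.Im z ^+ 2.

Lemma nsq_ge0 z : 0 <= nsq z.
Proof. by rewrite addr_ge0// sqr_ge0. Qed.

Lemma nsqM z t : nsq (z * t) = nsq z * nsq t.
Proof. by case: z t => [a b] [c d]; rewrite /nsq /=; ring. Qed.

Lemma nsqV z : nsq z^-1 = (nsq z)^-1.
Proof.
have [->|z0] := eqVneq z 0; first by rewrite invr0 /nsq /= expr0n/= addr0 invr0.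
have h : nsq z^-1 * nsq z = 1 by rewrite -nsqM mulVf// /nsq /= expr1n expr0n addr0.
have n0 : nsq z != 0.
  by apply: contra_eq_neq h => ->; rewrite mulr0 eq_sym oner_neq0.
by apply: (mulIf n0); rewrite h mulVf.
Qed.

Lemma nsqX z n : nsq (z ^+ n) = nsq z ^+ n.
Proof.
elim: n => [|n IH]; first by rewrite !expr0 /nsq /= expr1n expr0n addr0.
by rewrite !exprS nsqM IH.
Qed.

Lemma nsq_ft F y : L1 F -> (forall x, 0 <= F x) -> nsq (ft F y) <= 2 * (\int[mu]_v F v) ^+ 2.
Proof.
move=> hF F0.
have mF := L1_measurable hF.
have h (g : R -> R) : L1 (fun v => F v * g v) -> (forall v, `|g v| <= 1) ->
    (\int[mu]_v (F v * g v)) ^+ 2 <= (\int[mu]_v F v) ^+ 2.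
  move=> hg g1; rewrite -[leLHS]real_normK ?num_real// lerXn2r ?nnegrE//.
    by apply: Rintegral_ge0 => v _.
  apply: (le_trans (le_normr_Rintegral measurableT hg)).
  apply: le_Rintegral => //; first exact: L1_norm.
  by move=> v _; rewrite normrM (ger0_norm (F0 v)) ler_piMr.
rewrite mulr_natl mulr2n /nsq lerD//=.
  by apply: h => [|v]; [exact: L1_cos|exact: cos_max].
by apply: h => [|v]; [exact: L1_sin|exact: sin_max].
Qed.

(** From |Gamma(a + i y)|^2 = |Gamma(a + 1 + i y)|^2 / (a^2 + y^2), with the numerator bounded by
    the integral of [gker (a + 1)]. The factor 1 + a^(-2) compares a^2 + y^2 with 1 + y^2. *)
Lemma nsq_ft_gker a y : 0 < a ->
  nsq (ft (gker a) y) <= 2 * rgamma (a + 1) ^+ 2 * (1 + a ^- 2) / (1 + y ^+ 2).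
Proof.
move=> a0; have a1 : 0 < a + 1 by rewrite addr_gt0.
have y0 := sqr_ge0 y.
have p1 : 0 < 1 + y ^+ 2 by rewrite ltr_pwDl.
have a2 : 0 < a ^+ 2 by rewrite exprn_gt0.
have d0 : 0 < a ^+ 2 + y ^+ 2 by rewrite ltr_pwDl.
have := nsq_ft y (gker_L1 a1) (gker_ge0 (a + 1)).
rewrite rgammaS_ft// nsqM -/(rgamma _) [X in X * _ <= _]/nsq /= => h.
rewrite ler_pdivlMr//.
apply: (@le_trans _ _ ((1 + a ^- 2) * ((a ^+ 2 + y ^+ 2) * nsq (ft (gker a) y)))).
  rewrite mulrC mulrA ler_wpM2r ?nsq_ge0//.
  rewrite (_ : _ * _ = 1 + y ^+ 2 + (a ^+ 2 + y ^+ 2 / a ^+ 2)); last by field; rewrite gt_eqF.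
  by rewrite lerDl addr_ge0 ?divr_ge0// ltW.
rewrite [leRHS]mulrC ler_wpM2l// addr_ge0// invr_ge0 ltW//.
Qed.

Lemma nsq_L1 F (C : R) : L1 F -> (forall y, nsq (ft F y) <= (C / (1 + y ^+ 2)) ^+ 2) ->
  L1 (fcos F) /\ L1 (fsin F).
Proof.
move=> hF h; have [hP _] := @poisson_kernel R.
have b (x t y : R) : x ^+ 2 + t ^+ 2 <= (C / (1 + y ^+ 2)) ^+ 2 -> `|x| <= `|C| * (1 + y ^+ 2)^-1.
  move=> le; have p1 : 0 < (1 + y ^+ 2)^-1 by rewrite invr_gt0 ltr_pwDl// sqr_ge0.
  rewrite -(gtr0_norm p1) -normrM -ler_sqr ?nnegrE// !real_normK ?num_real//.
  by rewrite (le_trans _ le)// lerDl sqr_ge0.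
split.
  apply: (L1_le _ _ (L1Z `|C| hP)); first by apply: continuous_measurable_fun;
    exact: continuous_fcos.
  by move=> y; apply: b (h y).
apply: (L1_le _ _ (L1Z `|C| hP)); first by apply: continuous_measurable_fun; exact: continuous_fsin.
by move=> y; have := h y; rewrite /nsq addrC; exact: b.
Qed.

(** Fourier inversion with [y] reversed: on the contour the Gamma arguments are b - s - i y, which
    puts the transform at [- y]. *)
Lemma mellin_inversion F (A C x : R) : L1 F -> continuous F -> (forall v, `|F v| <= A) ->
  (forall y, nsq (ft F y) <= (C / (1 + y ^+ 2)) ^+ 2) ->
  L1 (fun y => complex.Re (ft F (- y) * (cos (y * x) +i* sin (y * x)))) /\
  \int[mu]_y complex.Re (ft F (- y) * (cos (y * x) +i* sin (y * x))) = 2 * pi * F x.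
Proof.
move=> hF cF FA hn; have [hc hs] := nsq_L1 hF hn.
rewrite -(fourier_inversion x hF cF FA hc hs).
have mc := L1_measurable hc; have ms := L1_measurable hs.
have hg : L1 (fun y => fcos F y * cos (y * x) + fsin F y * sin (y * x)).
  by apply: L1D; [apply: (L1M hc _ (fun y => cos_max _))|apply: (L1M hs _ (fun y => sin_max _))];
    meas.
have E : (fun y => complex.Re (ft F (- y) * (cos (y * x) +i* sin (y * x)))) =
    (fun y => fcos F (- y) * cos (- y * x) + fsin F (- y) * sin (- y * x)).
  by apply/funext => y /=; rewrite mulNr cosN sinN mulrN.
rewrite E; split; first exact: (L1_opp hg).
exact: (Rintegral_opp (L1_measurable hg)).
Qed.

End mellin_inversion.

Section convolution_powers.
Context {R : realType}.
Local Notation mu := (@lebesgue_measure R).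
Local Notation L1 F := (mu.-integrable setT (EFin \o F)).
Local Open Scope complex_scope.

(** The mass is not normalised to 1, hence the powers of the total mass in the bounds on [cumul]. *)
Definition density (h : R -> R) := [/\ L1 h, continuous h, forall v, 0 <= h v &
  exists A, forall v, h v <= A].

(* If [h] is the density of [v], this is the mass of [v_1 + ... + v_n < x]. *)
Fixpoint cumul (h : R -> R) (n : nat) : R -> R :=
  if n is n'.+1 then convol (cumul h n') h else fun v => (0 < v)%R%:R.

Lemma density_bound h : density h -> exists A, [/\ 0 <= A & forall v, `|h v| <= A].
Proof.
move=> [_ _ h0 [A hA]]; exists A; split; first exact: le_trans (hA 0).
by move=> v; rewrite ger0_norm.
Qed.

Lemma cumulP h n : density h -> [/\ measurable_fun setT (cumul h n), forall v, 0 <= cumul h n v &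
  forall v, cumul h n v <= (\int[mu]_v h v) ^+ n].
Proof.
move=> dh; have [hL ch h0 _] := dh; have mh := L1_measurable hL.
elim: n => [|n [mT T0 TI]].
  split; [by rewrite /=; meas|by move=> v /=|by move=> v /=; rewrite expr0; case: (0 < v)].
split=> [|v|v] /=.
- exact: convol_measurable.
- exact: convol_ge0.
- rewrite (convolC _ mT mh) exprSr.
  apply: le_trans (ler_norm _) _; apply: (convol_le _ hL h0 mT) => x.
  by rewrite ger0_norm.
Qed.

(** A cumulative mass need not be integrable; it is the bounded factor here, and the reflected [h]
    the integrable one. *)
Lemma cumul_integrable h n x : density h -> L1 (fun w => cumul h n w * h (x - w)).
Proof.
move=> dh; have [hL _ _ _] := dh; have [mT T0 TI] := cumulP n dh.
have := L1M (L1_reflect x hL) mT (fun v => ltac:(by rewrite (ger0_norm (T0 v)); exact: TI v)).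
by congr (_.-integrable _ _); apply/funext => w /=; rewrite mulrC.
Qed.

Lemma cumulS h n x : density h -> cumul h n.+1 x = \int[mu]_v (h v * cumul h n (x - v)).
Proof.
move=> dh; have [hL _ _ _] := dh; have mh := L1_measurable hL.
by have [mT _ _] := cumulP n dh; rewrite /= convolC.
Qed.

Variables (h : R -> R) (s : R).
Hypotheses (s0 : 0 < s) (dh : density h).
Let hs v := expR (- s * v) * h v.
Hypothesis dhs : density hs.

Let ts n v := expR (- s * v) * cumul h n v.

Let tsS n v : ts n.+1 v = convol (ts n) hs v.
Proof. by rewrite /ts /= convol_scale//; exact: cumul_integrable. Qed.

(** A tilt by [s > 0] makes the cumulative masses integrable. The tilted Heaviside function has
    transform 1 / (s - i y), and each convolution contributes one factor [ft hs y]. *)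
Lemma tilted_cumulP n :
  [/\ L1 (ts n), forall v, 0 <= ts n v, exists A, forall v, `|ts n v| <= A &
   forall y, ft (ts n) y = ft hs y ^+ n / (s -i* y)].
Proof.
have [hL ch h0 _] := dhs; have mh := L1_measurable hL.
have [A [A0 hA]] := density_bound dhs.
elim: n => [|n [Lt t0 _ ft_t]].
  have Lt : L1 (ts 0) by exact: exp_L1.
  split=> //.
  - by move=> v; rewrite mulr_ge0 ?expR_ge0//=.
  - exists 1 => v; rewrite /ts /=; case: ltP => v0; last by rewrite mulr0 normr0.
    rewrite mulr1 ger0_norm ?expR_ge0// -expR0 ler_expR mulNr oppr_le0 mulr_ge0// ltW//.
  - move=> y; rewrite expr0 div1r.
    have [Ec Es] := exp_cos_sin y s0.
    have n0 : s ^+ 2 + y ^+ 2 != 0 by rewrite gt_eqF// ltr_pwDl ?sqr_ge0// exprn_gt0.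
    rewrite /ft /fcos /fsin /ts /=.
    under eq_Rintegral do rewrite mulrAC.
    under [X in _ +i* X]eq_Rintegral do rewrite mulrAC.
    rewrite Ec Es; apply/eqP; rewrite eq_complex /=; apply/andP; split; apply/eqP; field;
      by rewrite sqrrN.
have hA' v : 0 <= hs v <= A by rewrite h0 -[leLHS](ger0_norm (h0 v)) hA.
have E : ts n.+1 = convol (ts n) hs by apply/funext => v; exact: tsS.
rewrite E; split.
- exact: (convol_L1 Lt hL t0 hA').
- by move=> v; exact: convol_ge0.
- by exists (A * \int[mu]_v ts n v) => v; exact: convol_le.
- by move=> y; rewrite (ft_convol y Lt hL t0 hA') ft_t exprSr mulrAC.
Qed.

(** [ts 0] jumps at 0; a single convolution with the continuous [hs] removes the jump, so the index
    starts at [n.+1]. *)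
Lemma tilted_cumul_continuous n : continuous (ts n.+1).
Proof.
have [hL ch h0 _] := dhs; have [A [A0 hA]] := density_bound dhs.
have [Lt _ _ _] := tilted_cumulP n.
have -> : ts n.+1 = convol (ts n) hs by apply/funext => v; exact: tsS.
exact: convol_continuous Lt ch hA.
Qed.

(* Perron's formula for the cumulative mass. *)
Lemma cumul_inversion (C x : R) n : 0 < C ->
  (forall y, nsq (ft hs y) <= (C / (1 + y ^+ 2)) ^+ 2) ->
  L1 (fun y => complex.Re (ft hs (- y) ^+ n.+1 / (s +i* y) * (cos (y * x) +i* sin (y * x)))) /\
  \int[mu]_y complex.Re (ft hs (- y) ^+ n.+1 / (s +i* y) * (cos (y * x) +i* sin (y * x))) =
  2 * pi * (expR (- s * x) * cumul h n.+1 x).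
Proof.
move=> C0 hC; have [Lt t0 [A tA] ft_t] := tilted_cumulP n.+1.
have E : (fun y => complex.Re (ft hs (- y) ^+ n.+1 / (s +i* y) * (cos (y * x) +i* sin (y * x)))) =
    (fun y => complex.Re (ft (ts n.+1) (- y) * (cos (y * x) +i* sin (y * x)))).
  by apply/funext => y; rewrite ft_t opprK.
rewrite E -/(ts n.+1 x); apply: (@mellin_inversion _ (ts n.+1) A (C ^+ n.+1 / s) x) => //.
- exact: tilted_cumul_continuous.
(* One of the [n.+1] factors 1 / (1 + y^2) is kept for integrability; the others are bounded by 1,
   and 1 / |s - i y| by 1 / s. *)
- move=> y; rewrite ft_t nsqM nsqX nsqV.
  have p1 : 1 <= 1 + y ^+ 2 by rewrite lerDl sqr_ge0.
  have p0 : 0 < 1 + y ^+ 2 by rewrite (lt_le_trans ltr01).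
  have ss : (nsq (s -i* y))^-1 <= s ^- 2.
    rewrite /nsq /= sqrrN lef_pV2 ?posrE ?exprn_gt0//; first by rewrite lerDl sqr_ge0.
    by rewrite ltr_pwDl ?sqr_ge0// exprn_gt0.
  apply: (@le_trans _ _ (((C / (1 + y ^+ 2)) ^+ 2) ^+ n.+1 * s ^- 2)).
    apply: ler_pM => //; first by rewrite exprn_ge0// nsq_ge0.
      by rewrite invr_ge0 nsq_ge0.
    by rewrite lerXn2r ?nnegrE ?nsq_ge0 ?sqr_ge0.
  rewrite -exprVn -exprAC -exprMn lerXn2r ?nnegrE//.
  + by rewrite mulr_ge0 ?exprn_ge0 ?divr_ge0 ?invr_ge0 ?ltW.
  + by rewrite !divr_ge0 ?exprn_ge0 ?ltW.
  + rewrite [leRHS]mulrAC ler_wpM2r ?invr_ge0 ?(ltW s0)//.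
    rewrite exprMn ler_wpM2l ?exprn_ge0 ?(ltW C0)// exprVn lef_pV2 ?posrE ?exprn_gt0//.
    by rewrite ler_eXnr.
Qed.

End convolution_powers.

(** * Identification of the Meijer functions *)

Section meijer_density.
Context {R : realType}.
Local Notation mu := (@lebesgue_measure R).
Local Notation L1 F := (mu.-integrable setT (EFin \o F)).
Implicit Types (a b w v y : R).
Local Open Scope complex_scope.

(* The function with Mellin transform
   Gamma(a - s) Gamma(b - s) Gamma(w - s) / Gamma(w + 1/2 - s),
   in the logarithmic variable. *)
Definition hker a b w v : R :=
  (rgamma 2^-1)^-1 * convol (convol (bker w) (gker a)) (gker b) v.

Let c0 : 0 < rgamma 2^-1 :> R.
Proof. by apply: rgamma_gt0; rewrite invr_gt0. Qed.

Lemma mulf_rearrange (K : fieldType) (k d x y z : K) : k != 0 ->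
  k^-1 * (k * z / d * x * y) = x * y * z / d.
Proof. by move=> k0; rewrite -!mulrA mulKf//; ring. Qed.

Lemma mulf_cancel (K : fieldType) (x y z g t d : K) : g != 0 ->
  x * (y * z) * g / (t * g * d) = x * y * z / d / t.
Proof.
move=> g0; rewrite !invfM.
have -> : x * (y * z) * g * (t^-1 * g^-1 * d^-1) = x * y * z / d / t * (g / g) by ring.
by rewrite divff// mulr1.
Qed.

Lemma convol_bker_gker a w : 0 < a -> 0 < w ->
  [/\ L1 (convol (bker w) (gker a)), forall v, 0 <= convol (bker w) (gker a) v &
   forall y, ft (convol (bker w) (gker a)) y = ft (bker w) y * ft (gker a) y].
Proof.
move=> a0 w0; have [C C0 hC] := gker_bounded (ltW a0).
have hB := bker_L1 w0; have hG := gker_L1 a0.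
split; first exact: (convol_L1 hB hG (bker_ge0 w) hC).
  by move=> v; apply: convol_ge0; [exact: bker_ge0|exact: gker_ge0].
by move=> y; exact: (ft_convol y hB hG (bker_ge0 w) hC).
Qed.

Lemma hker_density a b w : 0 < a -> 0 < b -> 0 < w -> density (hker a b w).
Proof.
move=> a0 b0 w0; have [hU U0 _] := convol_bker_gker a0 w0.
have [C C0 hC] := gker_bounded (ltW b0).
have nC v : `|gker b v| <= C by rewrite ger0_norm; [case/andP: (hC v)|exact: gker_ge0].
split.
- exact/L1Z/(convol_L1 hU (gker_L1 b0) U0 hC).
- move=> v; apply: cvgM; first exact: cvg_cst.
  exact: (convol_continuous hU (@continuous_gker R b) nC).
- move=> v; apply: mulr_ge0; first by rewrite invr_ge0 ltW.
  by apply: convol_ge0 => // x; exact: gker_ge0.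
- exists ((rgamma 2^-1)^-1 * (C * \int[mu]_v convol (bker w) (gker a) v)) => v.
  apply: ler_wpM2l; first by rewrite invr_ge0 ltW.
  apply: le_trans (ler_norm _) _; exact: (convol_le v hU U0 (measurable_gker b) nC).
Qed.

Lemma ft_hker a b w y : 0 < a -> 0 < b -> 0 < w ->
  ft (hker a b w) y =
  ft (gker a) y * ft (gker b) y * ft (gker w) y / ft (gker (w + 2^-1)) y.
Proof.
move=> a0 b0 w0; have [hU U0 fU] := convol_bker_gker a0 w0.
have [C C0 hC] := gker_bounded (ltW b0).
rewrite /hker ftZ; last exact: (convol_L1 hU (gker_L1 b0) U0 hC).
rewrite (ft_convol y hU (gker_L1 b0) U0 hC) fU ft_bker//.
have -> : ((rgamma 2^-1)^-1)%:C = ((rgamma 2^-1)%:C)^-1 :> R[i] by exact: fmorphV.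
have n0 : (rgamma 2^-1)%:C != 0 :> R[i] by rewrite eq_complex /= (gt_eqF c0).
have n1 : ft (gker (w + 2^-1)) y != 0 by apply: ft_gker_neq0; rewrite addr_gt0 ?invr_gt0.
exact: mulf_rearrange.
Qed.

Lemma hker_shift a b w s v : 0 < a -> 0 < b -> 0 < w ->
  expR (s * v) * hker a b w v = hker (a + s) (b + s) (w + s) v.
Proof.
move=> a0 b0 w0; have [hU U0 _] := convol_bker_gker a0 w0.
have [C C0 hC] := gker_bounded (ltW b0).
have [C' C'0 hC'] := gker_bounded (ltW a0).
have nC x : `|gker b x| <= C by rewrite ger0_norm; [case/andP: (hC x)|exact: gker_ge0].
have nC' x : `|gker a x| <= C' by rewrite ger0_norm; [case/andP: (hC' x)|exact: gker_ge0].
rewrite /hker mulrCA; congr (_ * _).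
rewrite convol_scale; last exact: (convol_integrable v hU (measurable_gker b) nC).
apply: eq_convol => x; last exact: gker_shift.
rewrite convol_scale; last exact: (convol_integrable x (bker_L1 w0) (measurable_gker a) nC').
by apply: eq_convol => t; [exact: bker_shift|exact: gker_shift].
Qed.

Lemma nsq_real (k : R) : nsq k%:C = k ^+ 2.
Proof. by rewrite /nsq /= expr0n addr0. Qed.

(** The decay comes from the two Gamma kernels, each giving 1 / (1 + y^2) for the squared modulus;
    the Beta kernel enters through its total mass only. *)
Lemma nsq_ft_hker a b w : 0 < a -> 0 < b -> 0 < w ->
  exists2 C, 0 < C & forall y, nsq (ft (hker a b w) y) <= (C / (1 + y ^+ 2)) ^+ 2.
Proof.
move=> a0 b0 w0; have [hU U0 fU] := convol_bker_gker a0 w0.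
have [C C0 hC] := gker_bounded (ltW b0).
pose ka := 2 * rgamma (a + 1) ^+ 2 * (1 + a ^- 2).
pose kb := 2 * rgamma (b + 1) ^+ 2 * (1 + b ^- 2).
pose kw := (rgamma 2^-1)^-1 ^+ 2 * (2 * (\int[mu]_v bker w v) ^+ 2).
have k0 (t : R) : 0 <= 2 * rgamma (t + 1) ^+ 2 * (1 + t ^- 2).
  have i0 : 0 <= 1 + t ^- 2 by apply: addr_ge0 => //; rewrite invr_ge0 sqr_ge0.
  exact: (mulr_ge0 (mulr_ge0 (ler0n _ 2) (sqr_ge0 _)) i0).
have kw0 : 0 <= kw by exact: (mulr_ge0 (sqr_ge0 _) (mulr_ge0 (ler0n _ 2) (sqr_ge0 _))).
pose K := kw * ka * kb.
have K0 : 0 <= K by exact: (mulr_ge0 (mulr_ge0 kw0 (k0 a)) (k0 b)).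
(* [K] bounds a square; K <= (1 + K)^2 avoids a square root. *)
exists (1 + K) => [|y]; first by rewrite ltr_pwDl.
have p0 : 0 < 1 + y ^+ 2 by rewrite ltr_pwDl// sqr_ge0.
apply: (@le_trans _ _ (kw * (ka / (1 + y ^+ 2)) * (kb / (1 + y ^+ 2)))).
  rewrite /hker ftZ; last exact: (convol_L1 hU (gker_L1 b0) U0 hC).
  rewrite (ft_convol y hU (gker_L1 b0) U0 hC) fU !nsqM mulrA.
  have n0 := @nsq_ge0 R.
  apply: ler_pM; [exact: (mulr_ge0 (n0 _) (mulr_ge0 (n0 _) (n0 _)))|exact: n0| |exact: nsq_ft_gker].
  rewrite mulrA; apply: ler_pM; [exact: (mulr_ge0 (n0 _) (n0 _))|exact: n0| |exact: nsq_ft_gker].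
  rewrite nsq_real.
  apply: ler_wpM2l; first exact: sqr_ge0.
  exact: (nsq_ft y (bker_L1 w0) (bker_ge0 w)).
rewrite expr_div_n (_ : _ * _ = K / (1 + y ^+ 2) ^+ 2); last by rewrite /K; field; rewrite gt_eqF.
rewrite ler_wpM2r ?invr_ge0 ?sqr_ge0//.
have := sqr_ge0 K; nra.
Qed.

Lemma cpowE (x s y : R) : 0 < x ->
  cpow x (s +i* y) = (expR (s * ln x))%:C * (cos (y * ln x) +i* sin (y * ln x)).
Proof. by move=> x0; rewrite /cpow /cexp /= !mulr0 subr0 add0r. Qed.

Lemma Gamma_subE b s y : s < b -> Gamma (b%:C - (s +i* y)) = ft (gker (b - s)) (- y).
Proof. by move=> sb; rewrite GammaE /= ?sub0r ?subr_gt0. Qed.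

Lemma Re_mulC (k : R) (z : R[i]) : complex.Re (k%:C * z) = k * complex.Re z.
Proof. by case: z => p q /=; rewrite mul0r subr0. Qed.

Lemma meijerGRE m n (a b : seq R) (x : R) (k : R -> R[i]) (s : R) :
  0 < x -> s = xget 0 [set s | separating m n a b s] ->
  (forall y, (\prod_(bj <- take m b) Gamma (bj%:C - (s +i* y)) *
      \prod_(aj <- take n a) Gamma (1 - aj%:C + (s +i* y))) /
      (\prod_(bj <- drop m b) Gamma (1 - bj%:C + (s +i* y)) *
      \prod_(aj <- drop n a) Gamma (aj%:C - (s +i* y))) = k y) ->
  meijerGR m n a b x = (2 * pi)^-1 * \int[mu]_y (expR (s * ln x) *
    complex.Re (k y * (cos (y * ln x) +i* sin (y * ln x)))).
Proof.
move=> x0 sE h; rewrite /meijerGR /meijerG -sE Re_mulC; congr (_ * _).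
apply: eq_Rintegral => y _; rewrite /meijer_integrand h cpowE// mulrCA.
by rewrite Re_mulC.
Qed.

(** On the line of abscissa [s] the Gamma quotient is the transform of [hker] with all parameters
    lowered by [s], that is, of [hker] tilted by [- s]. Inversion at [ln x] gives the tilted value,
    and the modulus x^s of [cpow] removes the tilt. *)
Lemma meijer_density a b w x : 0 < a -> 0 < b -> 0 < w -> 0 < x ->
  meijerGR 3 0 [:: w + 2^-1] [:: a; b; w] x = hker a b w (ln x).
Proof.
move=> a0 b0 w0 x0; set s := xget 0 [set s | separating 3 0 [:: w + 2^-1] [:: a; b; w] s].
have [hsep _] : separating 3 0 [:: w + 2^-1] [:: a; b; w] s.
  (* The abscissa 0 shows that separating lines exist; of the line actually chosen only the
     separation property is used. *)
  apply: (xgetPex 0); exists 0; split => [bj k|//] /=.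
  by rewrite !inE => /or3P[] /eqP ->; rewrite ltr_wpDr.
have sb t : t \in [:: a; b; w] -> 0 < t - s.
  by move=> ht; rewrite subr_gt0; have := hsep t 0%N ht; rewrite addr0.
have as0 : 0 < a - s by rewrite sb// !inE eqxx.
have bs0 : 0 < b - s by rewrite sb// !inE eqxx orbT.
have ws0 : 0 < w - s by rewrite sb// !inE eqxx !orbT.
have [sa sb' sw] : [/\ s < a, s < b & s < w] by split; rewrite -subr_gt0.
have sw2 : s < w + 2^-1 by rewrite (lt_trans sw)// ltrDl invr_gt0.
have sw2E : w + 2^-1 - s = w - s + 2^-1 by rewrite addrAC.
rewrite (@meijerGRE _ _ _ _ _ (fun y => ft (hker (a - s) (b - s) (w - s)) (- y)) s)//; last first.
  move=> y; rewrite /= big_nil !big_cons !big_nil !mulr1 mul1r.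
  rewrite (Gamma_subE y sa) (Gamma_subE y sb') (Gamma_subE y sw) (Gamma_subE y sw2) sw2E.
  by rewrite (ft_hker _ as0 bs0 ws0) mulrA.
have [hL hc h0 [A hA]] := hker_density as0 bs0 ws0.
have [C C0 hC] := nsq_ft_hker as0 bs0 ws0.
have hA' v : `|hker (a - s) (b - s) (w - s) v| <= A by rewrite ger0_norm.
have [hI I] := mellin_inversion (ln x) hL hc hA' hC.
rewrite (RintegralZl _ measurableT hI) I.
rewrite -(hker_shift _ (ln x))// mulNr expRN.
rewrite [expR _ * _]mulrCA mulVKf; last by rewrite gt_eqF ?expR_gt0.
by rewrite mulKf// mulf_neq0// gt_eqF// pi_gt0.
Qed.

Lemma take_cat_size (T : Type) (n : nat) (s t : seq T) : size s = n ->
  take n (s ++ t) = s /\ drop n (s ++ t) = t.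
Proof. by move=> <-; rewrite take_size_cat// drop_size_cat. Qed.

Lemma prod_nseq (T : Type) (f : T -> R[i]) (n : nat) (x : T) :
  \prod_(i <- nseq n x) f i = f x ^+ n.
Proof. by rewrite big_nseq iter_mulr_1. Qed.

(** The upper parameter 1 contributes Gamma(s) and the last lower parameter 0 contributes 1 /
    Gamma(1 + s); together they are Perron's 1 / s. The pole of Gamma(s) at 0 forces [0 < s], the
    positivity that the tilted cumulative masses require. *)
Lemma meijer_cumul M a b w x : (0 < M)%N -> 0 < a -> 0 < b -> 0 < w -> 0 < x ->
  meijerGR (3 * M) 1 (1 :: nseq M (w + 2^-1))
    (nseq M a ++ nseq M b ++ nseq M w ++ [:: 0]) x = cumul (hker a b w) M (ln x).
Proof.
move=> M0 a0 b0 w0 x0; set aa := 1 :: _; set bb := _ ++ _.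
pose s := xget 0 [set s | separating (3 * M) 1 aa bb s].
have [tb db] : take (3 * M) bb = nseq M a ++ nseq M b ++ nseq M w /\ drop (3 * M) bb = [:: 0].
  rewrite /bb !catA; apply: take_cat_size; rewrite !size_cat !size_nseq.
  by rewrite !mulSn mul0n addn0 addnA.
have [hsep hsep'] : separating (3 * M) 1 aa bb s.
  apply: (xgetPex 0); exists (Num.min a (Num.min b w) / 2).
  have q0 : 0 < Num.min a (Num.min b w) by rewrite !lt_min a0 b0.
  split => [bj k|aj k].
    rewrite tb !mem_cat !mem_nseq M0 /= => h.
    apply: (@lt_le_trans _ _ (Num.min a (Num.min b w))); first by lra.
    rewrite -[leLHS]addr0 lerD//.
    by case/or3P : h => /eqP ->; rewrite !ge_min lexx ?orbT.
  rewrite /= take0 inE => /eqP ->; rewrite subrr sub0r.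
  by rewrite (le_lt_trans (y := 0)) ?oppr_le0// divr_gt0.
have s0 : 0 < s by have := hsep' 1 0%N; rewrite /= take0 inE eqxx subrr subr0; exact.
have sb t : t \in nseq M a ++ nseq M b ++ nseq M w -> 0 < t - s.
  by rewrite -tb => ht; rewrite subr_gt0; have := hsep t 0%N ht; rewrite addr0.
have as0 : 0 < a - s by rewrite sb// !mem_cat !mem_nseq M0 eqxx.
have bs0 : 0 < b - s by rewrite sb// !mem_cat !mem_nseq M0 eqxx orbT.
have ws0 : 0 < w - s by rewrite sb// !mem_cat !mem_nseq M0 eqxx !orbT.
have [sa sb' sw] : [/\ s < a, s < b & s < w] by split; rewrite -subr_gt0.
have sw2 : s < w + 2^-1 by rewrite (lt_trans sw)// ltrDl invr_gt0.
have sw2E : w + 2^-1 - s = w - s + 2^-1 by rewrite addrAC.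
have hsE v : hker (a - s) (b - s) (w - s) v = expR (- s * v) * hker a b w v.
  by rewrite hker_shift.
rewrite (@meijerGRE _ _ _ _ _ (fun y =>
  ft (hker (a - s) (b - s) (w - s)) (- y) ^+ M / (s +i* y)) s)//;
    last first.
  move=> y; rewrite tb db /= take0 drop0 !big_cat !big_cons !big_nil !prod_nseq !mulr1 /=.
  rewrite (Gamma_subE y sa) (Gamma_subE y sb') (Gamma_subE y sw) (Gamma_subE y sw2) sw2E.
  rewrite (ft_hker _ as0 bs0 ws0).
  have -> : Gamma (1 - 1%:C + (s +i* y)) = ft (gker s) y.
    by rewrite GammaE /= subrr ?add0r// oppr0 !add0r.
  have -> : Gamma (1 - 0%:C + (s +i* y)) = (s +i* y) * ft (gker s) y.
    rewrite GammaE /= subr0; last by rewrite addr_gt0.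
    by rewrite oppr0 !add0r [1 + s]addrC rgammaS_ft.
  have n1 : ft (gker s) y != 0 by exact: ft_gker_neq0.
  by rewrite !exprMn exprVn; exact: mulf_cancel.
clear tb db hsep hsep' sb; clearbody s; clear aa bb.
case: M M0 => // M _.
have dh := hker_density a0 b0 w0.
have dhs := hker_density as0 bs0 ws0.
have [C C0 hC] := nsq_ft_hker as0 bs0 ws0.
have E : hker (a - s) (b - s) (w - s) = (fun v => expR (- s * v) * hker a b w v).
  by apply/funext.
rewrite E in hC dhs *.
have [hI I] := cumul_inversion s0 dh dhs (ln x) M C0 hC.
rewrite (RintegralZl _ measurableT hI) I mulNr expRN.
rewrite [expR _ * _]mulrCA mulVKf; last by rewrite gt_eqF ?expR_gt0.
by rewrite mulKf// mulf_neq0// gt_eqF// pi_gt0.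
Qed.

End meijer_density.

(** * The outage bound *)

Section outage_bound.
Context {R : realType}.
Local Notation mu := (@lebesgue_measure R).
Local Notation L1 F := (mu.-integrable setT (EFin \o F)).

(** The integral of a nonnegative function is a supremum over the simple functions below it, hence
    monotone for arbitrary functions. This spares a measurability proof for every inner iterated
    integral. *)
Lemma ge0_le_integral_nonmeasurable (D : set R) (f g : R -> \bar R) :
  (forall x, D x -> 0 <= f x <= g x)%E ->
  (0 <= \int[mu]_(x in D) f x <= \int[mu]_(x in D) g x)%E.
Proof.
move=> fg; rewrite integral_ge0/=; last by move=> x /fg /andP[].
rewrite integral_mkcond [leRHS]integral_mkcond.
have f0 x : (0 <= (f \_ D) x)%E.
  by apply: erestrict_ge0 => t /fg /andP[].
have g0 x : (0 <= (g \_ D) x)%E.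
  by apply: erestrict_ge0 => t /fg /andP[]; exact: le_trans.
rewrite !ge0_integralTE//; apply: le_ereal_sup => _ [k kf <-]; exists k => // x.
apply: (le_trans (kf x)); rewrite !patchE; case: ifPn => // /set_mem /fg /andP[_].
exact.
Qed.

Lemma le_iter_integral n (F G : n.-tuple R -> \bar R) :
  (forall t, (forall i, (0 < tnth t i)%R) -> 0 <= F t <= G t)%E ->
  (0 <= iter_integral F <= iter_integral G)%E.
Proof.
elim: n F G => [|n IH] F G FG /=; first by apply: FG => -[].
apply: ge0_le_integral_nonmeasurable => x; rewrite /= in_itv/= andbT => x0.
apply: IH => t t0; apply: FG => i.
case: (unliftP ord0 i) => [j ->|->]; last by rewrite tnth0.
by rewrite tnthS.
Qed.

Lemma sum_tnth_cons n (F : R -> R) (x : R) (t : n.-tuple R) :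
  \sum_i F (tnth [tuple of x :: t] i) = F x + \sum_i F (tnth t i).
Proof. by rewrite big_ord_recl tnth0; congr (_ + _); apply: eq_bigr => i _; rewrite tnthS. Qed.

Lemma prod_tnth_cons n (F : R -> R) (x : R) (t : n.-tuple R) :
  \prod_i F (tnth [tuple of x :: t] i) = F x * \prod_i F (tnth t i).
Proof. by rewrite big_ord_recl tnth0; congr (_ * _); apply: eq_bigr => i _; rewrite tnthS. Qed.

(** The convex function ln (1 + e^t) lies above its tangent at [ln A], of slope [p = A / (1 + A)].
    Exponentiated, this is e^(p z) <= 1 - p + p e^z, the average with weights 1 - p and p of two
    instances of 1 + t <= e^t. *)
Lemma ln_tangent (y A : R) : 0 < y -> 0 < A ->
  ln (1 + A) + A / (1 + A) * (ln y - ln A) <= ln (1 + y).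
Proof.
move=> y0 A0; have A1 : 0 < 1 + A by rewrite addr_gt0.
have y1 : 0 < 1 + y by rewrite addr_gt0.
set p := A / (1 + A); set z := ln y - ln A.
have p0 : 0 < p by rewrite divr_gt0.
have p1 : 0 < 1 - p by rewrite subr_gt0 ltr_pdivrMr// mul1r ltrDr.
have ez : expR z = y / A by rewrite expRB !lnK.
have e1 : 1 + (- (p * z)) <= expR (- (p * z)) by exact: expR_ge1Dx.
have e2 : 1 + (1 - p) * z <= expR ((1 - p) * z) by exact: expR_ge1Dx.
have E2 : expR ((1 - p) * z) = expR (- (p * z)) * expR z.
  by rewrite -expRD; congr expR; ring.
have key : 1 <= expR (- (p * z)) * ((1 - p) + p * expR z).
  have h1 := ler_wpM2l (ltW p1) e1; have h2 := ler_wpM2l (ltW p0) e2.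
  rewrite (_ : _ * _ = (1 - p) * expR (- (p * z)) + p * expR ((1 - p) * z)); last by rewrite E2;
    ring.
  by apply: le_trans (lerD h1 h2); rewrite [leRHS](_ : _ = 1)//; ring.
rewrite -ler_expR expRD !lnK//.
have -> : 1 + y = (1 + A) * ((1 - p) + p * expR z).
  by rewrite ez /p; field; rewrite !gt_eqF.
rewrite ler_pM2l// -[leRHS]mul1r -[X in _ <= X * _](expRxMexpNx_1 (p * z)).
by rewrite -[leRHS]mulrA ler_peMr ?expR_ge0.
Qed.

Variables (alpha beta omega A0 hl gbar : R).
Hypotheses (a0 : 0 < alpha) (b0 : 0 < beta) (w0 : 0 < omega) (A00 : 0 < A0) (hl0 : 0 < hl)
  (g0 : 0 < gbar).
Let k := alpha * beta / (A0 * hl).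
Let k0 : 0 < k. Proof. by rewrite divr_gt0// mulr_gt0. Qed.
Let K := Num.sqrt omega / (gammaR alpha * gammaR beta).
Let K0 : 0 < K.
Proof. by rewrite divr_gt0 ?sqrtr_gt0// mulr_gt0// gammaRE// rgamma_gt0. Qed.
Let f := snr_density alpha beta omega A0 hl gbar.
Let h := hker alpha beta omega.
Let ell (x : R) := ln (k * Num.sqrt (x / gbar)).

Let ellE x : 0 < x -> ell x = 2^-1 * ln x + (ln k - ln gbar / 2).
Proof.
move=> x0; have xg : 0 < x / gbar by rewrite divr_gt0.
rewrite /ell lnM ?posrE ?sqrtr_gt0// -powR12_sqrt ?(ltW xg)// ln_powR ln_div ?posrE//.
by field.
Qed.

Let fE x : 0 < x -> f x = K / 2 * h (ell x) / x.
Proof.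
move=> x0; have xg : 0 < x / gbar by rewrite divr_gt0.
rewrite /f /snr_density meijer_density//; last by rewrite mulr_gt0 ?sqrtr_gt0.
rewrite -/h -/k -/(ell x) /K (gammaRE a0) (gammaRE b0).
have := rgamma_gt0 a0; have := rgamma_gt0 b0.
move: (rgamma alpha) (rgamma beta) (h (ell x)) => ga gb hx gb0 ga0.
by field; rewrite !gt_eqF.
Qed.

Let dh : density h. Proof. exact: hker_density. Qed.

Let f_ge0 x : 0 < x -> 0 <= f x.
Proof.
have [_ _ h0 _] := dh; move=> x0; rewrite (fE x0).
exact: (divr_ge0 (mulr_ge0 (divr_ge0 (ltW K0) (ler0n _ 2)) (h0 _)) (ltW x0)).
Qed.

(** In the variable [v = ell x] the measure f x dx is K h v dv: the slope 1/2 of [ell] in [ln x]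
    cancels the 1/2 of the density. The constant [c] is part of the statement so that the induction
    can absorb the factor [f x] of the outer variable. *)
Lemma iter_integral_cumul n (c L : R) : 0 <= c ->
  iter_integral (fun t : n.-tuple R =>
    (c * ((\sum_i ell (tnth t i) < L)%R%:R * \prod_i f (tnth t i)))%:E) =
  (c * (K ^+ n * cumul h n L))%:E.
Proof.
have [hL _ h0 _] := dh; have mh := L1_measurable hL.
elim: n c L => [|n IH] c L c0.
  by rewrite /= !big_ord0 expr0 mul1r mulr1.
have [mT T0 _] := cumulP n dh.
pose Psi v := (c * K ^+ n.+1 / 2) * (h v * cumul h n (L - v)).
have mPsi : measurable_fun setT Psi by rewrite /Psi; meas.
have cK : 0 <= c * K ^+ n.+1 / 2.
  by apply: divr_ge0 => //; apply: mulr_ge0 => //; apply: exprn_ge0; exact: ltW.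
have Psi0 v : 0 <= Psi v by exact: (mulr_ge0 cK (mulr_ge0 (h0 v) (T0 _))).
pose phi u := Psi (2^-1 * u + (ln k - ln gbar / 2)).
have mphi : measurable_fun setT phi by rewrite /phi; meas.
rewrite /=; transitivity (\int[mu]_(x in `]0%R, +oo[) (phi (ln x) / x)%:E)%E.
  apply: eq_integral => x; rewrite inE /= in_itv/= andbT => x0.
  have f0 := f_ge0 x0.
  transitivity (iter_integral (fun t : n.-tuple R =>
    ((c * f x) * ((\sum_i ell (tnth t i) < L - ell x)%R%:R * \prod_i f (tnth t i)))%:E)).
    congr iter_integral; apply/funext => t; congr EFin.
    rewrite (sum_tnth_cons ell) (prod_tnth_cons f) ltrBrDl.
    move: (_ < L)%R (f x) (\prod_i _) => bb fx P.
    by ring.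
  rewrite IH; last exact: mulr_ge0.
  congr EFin; rewrite fE// /phi -ellE// /Psi exprS.
  by ring.
rewrite (ge0_integral_ln mphi); last by move=> x; exact: Psi0.
have mE : measurable_fun setT (EFin \o Psi) by exact/measurable_EFinP.
have h2 : 0 < 2^-1 :> R by rewrite invr_gt0.
have := ge0_integral_affine (ln k - ln gbar / 2) h2 mE (fun v => ltac:(by rewrite lee_fin;
  exact: Psi0)).
rewrite /phi => ->; rewrite invrK.
have hP : L1 (fun v => h v * cumul h n (L - v)).
  have := L1_reflect L (cumul_integrable n L dh).
  by congr (_.-integrable _ _); apply/funext => v /=; rewrite subKr mulrC.
rewrite L1_EFin; last exact: L1Z.
rewrite (RintegralZl _ measurableT hP) -(cumulS n L dh) -[convol _ _ L]/(cumul h n.+1 L).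
by rewrite -EFinM; congr EFin; move: (cumul _ _ _) => T; field.
Qed.

Lemma ln_Phi (M : nat) (Rt : R) : (0 < M)%N -> 0 < Rt ->
  [/\ 0 < 2 `^ (2 * Rt / M%:R) - 1, 0 < Phi M alpha beta A0 hl Rt gbar &
    ln (Phi M alpha beta A0 hl Rt gbar) = ln (alpha * beta / (A0 * hl)) +
     (ln (2 `^ (2 * Rt / M%:R) - 1) - (ln (capacity_const R) + ln gbar)) / 2].
Proof.
move=> M0 Rt0; set A := 2 `^ (2 * Rt / M%:R) - 1.
have M0' : 0 < M%:R :> R by rewrite ltr0n.
have A_gt0 : 0 < A.
  rewrite subr_gt0 /powR pnatr_eq0/= expR_gt1.
  by rewrite (mulr_gt0 (divr_gt0 (mulr_gt0 (ltr0n _ 2) Rt0) M0'))// ln_gt0// ltr1n.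
have c0 : 0 < capacity_const R by rewrite divr_gt0 ?expR_gt0// mulr_gt0// pi_gt0.
have Acg : 0 < A / (capacity_const R * gbar) by rewrite divr_gt0// mulr_gt0.
split => //; first by rewrite mulr_gt0 ?sqrtr_gt0.
rewrite /Phi -/A -/k lnM ?posrE ?sqrtr_gt0// -powR12_sqrt ?(ltW Acg)// ln_powR.
rewrite ln_div ?posrE//; last exact: mulr_gt0.
by rewrite lnM ?posrE// [2^-1 * _]mulrC.
Qed.

(** The tangent is taken at [A], the common value of [c * tnth t i] for which [M] equal terms add up
    to exactly [2 * Rt]; there each [ell] equals [ln Phi]. *)
Lemma outage_ir_le (M : nat) (Rt : R) : (0 < M)%N -> 0 < Rt ->
  (outage_ir M alpha beta omega A0 hl Rt gbar <=
   (outage_ir_ub M alpha beta omega A0 hl Rt gbar)%:E)%E /\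
  outage_ir_ub M alpha beta omega A0 hl Rt gbar =
  K ^+ M * cumul h M (M%:R * ln (Phi M alpha beta A0 hl Rt gbar)).
Proof.
move=> M0 Rt0; set A := 2 `^ (2 * Rt / M%:R) - 1.
have M0' : 0 < M%:R :> R by rewrite ltr0n.
have ln2 : 0 < ln 2 :> R by rewrite ln_gt0// ltr1n.
have [A_gt0 phi0 lphi] := ln_Phi M0 Rt0; rewrite -/k -/A in lphi A_gt0.
have c0 : 0 < capacity_const R by rewrite divr_gt0 ?expR_gt0// mulr_gt0// pi_gt0.
set c := capacity_const R in c0 lphi *.
set phi := Phi M alpha beta A0 hl Rt gbar in phi0 lphi *.
have ubE : outage_ir_ub M alpha beta omega A0 hl Rt gbar = K ^+ M * cumul h M (M%:R * ln phi).
  by rewrite /outage_ir_ub meijer_cumul ?exprn_gt0// lnXn// mulr_natl.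
split=> //; rewrite ubE -[X in X%:E]mul1r -iter_integral_cumul//.
suff /andP[] : (0 <= outage_ir M alpha beta omega A0 hl Rt gbar <=
   iter_integral (fun t : M.-tuple R =>
    (1 * ((\sum_i ell (tnth t i) < M%:R * ln phi)%R%:R * \prod_i f (tnth t i)))%:E))%E by [].
apply: le_iter_integral => t t0.
have P0 : 0 <= \prod_i f (tnth t i).
  by apply: prodr_ge0 => i _; exact: f_ge0.
rewrite !lee_fin mul1r mulr_ge0//= ler_wpM2r//.
rewrite indicE; case: (boolP (_ \in _)) => // /set_mem /= B.
rewrite (_ : (_ < _) = true)//; rewrite ltNge; apply/negP => hge.
move: B; apply/negP; rewrite -leNgt.
have lA : ln (1 + A) = 2 * Rt / M%:R * ln 2 by rewrite /A addrC subrK ln_powR.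
have -> : 2 * Rt = \sum_(i < M) (ln (1 + A) / ln 2).
  by rewrite sumr_const card_ord lA mulfK ?gt_eqF// -[RHS]mulr_natr divfK// gt_eqF.
pose p := A / (1 + A).
have p0 : 0 < p by rewrite divr_gt0// addr_gt0.
(* [ell x - ln phi] is half of ln (c x) - ln A, whence the slope [2 * p]. The linear terms add up to
   something nonnegative by the negated conclusion [hge]. *)
apply: (@le_trans _ _ (\sum_(i < M) (ln (1 + A) / ln 2 +
    2 * p / ln 2 * (ell (tnth t i) - ln phi)))).
  rewrite big_split /= lerDl -mulr_sumr mulr_ge0//.
    exact: (divr_ge0 (mulr_ge0 (ler0n _ 2) (ltW p0)) (ltW ln2)).
  by rewrite sumrB sumr_const card_ord subr_ge0 -mulr_natl.
apply: ler_sum => i _; rewrite /log2 ler_pdivlMr//.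
have ct0 : 0 < c * tnth t i by rewrite mulr_gt0.
apply: le_trans (ln_tangent ct0 A_gt0); rewrite -/p ellE// lphi lnM ?posrE//.
rewrite mulrDl divfK ?gt_eqF// lerD2l.
rewrite [leLHS](_ : _ = p * (2 * (2^-1 * ln (tnth t i) + (ln k - ln gbar / 2) -
  (ln k + (ln A - (ln c + ln gbar)) / 2)))); last by field; rewrite gt_eqF.
by rewrite ler_pM2l// [leLHS](_ : _ = ln c + ln (tnth t i) - ln A)//; field.
Qed.

End outage_bound.

(** * Asymptotics of the bound *)

Section tail_asymptotics.
Context {R : realType}.
Local Notation mu := (@lebesgue_measure R).
Local Notation L1 F := (mu.-integrable setT (EFin \o F)).

Variables (h : R -> R) (q C A : R).
Hypotheses (dh : density h) (q0 : 0 < q).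
Let eta (v : R) : R := expR (- q * v) * h v.
Hypothesis eta_lim : forall u : nat -> R, u n @[n --> \oo] --> -oo -> eta (u n) @[n --> \oo] --> C.
Hypothesis eta_le : forall v, eta v <= A.
Hypothesis eta_decay : forall v, eta v <= A * expR (- v).

Let tau n (x : R) : R := expR (- q * x) * cumul h n x.
Let I : R := \int[mu]_v h v.

Let meta : measurable_fun setT eta.
Proof. by have [hL _ _ _] := dh; have mh := L1_measurable hL; rewrite /eta; meas. Qed.

Let eta_ge0 v : 0 <= eta v.
Proof. by have [_ _ h0 _] := dh; rewrite mulr_ge0 ?expR_ge0. Qed.

Let mtau n : measurable_fun setT (tau n).
Proof. by have [mT _ _] := cumulP n dh; rewrite /tau; meas. Qed.

Let tau_ge0 n x : 0 <= tau n x.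
Proof. by have [_ T0 _] := cumulP n dh; rewrite mulr_ge0 ?expR_ge0. Qed.

Let tau_le n x : tau n x <= I ^+ n * expR (- q * x).
Proof. by have [_ _ TI] := cumulP n dh; rewrite /tau mulrC;
  exact: (ler_wpM2r (expR_ge0 _) (TI x)). Qed.

Let tauS n x : tau n.+1 x = convol (tau n) eta x.
Proof. by rewrite /tau /= convol_scale//; exact: cumul_integrable. Qed.

Let A0 : 0 <= A. Proof. exact: le_trans (eta_ge0 0) (eta_le 0). Qed.

Let eta_norm v : `|eta v| <= A. Proof. by rewrite ger0_norm. Qed.

(** Growth at rate 1/2 is slow enough to be absorbed by the decay of [eta] at rate 1. *)
Lemma pow_le_exp (m : nat) (t : R) : 0 <= t -> t ^+ m <= m`!%:R * 2 ^+ m * expR (t / 2).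
Proof.
move=> t0; have t20 : 0 <= t / 2 by rewrite divr_ge0.
case: m => [|m].
  by rewrite !expr0 fact0 mulr1 mul1r -[leLHS]expR0 ler_expR.
have F0 : 0 < m.+1`!%:R :> R by rewrite ltr0n fact_gt0.
have := expR_ge1Dxn m t20 => h1.
rewrite mulrAC -ler_pdivrMr ?exprn_gt0// -expr_div_n -ler_pdivrMl// mulrC.
by rewrite (le_trans _ h1)// lerDr.
Qed.

(** [tau 1 (- x)] averages [eta] at points tending to [-oo] against exp (- q w) on w > 0, of mass 1
    / q. *)
Let tau_lim0 : tau 1 (- x) @[x --> +oo] --> C / q.
Proof.
apply/cvg_pinftyP => u uy.
have hE := exp_L1 q0.
have -> : (fun n => tau 1 (- u n)) = (fun n => convol (tau 0) eta (- u n)).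
  by apply/funext => n; rewrite tauS.
have -> : C / q = \int[mu]_w (tau 0 w * C).
  by rewrite RintegralZr// /tau /= exp_integral// mulrC.
apply: (convol_cvg hE meta eta_norm (measurable_cst C)) => w.
apply: eta_lim; apply/cvgrNyPle => B; move/cvgryPge : uy => /(_ (- B - w)).
by apply: filterS => n; lra.
Qed.

(** The limit controls [x >= N], and the trivial bound [tau_le] the remaining compact range. *)
Let tau_bound m (c : R) : tau m.+1 (- x) / x ^+ m @[x --> +oo] --> c ->
  exists2 B, 0 <= B & forall x, 0 <= x -> tau m.+1 (- x) <= B * (1 + x) ^+ m.
Proof.
move=> lim.
have [N [N1 hN]] : exists N, 1 <= N /\ forall x, N <= x -> tau m.+1 (- x) / x ^+ m <= `|c| + 1.
  have c1 : c < `|c| + 1 by have := ler_norm c; lra.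
  have [N [_ hN]] := cvgr_lt _ lim _ c1; exists (Num.max 1 (N + 1)); rewrite le_max lexx; split =>
    // x Nx.
  by apply/ltW/hN; rewrite (lt_le_trans _ Nx)// lt_max ltrDl ltr01 orbT.
have I0 : 0 <= I by have [_ _ h0 _] := dh; apply: Rintegral_ge0 => v _.
have IN0 : 0 <= I ^+ m.+1 * expR (q * N) by rewrite mulr_ge0 ?exprn_ge0 ?expR_ge0.
exists (`|c| + 1 + I ^+ m.+1 * expR (q * N)) => [|x x0]; first by rewrite !addr_ge0.
have x1 : 1 <= (1 + x) ^+ m by rewrite exprn_ege1// lerDl.
have x1' : 0 <= (1 + x) ^+ m by rewrite (le_trans ler01).
case: (leP N x) => [Nx|/ltW xN].
  have xp : 0 < x by rewrite (lt_le_trans _ Nx)// (lt_le_trans ltr01).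
  have := hN x Nx; rewrite ler_pdivrMr ?exprn_gt0// => h1.
  rewrite (le_trans h1)// ler_pM ?exprn_ge0 ?addr_ge0 ?lerDl//.
  by rewrite lerXn2r ?nnegrE ?addr_ge0// lerDr.
rewrite (le_trans (tau_le _ _))// mulrNN (@le_trans _ _ (I ^+ m.+1 * expR (q * N)))//.
  by rewrite ler_wpM2l ?exprn_ge0// ler_expR ler_pM2l.
by rewrite (@le_trans _ _ (`|c| + 1 + I ^+ m.+1 * expR (q * N)))// ?lerDr ?addr_ge0// ler_peMr ?addr_ge0.
Qed.

Lemma Rintegral_pow m : \int[mu]_x (\1_(`[-1, 0]%classic) x * (1 + x) ^+ m) = m.+1%:R^-1 :> R.
Proof.
have dF (x : R) : -1 <= x <= 0 -> is_derive x 1 (fun x : R =>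
  m.+1%:R^-1 * (1 + x) ^+ m.+1) ((1 + x) ^+ m).
  move=> _.
  have -> : (fun x : R => m.+1%:R^-1 * (1 + x) ^+ m.+1) = m.+1%:R^-1 \*: (cst 1 + id) ^+ m.+1.
    by apply/funext => y; rewrite /GRing.scale_fun/= exprfctE.
  have d1 : is_derive x (1 : R) (cst (1 : R) + id) (0 + 1) by exact: is_deriveD.
  apply: (is_derive_eq (is_deriveZ m.+1%:R^-1 (is_deriveX m.+1 d1))).
  rewrite /GRing.scale/= add0r mulr1 mulrA mulVf ?mul1r// pnatr_eq0//.
have cf (x : R) : -1 <= x <= 0 -> {for x, continuous (fun x : R => (1 + x) ^+ m)}.
  move=> _; apply: (@continuous_comp _ _ _ (fun x : R => 1 + x) (fun x => x ^+ m)).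
    by apply: cvgD; [exact: cvg_cst|exact: cvg_id].
  exact: exprn_continuous.
have N10 : -1 <= 0 :> R by rewrite lerN10.
have := FTC_itv N10 dF cf; rewrite integral_mkcond => /(congr1 fine) /=.
rewrite addr0 expr1n mulr1 subrr expr0n/= mulr0 subr0 => <-.
congr fine; apply: eq_integral => x _; rewrite patchE indicE.
by case: ifPn => _; rewrite ?mul1r ?mul0r.
Qed.

(** Rescaling the convolution variable by [u n] concentrates the integral on [[-1, 0]]. There
    [eta (u n * x)] tends to [C] and the quotient of [tau] to c (1 + x)^m, whose integral gives 1 /
    (m + 1). For x > 0 the decay of [eta] kills the integrand; for x < -1 the trivial bound on [tau]
    does. *)
Let tau_step m (c : R) : tau m.+1 (- x) / x ^+ m @[x --> +oo] --> c ->
  tau m.+2 (- x) / x ^+ m.+1 @[x --> +oo] --> C * c / m.+1%:R.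
Proof.
move=> lim; have [B B0 hB] := tau_bound lim.
apply/cvg_pinftyP => u0 u0y.
(* Truncation makes [1 <= u n] hold for all [n], as the uniform domination demands; the sequence is
   eventually unchanged. *)
pose u n := Num.max 1 (u0 n).
have u1 n : 1 <= u n by rewrite le_max lexx.
have up n : 0 < u n by rewrite (lt_le_trans ltr01).
have uy : u n @[n --> \oo] --> +oo.
  by apply/cvgryPge => D; move/cvgryPge : u0y => /(_ D); apply: filterS => n; rewrite le_max =>
    ->; rewrite orbT.
suff : tau m.+2 (- u n) / u n ^+ m.+1 @[n --> \oo] --> C * c / m.+1%:R.
  apply: cvg_trans; apply: near_eq_cvg; move/cvgryPge : u0y => /(_ 1).
  by apply: filterS => n u1n; rewrite /u max_r.
pose F_ n (x : R) : R := eta (u n * x) * (tau m.+1 (- (u n * (1 + x))) / u n ^+ m).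
pose F (x : R) : R := C * c * (\1_(`[-1, 0]%classic) x * (1 + x) ^+ m).
have FE n : tau m.+2 (- u n) / u n ^+ m.+1 = \int[mu]_x F_ n x.
  have mf : measurable_fun setT (fun v => eta v * (tau m.+1 (- u n - v) / u n ^+ m)).
    by have mt := @mtau m.+1; meas.
  have := Rintegral_affine 0 (up n) mf.
  rewrite (_ : \int[mu]_x _ = \int[mu]_x F_ n x); last first.
    by apply: eq_Rintegral => x _; rewrite /F_ addr0 -opprD mulrDr mulr1.
  move=> ->; rewrite tauS (convolC _ (@mtau m.+1) meta) /convol.
  have hi : L1 (fun v => eta v * tau m.+1 (- u n - v)).
    have := L1_reflect (- u n) (L1Z (expR (- q * - u n)) (cumul_integrable m.+1 (- u n) dh)).
    congr (_.-integrable _ _); apply/funext => v /=; congr EFin.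
    rewrite /eta /tau subKr.
    have -> : expR (- q * - u n) = expR (- q * v) * expR (- q * (- u n - v)).
      by rewrite -expRD; congr expR; ring.
    by rewrite -[convol (cumul h m) h]/(cumul h m.+1); ring.
  under [in RHS]eq_Rintegral do rewrite mulrA.
  rewrite RintegralZr// exprSr invfM mulrA; ring.
have [hF] : \int[mu]_x F x = C * c / m.+1%:R /\ True.
  split=> //; rewrite RintegralZl ?Rintegral_pow//.
  have h1 : L1 (\1_(`[-1, 0]%classic) : R -> R) by exact: integrable_indic_itv.
  apply: (L1_le _ _ h1).
    apply: measurable_funM; first exact: measurable_indic.
    by apply: (@measurable_funX _ _ _ _ (fun x : R => 1 + x)); meas.
  move=> x; rewrite indicE mem_setE in_itv/=; case: (boolP (-1 <= x <= 0)) => [/andP[x1 x0]|_].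
    by rewrite mul1r ger0_norm ?exprn_ile1 ?exprn_ge0//; lra.
  by rewrite mul0r normr0.
rewrite -hF => _; under eq_fun do rewrite FE.
(* The rate is 1/2 for [x >= -1], after [pow_le_exp], and [q] for [x < -1], from the trivial bound
   on [tau]. *)
pose d := Num.min 2^-1 q.
have d0 : 0 < d by rewrite lt_min invr_gt0 ltr0n.
pose D := B * (m`!%:R * 2 ^+ m * expR 1).
have D0 : 0 <= D by rewrite !mulr_ge0 ?expR_ge0.
have I0 : 0 <= I by have [_ _ h0 _] := dh; apply: Rintegral_ge0 => v _.
pose K1 := A * D * expR 1; pose K2 := A * (I ^+ m.+1 * expR q).
have K10 : 0 <= K1 by rewrite !mulr_ge0 ?expR_ge0.
have K20 : 0 <= K2 by rewrite !mulr_ge0 ?exprn_ge0 ?expR_ge0.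
have um n : 0 < u n ^+ m by rewrite exprn_gt0.
have um1 n : 1 <= u n ^+ m by rewrite exprn_ege1.
have tau_in n x : -1 <= x -> tau m.+1 (- (u n * (1 + x))) / u n ^+ m <= D * expR (x / 2).
  move=> x1; have x10 : 0 <= 1 + x by lra.
  rewrite (@le_trans _ _ (B * (2 + x) ^+ m))//.
    rewrite ler_pdivrMr// -mulrA -exprMn (le_trans (hB _ _)) ?mulr_ge0 ?(ltW (up n))//.
    rewrite ler_wpM2l// lerXn2r ?nnegrE ?addr_ge0 ?mulr_ge0 ?(ltW (up n))//; first by lra.
    by have := u1 n; nra.
  rewrite /D -!mulrA ler_wpM2l//.
  have x20 : 0 <= 2 + x by lra.
  rewrite (le_trans (pow_le_exp m x20))// -mulrA ler_wpM2l// ler_wpM2l ?exprn_ge0//.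
  by rewrite -expRD ler_expR; lra.
have tau_out n x : x < -1 -> tau m.+1 (- (u n * (1 + x))) / u n ^+ m <=
    I ^+ m.+1 * expR (- q * (- (u n * (1 + x)))).
  move=> x1; rewrite ler_pdivrMr// (le_trans (tau_le _ _))// ler_peMr//.
  by rewrite mulr_ge0 ?exprn_ge0 ?expR_ge0.
have tn0 n x : 0 <= tau m.+1 (- (u n * (1 + x))) / u n ^+ m by rewrite divr_ge0// ltW.
have exp_lim0 s : 0 < s -> expR (- (u n * s)) @[n --> \oo] --> 0.
  move=> s0; have us : u n * s @[n --> \oo] --> +oo.
    apply/cvgryPge => E; move/cvgryPge : uy => /(_ (E / s)).
    by apply: filterS => n; rewrite ler_pdivrMr.
  exact: (cvg_comp (fun n => u n * s) (fun x : R => expR (- x)) us (@cvgr_expR R)).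
apply: (@Rintegral_dominated _ _ _ (fun x => (K1 + K2) * expR (- d * `|x|))).
- move=> n; rewrite /F_; have mt := @mtau m.+1; meas.
  exact: mulrl_measurable.
  change (measurable_fun setT (fun x : R => 1 + x)).
  by meas.
- rewrite /F; apply: measurable_funM; first exact: measurable_cst.
  apply: measurable_funM; first exact: measurable_indic.
  by apply: (@measurable_funX _ _ _ _ (fun x : R => 1 + x)); meas.
- exact/L1Z/exp_abs_L1.
(* At 0 the argument of [eta] does not move with [n], and at -1 that of [tau] does not, so the
   pointwise limit may fail at these two points. *)
- have neg : mu.-negligible ([set 0] `|` [set -1] : set R).
    by apply: negligibleU; [exists [set 0]|exists [set -1]]; split => //;
      exact: lebesgue_measure_set1.
  apply: (negligibleS _ neg) => x /= nx; apply: contrapT => /not_orP[/eqP x0 /eqP x1].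
  apply: nx; rewrite /F indicE mem_setE in_itv/=.
  have [xgt0|xle0] := ltP 0 x.
    rewrite andbF mul0r mulr0.
    apply: (@squeeze_cvgr _ _ _ _ (cst 0) (fun n => A * (D * expR (x / 2)) * expR (- (u n * x)))).
    - near=> n; rewrite mulr_ge0//= /F_ [leRHS]mulrAC.
      apply: ler_pM => //; last by apply: tau_in; lra.
    - exact: cvg_cst.
    - rewrite -[X in _ --> X](mulr0 (A * (D * expR (x / 2)))); apply: cvgMr.
      exact: exp_lim0.
  have xlt0 : x < 0 by rewrite lt_neqAle x0.
  have [xN1|xN1] := ltP x (-1).
    rewrite /= mul0r mulr0.
    apply: (@squeeze_cvgr _ _ _ _ (cst 0) (fun n =>
      A * I ^+ m.+1 * expR (- (u n * (- q * (1 + x)))))).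
    - near=> n; rewrite mulr_ge0//= /F_ -[leRHS]mulrA; apply: ler_pM => //.
      by rewrite (le_trans (tau_out _ _ xN1))// ler_wpM2l ?exprn_ge0// ler_expR; nra.
    - exact: cvg_cst.
    - rewrite -[X in _ --> X](mulr0 (A * I ^+ m.+1)); apply: cvgMr.
      by apply: exp_lim0; rewrite mulNr -mulrN mulr_gt0// oppr_gt0; lra.
  have xgtN1 : -1 < x by rewrite lt_neqAle eq_sym x1.
  rewrite /= mul1r -mulrA; apply: cvgM.
    apply: eta_lim; apply/cvgrNyPle => E; move/cvgryPge : uy => /(_ (E / x)).
    by apply: filterS => n; rewrite ler_ndivrMr.
  have x10 : 0 < 1 + x by lra.
  have ux : u n * (1 + x) @[n --> \oo] --> +oo.
    apply/cvgryPge => E; move/cvgryPge : uy => /(_ (E / (1 + x))).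
    by apply: filterS => n; rewrite ler_pdivrMr.
  have lux := cvg_comp (fun n => u n * (1 + x)) (fun x : R => tau m.+1 (- x) / x ^+ m) ux lim.
  apply: cvg_trans (cvgM lux (cvg_cst ((1 + x) ^+ m))).
  apply: near_eq_cvg; near=> n => /=.
  by rewrite exprMn invfM mulrA divfK// expf_neq0// gt_eqF.
- move=> n x; rewrite ger0_norm; last by rewrite mulr_ge0.
  have dq : d <= q by rewrite /d ge_min lexx orbT.
  have d12 : d <= 2^-1 by rewrite /d ge_min lexx.
  have [xge0|xlt0] := leP 0 x.
    rewrite mulrDl (@le_trans _ _ (K1 * expR (- d * `|x|)))//; last first.
      by rewrite lerDl (mulr_ge0 K20) ?expR_ge0.
    rewrite (ger0_norm xge0) (@le_trans _ _ (A * expR (- (u n * x)) * (D * expR (x / 2))))//.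
      by apply: ler_pM => //; apply: tau_in; lra.
    rewrite mulrACA -expRD /K1 -[leRHS]mulrA -expRD; apply: ler_wpM2l; first exact: mulr_ge0.
    by rewrite ler_expR; have := ler_wpM2r xge0 (u1 n); have := ler_wpM2r xge0 d12; lra.
  rewrite (ltr0_norm xlt0) mulrNN; have [xN1|xN1] := ltP x (-1).
    rewrite mulrDl (@le_trans _ _ (K2 * expR (d * x)))//; last first.
      by rewrite lerDr (mulr_ge0 K10) ?expR_ge0.
    rewrite /K2 -[leRHS]mulrA; apply: ler_pM => //.
    rewrite (le_trans (tau_out _ _ xN1))// -[leRHS]mulrA -expRD; apply: ler_wpM2l;
      first exact: exprn_ge0.
    have x1 : 1 + x <= 0 by lra.
    have := ler_wpM2l (ltW q0) (ler_wnM2r x1 (u1 n)); have := ler_wnM2r (ltW xlt0) dq.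
    by rewrite ler_expR; lra.
  rewrite mulrDl (@le_trans _ _ (K1 * expR (d * x)))//; last first.
    by rewrite lerDl (mulr_ge0 K20) ?expR_ge0.
  rewrite (@le_trans _ _ (A * (D * expR (x / 2))))//.
    by apply: ler_pM => //; apply: tau_in.
  rewrite mulrA /K1 -[leRHS]mulrA -expRD; apply: ler_wpM2l; first exact: mulr_ge0.
  by rewrite ler_expR; have := ler_wnM2r (ltW xlt0) d12; lra.
Unshelve. all: by end_near.
Qed.

Lemma cumul_asymptotics m :
  expR (q * x) * cumul h m.+1 (- x) / x ^+ m @[x --> +oo] --> C ^+ m.+1 / (q * m`!%:R).
Proof.
have -> : (fun x => expR (q * x) * cumul h m.+1 (- x) / x ^+ m) = (fun x =>
  tau m.+1 (- x) / x ^+ m).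
  by apply/funext => x; rewrite /tau mulrNN.
elim: m => [|m IH].
  rewrite expr1 fact0 mulr1; under eq_fun do rewrite expr0 divr1; exact: tau_lim0.
have -> : C ^+ m.+2 / (q * m.+1`!%:R) = C * (C ^+ m.+1 / (q * m`!%:R)) / m.+1%:R.
  rewrite factS natrM [C ^+ m.+2]exprS !invfM; move: (C ^+ m.+1) (m`!%:R^-1) => a b; ring.
exact: tau_step IH.
Qed.


End tail_asymptotics.

Section order_statistics.
Context {R : realType}.

(** The two larger parameters are left in either order, since the limiting constant is symmetric in
    them. *)
Lemma min3_cases (x y z : R) : let q := min3 x y z in let p := max3 x y z in let r := med3 x y z in
  q < r ->
  [\/ [/\ q = x, x < y & x < z] /\ (p = y /\ r = z \/ p = z /\ r = y),
      [/\ q = y, y < x & y < z] /\ (p = x /\ r = z \/ p = z /\ r = x) |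
      [/\ q = z, z < x & z < y] /\ (p = x /\ r = y \/ p = y /\ r = x)].
Proof.
rewrite /= /min3 /max3 /med3 /sort /=.
rewrite !minEle !maxEle.
case: (ltgtP x y) => xy; case: (ltgtP y z) => yz; case: (ltgtP x z) => xz;
  rewrite /= ?xy ?yz ?xz ?lexx ?ltxx /= ?(ltW xy) ?(ltW yz) ?(ltW xz) ?(lt_geF xy) ?(lt_geF yz) ?(lt_geF xz) /=.
all: try by lra.
all: move=> h; try by [lra|rewrite ltxx in h].
all: try by (constructor 1; split => //; auto).
all: try by (constructor 2; split => //; auto).
all: try by (constructor 3; split => //; auto).
Qed.
End order_statistics.

(** * The tilted kernel at [-oo], for each position of the smallest parameter *)

Section kernel_tail.
Context {R : realType}.
Local Notation mu := (@lebesgue_measure R).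
Local Notation L1 F := (mu.-integrable setT (EFin \o F)).
Implicit Types (a b w v : R) (u : nat -> R).

Let c0 : rgamma 2^-1 != 0 :> R.
Proof. by rewrite gt_eqF// rgamma_gt0// invr_gt0. Qed.

Let mb w := measurable_bker w.
Let mg a := @measurable_gker R a.

Let gker0_norm v : `|gker 0 v| <= 1.
Proof. by rewrite (ger0_norm (gker_ge0 0 v)) gker0_le1. Qed.

Lemma cvg_subrNy u w : u n @[n --> \oo] --> -oo -> u n - w @[n --> \oo] --> -oo.
Proof.
move=> uy; apply/cvgrNyPle => A; move/cvgrNyPle : uy => /(_ (A + w)).
by apply: filterS => n; rewrite lerBlDr.
Qed.

Lemma convol_cvg_cst (F G : R -> R) (A l : R) u : L1 F -> measurable_fun setT G ->
  (forall x, `|G x| <= A) ->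
  (forall w, G (u n - w) @[n --> \oo] --> l) ->
    convol F G (u n) @[n --> \oo] --> (\int[mu]_w F w) * l.
Proof.
by move=> hF mG GA lim; rewrite -RintegralZr//; exact: (convol_cvg (g := cst l) hF mG GA).
Qed.

Lemma hker_cvg_beta0 a w u : 0 < a -> 0 < w -> u n @[n --> \oo] --> -oo ->
  hker a 0 w (u n) @[n --> \oo] --> rgamma a * rgamma w / rgamma (w + 2^-1).
Proof.
move=> a0 w0 uy; have [hU U0 _] := convol_bker_gker a0 w0.
have -> : rgamma a * rgamma w / rgamma (w + 2^-1) =
    (rgamma 2^-1)^-1 * ((\int[mu]_v convol (bker w) (gker a) v) * 1).
  have [C C0 hC] := gker_bounded (ltW a0).
  rewrite (Rintegral_convol (bker_L1 w0) (gker_L1 a0) (bker_ge0 w) hC) Rintegral_bker// mulr1.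
  by rewrite -/(rgamma a) -!mulrA mulKf// mulrC -mulrA.
apply: cvgMr; apply: (convol_cvg_cst hU (mg 0) gker0_norm) => v.
exact: (gker_cvgNy (cvg_subrNy v uy)).1.
Qed.

(** Here [gker 0] sits in the inner convolution, which is then bounded with a limit but not
    integrable. Commuting the outer convolution makes it the translated factor. *)
Lemma hker_cvg_alpha0 b w u : 0 < b -> 0 < w -> u n @[n --> \oo] --> -oo ->
  hker 0 b w (u n) @[n --> \oo] --> rgamma b * rgamma w / rgamma (w + 2^-1).
Proof.
move=> b0 w0 uy.
have mU : measurable_fun setT (convol (bker w) (gker 0)).
  exact: (convol_measurable (mb w) (mg 0) (bker_ge0 w) (gker_ge0 0)).
have -> : rgamma b * rgamma w / rgamma (w + 2^-1) =
    (rgamma 2^-1)^-1 * (rgamma b * \int[mu]_v bker w v).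
  by rewrite Rintegral_bker// mulrCA -!mulrA mulKf.
apply: cvgMr; under eq_fun do rewrite (convolC _ mU (mg b)).
apply: (convol_cvg_cst (gker_L1 b0) mU).
  exact: (fun x => convol_le x (bker_L1 w0) (bker_ge0 w) (mg 0) gker0_norm).
move=> v; rewrite -[X in _ --> X]mulr1.
apply: (convol_cvg_cst (bker_L1 w0) (mg 0) gker0_norm) => v'.
exact: (gker_cvgNy (cvg_subrNy v' (cvg_subrNy v uy))).1.
Qed.

(** [bker 0] is split into the indicator of [v < 0] and an integrable remainder [D]. Convolved with
    [gker a], the remainder tends to 0 at [-oo] and the indicator to the full mass [rgamma a];
    convolving with [gker b] multiplies by [rgamma b]. *)
Lemma hker_cvg_omega0 a b u : 0 < a -> 0 < b -> u n @[n --> \oo] --> -oo ->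
  hker a b 0 (u n) @[n --> \oo] --> rgamma a * rgamma b / rgamma 2^-1.
Proof.
move=> a0 b0 uy; have [C C0 hC] := gker_bounded (ltW a0).
have nC v : `|gker a v| <= C by rewrite (ger0_norm (gker_ge0 a v)); case/andP: (hC v).
pose ind (v : R) : R := (0 < - v)%R%:R.
have ind0 v : 0 <= ind v by rewrite ler0n.
have ind1 v : `|ind v| <= 1 by rewrite (ger0_norm (ind0 v)) /ind; case: ltP.
have mind : measurable_fun setT ind.
  by rewrite /ind; meas; exact: oppr_measurable.
pose D v := bker 0 v - ind v.
have mD : measurable_fun setT D by have := mb 0; rewrite /D => m; meas.
have D0 v : 0 <= D v by case/andP: (bker0_bound v).
have hD : L1 D.
  apply: (L1_le mD _ (bker_L1 ltr01)) => v; rewrite (ger0_norm (D0 v)).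
  by case/andP: (bker0_bound v).
have UE v : convol (bker 0) (gker a) v = convol D (gker a) v + convol (gker a) ind v.
  rewrite (convolC v (mg a) mind) -RintegralD//; last 2 first.
  - exact: (convol_integrable v hD (mg a) nC).
  - have := L1_reflect v (convol_integrable v (gker_L1 a0) mind ind1).
    congr (_.-integrable _ _); apply/funext => w /=; rewrite subKr; congr EFin; exact: mulrC.
  by apply: eq_Rintegral => w _; rewrite -mulrDl /D subrK.
have mU : measurable_fun setT (convol (bker 0) (gker a)).
  exact: (convol_measurable (mb 0) (mg a) (bker_ge0 0) (gker_ge0 a)).
have Ule v : `|convol (bker 0) (gker a) v| <= C * (\int[mu]_v D v) + 1 * rgamma a.
  rewrite UE (le_trans (ler_normD _ _))// lerD//.
    exact: convol_le.
  exact: (convol_le v (gker_L1 a0) (gker_ge0 a) mind ind1).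
rewrite mulrC; apply: cvgMr; rewrite mulrC.
under eq_fun do rewrite (convolC _ mU (mg b)).
apply: (convol_cvg_cst (gker_L1 b0) mU Ule) => v; under eq_fun do rewrite UE.
rewrite -[rgamma a]add0r; apply: cvgD.
  rewrite -[X in _ --> X](mulr0 (\int[mu]_v D v)); apply: (convol_cvg_cst hD (mg a) nC) => v'.
  exact: (gker_cvgNy (cvg_subrNy v' (cvg_subrNy v uy))).2 _ a0.
rewrite -[rgamma a]mulr1; apply: (convol_cvg_cst (gker_L1 a0) mind ind1) => v'.
apply: cvg_near_cst; have /cvgrNyPlt := cvg_subrNy v' (cvg_subrNy v uy).
by move=> /(_ 0); apply: filterS => n h; rewrite /ind oppr_gt0 h.
Qed.

Lemma hker_cvg a b w u : let q := min3 a b w in 0 < a -> 0 < b -> 0 < w -> q < med3 a b w ->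
  u n @[n --> \oo] --> -oo -> expR (- q * u n) * hker a b w (u n) @[n --> \oo] -->
  rgamma (max3 a b w - q) * rgamma (med3 a b w - q) / rgamma (w - q + 2^-1).
Proof.
move=> q a0 b0 w0 + uy; under eq_fun do rewrite (hker_shift _ _ a0 b0 w0).
have p0 (x : R) : q < x -> 0 < x - q by rewrite subr_gt0.
have comm (x y d : R) : x * y / d = y * x / d by rewrite (mulrC x).
case/min3_cases; rewrite -/q => -[[qE + +] [[-> ->]|[-> ->]]]; rewrite -qE => /p0 h1 /p0 h2;
  rewrite subrr.
- exact: hker_cvg_alpha0.
- by rewrite comm; exact: hker_cvg_alpha0.
- exact: hker_cvg_beta0.
- by rewrite comm; exact: hker_cvg_beta0.
- by rewrite add0r; exact: hker_cvg_omega0.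
- by rewrite add0r comm; exact: hker_cvg_omega0.
Qed.

(** Boundedness: the limit at [-oo] settles [v < N], and boundedness of [hker] with the tilt the
    rest. Decay: [expR v * eta v] is [hker] with parameters raised by [1 - q], all still positive,
    hence bounded. *)
Lemma hker_tail_bound a b w : let q := min3 a b w in 0 < a -> 0 < b -> 0 < w -> q < med3 a b w ->
  exists A, forall v, expR (- q * v) * hker a b w v <= A /\
    expR (- q * v) * hker a b w v <= A * expR (- v).
Proof.
move=> q a0 b0 w0 qr; set eta := fun v => expR (- q * v) * hker a b w v.
have [_ _ h0 [B hB]] := hker_density a0 b0 w0.
have [qa qb qw] : [/\ q <= a, q <= b & q <= w] by rewrite /q /min3 !ge_min !lexx !orbT.
have q0 : 0 < q by rewrite /q /min3 !lt_min a0 b0 w0.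
have B0 : 0 <= B := le_trans (h0 0) (hB 0).
have [a1 b1 w1] : [/\ 0 < a + (1 - q), 0 < b + (1 - q) & 0 < w + (1 - q)] by split; lra.
have [_ _ h1 [B1 hB1]] := hker_density a1 b1 w1.
have B10 : 0 <= B1 := le_trans (h1 0) (hB1 0).
have lim : eta x @[x --> -oo] --> rgamma (max3 a b w - q) * rgamma (med3 a b w - q) / rgamma (w - q + 2^-1).
  by apply/cvg_ninftyP => u uy; exact: hker_cvg.
move: lim; set l := (X in _ --> X) => lim.
have [N [_ hN]] := cvgr_lt _ lim _ (ltr_pwDr ltr01 (ler_norm l)).
exists (`|l| + 1 + expR (- q * N) * B + B1) => v.
have E0 : 0 <= expR (- q * N) * B by rewrite mulr_ge0 ?expR_ge0.
have L0 : 0 <= `|l| + 1 by rewrite addr_ge0.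
rewrite -/(eta v); split.
  have [vN|Nv] := ltP v N; first by have := hN _ vN; lra.
  have : eta v <= expR (- q * N) * B by rewrite ler_pM ?expR_ge0// ler_expR ler_nM2l ?oppr_lt0.
  by lra.
have -> : eta v = hker (a + (1 - q)) (b + (1 - q)) (w + (1 - q)) v * expR (- v).
  rewrite -hker_shift// mulrAC -expRD; congr (expR _ * _); ring.
by rewrite ler_wpM2r ?expR_ge0//; have := hB1 v; lra.
Qed.
End kernel_tail.

(** * Transfer of the tail asymptotics to the bound *)

Section outage_tail.
Context {R : realType}.

Lemma ln_Phi_cvgNy (M : nat) (alpha beta A0 hl Rt : R) : (0 < M)%N -> 0 < alpha -> 0 < beta ->
  0 < A0 -> 0 < hl -> 0 < Rt -> ln (Phi M alpha beta A0 hl Rt gbar) @[gbar --> +oo] --> -oo.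
Proof.
move=> M0 a0 b0 A00 hl0 Rt0; apply/cvgrNyPle => B.
set k := ln (alpha * beta / (A0 * hl)); set A := ln (2 `^ (2 * Rt / M%:R) - 1).
near=> gbar; have g0 : 0 < gbar by near: gbar; exact: nbhs_pinfty_gt.
have [_ _ ->] := ln_Phi a0 b0 A00 hl0 g0 M0 Rt0; rewrite -/k -/A.
suff : 2 * (k - B) + A - ln (capacity_const R) <= ln gbar by lra.
by rewrite -ler_expR lnK ?posrE//; near: gbar; exact: nbhs_pinfty_ge.
Unshelve. all: by end_near.
Qed.

Lemma outage_ir_ub_equiv (m : nat) (alpha beta omega A0 hl Rt : R) :
  0 < alpha -> 0 < beta -> 0 < omega -> 0 < A0 -> 0 < hl -> 0 < Rt ->
  min3 alpha beta omega < med3 alpha beta omega ->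
  outage_ir_ub m.+1 alpha beta omega A0 hl Rt gbar /
   outage_ir_asym m.+1 alpha beta omega A0 hl Rt gbar @[gbar --> +oo] --> (1 : R).
Proof.
move=> a0 b0 w0 A00 hl0 Rt0 qr.
set q := min3 alpha beta omega in qr *.
set p := max3 alpha beta omega; set r := med3 alpha beta omega in qr *.
have qw : q <= omega by rewrite /q /min3 !ge_min lexx !orbT.
have q0 : 0 < q by rewrite /q /min3 !lt_min a0 b0 w0.
have qp : q < p.
  by rewrite /p; case: (min3_cases qr); rewrite -/q => -[[-> ? ?] [[-> _]|[-> _]]].
pose C := rgamma (p - q) * rgamma (r - q) / rgamma (omega - q + 2^-1).
have pq0 : 0 < p - q by lra.
have rq0 : 0 < r - q by lra.
have wq0 : 0 < omega - q + 2^-1 by lra.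
have C0 : 0 < C by rewrite divr_gt0 ?mulr_gt0 ?rgamma_gt0.
have dh := hker_density a0 b0 w0; set h := hker alpha beta omega in dh.
have [A hA] := hker_tail_bound a0 b0 w0 qr.
have := @cumul_asymptotics _ h q C A dh q0 (fun u uy => hker_cvg a0 b0 w0 qr uy)
  (fun v => (hA v).1) (fun v => (hA v).2) m.
set T := (fun x => _ / _); set c := _ / _ => Tc.
have c0 : 0 < c by rewrite divr_gt0 ?exprn_gt0// mulr_gt0// ltr0n fact_gt0.
have lphi := @ln_Phi_cvgNy m.+1 alpha beta A0 hl Rt isT a0 b0 A00 hl0 Rt0.
pose x gbar := - (m.+1%:R * ln (Phi m.+1 alpha beta A0 hl Rt gbar)).
have xy : x gbar @[gbar --> +oo] --> +oo.
  apply/cvgryPge => B; move/cvgrNyPle : lphi => /(_ (- B / m.+1%:R)).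
  by apply: filterS => g; rewrite ler_pdivlMr ?ltr0n// /x mulrC; lra.
rewrite -(divff (lt0r_neq0 c0)).
(* The ratio equals [T (x g) / c] once [0 < g] and [ln Phi < 0]. The powers of [K] cancel, and the
   factor M^(M - 1) of the asymptotic form comes from raising [x g = - (M * ln Phi)] to the power M
   - 1. *)
apply: cvg_trans (cvgM (cvg_comp x T xy Tc) (cvg_cst c^-1)).
apply: near_eq_cvg; near=> g => /=.
have g0 : 0 < g by near: g; exact: nbhs_pinfty_gt.
have l0 : ln (Phi m.+1 alpha beta A0 hl Rt g) < 0.
  by near: g; move/cvgrNyPlt : lphi => /(_ 0).
have [_ phi0 _] := ln_Phi a0 b0 A00 hl0 g0 (ltn0Sn m) Rt0.
have [_ ->] := @outage_ir_le R alpha beta omega A0 hl g a0 b0 w0 A00 hl0 g0 m.+1 Rt (ltn0Sn m) Rt0.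
rewrite /outage_ir_asym -/q -/p -/r /T /x /c /powR gt_eqF//= opprK -/h.
rewrite !gammaRE//.
set L := ln _; set t := convol _ _ _; set K := Num.sqrt omega / _.
have -> : Num.sqrt omega * rgamma (p - q) * rgamma (r - q) /
    (rgamma alpha * rgamma beta * rgamma (omega - q + 2^-1)) = K * C.
  by rewrite /K /C mulf_div !mulrA.
have -> : q * - (m.+1%:R * L) = - (m.+1%:R * q * L) by ring.
rewrite expRN -mulrN [(K * C) ^+ _]exprMn [(_ * - L) ^+ m]exprMn.
have K0 : 0 < K by rewrite divr_gt0 ?sqrtr_gt0// mulr_gt0 ?rgamma_gt0.
have L0 : 0 < - L by rewrite oppr_gt0.
have /lt0r_neq0 := exprn_gt0 m.+1 K0; have /lt0r_neq0 := exprn_gt0 m.+1 C0.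
have /lt0r_neq0 := exprn_gt0 m L0; have /lt0r_neq0 := exprn_gt0 m (ltr0Sn R m).
have /lt0r_neq0 : 0 < m`!%:R :> R by rewrite ltr0n fact_gt0.
move: (lt0r_neq0 (expR_gt0 (m.+1%:R * q * L))) (lt0r_neq0 q0).
move: (expR _) (K ^+ _) (C ^+ _) ((- L) ^+ _) (m.+1%:R ^+ _) (m`!%:R) =>
  e k' c' l n f e_ q_ f_ n_ l_ c_ k_.
by field; rewrite e_ q_ f_ n_ l_ c_ k_.
Unshelve. all: by end_near.
Qed.
End outage_tail.

Theorem proposition5 (R : realType) (M : nat)
    (alpha beta omega A0 hl Rt : R) :
  (1 <= M)%N ->
  0 < alpha -> 0 < beta -> 0 < omega -> 0 < A0 -> 0 < hl -> 0 < Rt ->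
  min3 alpha beta omega < med3 alpha beta omega ->
  (forall gbar : R, 0 < gbar ->
     (outage_ir M alpha beta omega A0 hl Rt gbar <=
      (outage_ir_ub M alpha beta omega A0 hl Rt gbar)%:E)%E) /\
  (outage_ir_ub M alpha beta omega A0 hl Rt gbar /
   outage_ir_asym M alpha beta omega A0 hl Rt gbar @[gbar --> +oo] --> (1 : R)).
Proof.
move=> M1 a0 b0 w0 A00 hl0 Rt0 qr; split=> [gbar g0|].
  exact: (outage_ir_le a0 b0 w0 A00 hl0 g0 M1 Rt0).1.
by case: M M1 => // m _; exact: outage_ir_ub_equiv.
Qed.
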